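(* Let $1<p\leq q<\infty$. Let $\sigma$ and $\omega$ be locally finite Borel measures on $\mathbb{R}^d$. Let $C$ and $D$ be Banach lattices, and assume that $C$ and $D^*$ each have the dyadic Hardy--Littlewood property. Let $\mathcal{D}$ be a finite collection of dyadic cubes on $\mathbb{R}^d$ and let $\{\lambda_Q:C\to D\}_{Q\in\mathcal{D}}$ be positive operators. Define $$T_\lambda(f\sigma):=\sum_{Q\in\mathcal{D}}\lambda_Q\Big(\int_Q f\,\mathrm{d}\sigma\Big)1_Q ,$$ and, for $R\in\mathcal{D}$, $$T_{\lambda,R}(f\sigma):=\sum_{Q\in\mathcal{D}:\,Q\subseteq R}\lambda_Q\Big(\int_Q f\,\mathrm{d}\sigma\Big)1_Q,\qquad T^*_{\lambda,R}(g\omega):=\sum_{Q\in\mathcal{D}:\,Q\subseteq R}\lambda_Q^*\Big(\int_Q g\,\mathrm{d}\omega\Big)1_Q .$$ Let $\mathfrak{T}$ and $\mathfrak{T}^*$ be the least constants such that $$\|T_{\lambda,R}(f\sigma)\|_{L^q_D(\omega)}\leq \mathfrak{T}\,\|f\|_{L^\infty_C(R,\sigma)}\,\sigma(R)^{1/p},\qquad \|T^*_{\lambda,R}(g\omega)\|_{L^{p'}_{C^*}(\sigma)}\leq \mathfrak{T}^*\,\|g\|_{L^\infty_{D^*}(R,\omega)}\,\omega(R)^{1/q'}$$ for every $R\in\mathcal{D}$, every $f\in L^\infty_C(R,\sigma)$, and every $g\in L^\infty_{D^*}(R,\omega)$. Then $$\max\{\mathfrak{T},\mathfrak{T}^*\}\leq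 \|T_\lambda(\,\cdot\,\sigma)\|_{L^p_C(\sigma)\to L^q_D(\omega)}\leq K_{p,q}\Big(\|\bar M\|_{L^p_C\to L^p_C}\,\mathfrak{T}+\|\bar M\|_{L^{q'}_{D^*}\to L^{q'}_{D^*}}\,\mathfrak{T}^*\Big),$$ where $K_{p,q}$ is a constant depending only on $p$ and $q$.
   Context: A Banach lattice $(E,|\cdot|_E,\leq)$ is a real Banach space with a compatible lattice order; $E_+=\{e\in E:e\ge 0\}$. Its dual $E^*$ is a Banach lattice under the order $e^*\geq 0$ iff $e^*(e)\geq 0$ for all $e\in E_+$. A linear operator $\lambda:C\to D$ between Banach lattices is positive if $c\ge 0$ implies $\lambda c\ge 0$; $\lambda^*:D^*\to C^*$ denotes its adjoint. $L^p_E(\mu)$ is the Lebesgue--Bochner space with norm $(\int |f|_E^p\,\mathrm{d}\mu)^{1/p}$; $L^p_E$ is the case of Lebesgue measure on $\mathbb{R}^d$. $L^\infty_E(R,\mu)$ is the $E$-valued $L^\infty$ space on $R$ with respect to $\mu$. $p'$ and $q'$ are conjugate exponents. Operator norms: $\|T_\lambda(\cdot\,\sigma)\|_{L^p_C(\sigma)\to L^q_D(\omega)}$ is the least $K$ with $\|T_\lambda(f\sigma)\|_{L^q_D(\omega)}\le K\|f\|_{L^p_C(\sigma)}$ for all $f\in L^p_C(\sigma)$. For a finite collection $\mathcal{D}'$ of dyadic cubes, the dyadic lattice Hardy--Littlewood maximal operator is $\bar M_{\mathcal{D}'}f:=\sup_{Q\in\mathcal{D}'}\langle f\rangle_Q1_Q$,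 where $\langle f\rangle_Q=\frac1{|Q|}\int_Q f\,\mathrm{d}x$ and the supremum is taken in the lattice order of $E$. $\|\bar M\|_{L^p_E\to L^p_E}$ denotes $\sup_{\mathcal{D}'}\|\bar M_{\mathcal{D}'}\|_{L^p_E\to L^p_E}$ over all finite collections $\mathcal{D}'$ of dyadic cubes. $E$ has the dyadic Hardy--Littlewood property if this is finite for some $p\in(1,\infty)$ (it is a known fact that then it is finite for every $p\in(1,\infty)$). *)

(* Defs.v *)
From HB Require Import structures.
From mathcomp Require Import all_boot all_order all_algebra finmap.
From mathcomp Require Import all_classical all_reals all_analysis.
From mathcomp Require Import ring lra.

Set Implicit Arguments.
Unset Strict Implicit.
Unset Printing Implicit Defensive.

Import Order.TTheory GRing.Theory Num.Theory.
Import numFieldNormedType.Exports.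

Local Open Scope classical_set_scope.
Local Open Scope ring_scope.

(* The lattice order is given by plain operations: Hierarchy Builder rejects a
   structure inheriting both Order.Lattice and Zmodule, since realDomainType
   already inherits from both without a declared join. *)
HB.mixin Record CompleteNormedModule_isBanachLattice (R : realType) E
    & CompleteNormedModule R E := {
  lle : E -> E -> Prop ;
  ljoin : E -> E -> E ;
  lmeet : E -> E -> E ;
  llexx : forall x, lle x x ;
  lle_anti : forall x y, lle x y -> lle y x -> x = y ;
  lle_trans : forall y x z, lle x y -> lle y z -> lle x z ;
  ljoin_lle : forall x y z, lle (ljoin x y) z <-> lle x z /\ lle y z ;
  lle_lmeet : forall x y z, lle z (lmeet x y) <-> lle z x /\ lle z y ;
  lleD2r : forall z x y, lle x y -> lle (x + z) (y + z) ;
  lleZ : forall (a : R) x y, 0 <= a -> lle x y -> lle (a *: x) (a *: y) ;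
  lle_norm : forall x y,
    lle (ljoin x (- x)) (ljoin y (- y)) -> `|x| <= `|y|
}.

#[short(type="banachLatticeType")]
HB.structure Definition BanachLattice (R : realType) :=
  {E of CompleteNormedModule R E & CompleteNormedModule_isBanachLattice R E}.

Local Notation "x <=| y" := (lle x y) (at level 70, no associativity).

Definition labs (R : realType) (E : banachLatticeType R) (x : E) : E :=
  ljoin x (- x).

Section banach_lattice_theory.
Context {R : realType} {E : banachLatticeType R}.
Implicit Types (x y z : E) (a : R).

Lemma lle_joinl x y : x <=| ljoin x y.
Proof. by have /ljoin_lle[] := llexx (ljoin x y). Qed.

Lemma lle_joinr x y : y <=| ljoin x y.
Proof. by have /ljoin_lle[] := llexx (ljoin x y). Qed.

Lemma lmeet_llel x y : lmeet x y <=| x.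
Proof. by have /lle_lmeet[] := llexx (lmeet x y). Qed.

Lemma lmeet_ller x y : lmeet x y <=| y.
Proof. by have /lle_lmeet[] := llexx (lmeet x y). Qed.

Lemma lleD x y z t : x <=| y -> z <=| t -> x + z <=| y + t.
Proof.
move=> xy zt; apply: (lle_trans (y + z)); first exact: lleD2r.
by rewrite ![y + _]addrC; exact: lleD2r.
Qed.

Lemma lsub_ge0 x y : 0 <=| y - x <-> x <=| y.
Proof.
split=> [/(lleD2r x)|/(lleD2r (- x))]; first by rewrite add0r subrK.
by rewrite subrr.
Qed.

Lemma lleN x y : x <=| y -> - y <=| - x.
Proof. by move=> /lsub_ge0 h; apply/lsub_ge0; rewrite opprK addrC. Qed.

Lemma lleZ_ge0 a x : 0 <= a -> 0 <=| x -> 0 <=| a *: x.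
Proof. by move=> a0 /(lleZ _ _ _ a0); rewrite scaler0. Qed.

Lemma ladd_ge0 x y : 0 <=| x -> 0 <=| y -> 0 <=| x + y.
Proof. by move=> x0 y0; rewrite -(addr0 0); exact: lleD. Qed.

Lemma labs_ge x : x <=| labs x. Proof. exact: lle_joinl. Qed.

Lemma labs_geN x : - x <=| labs x. Proof. exact: lle_joinr. Qed.

Lemma labs_le x y : x <=| y -> - x <=| y -> labs x <=| y.
Proof. by move=> ? ?; apply/ljoin_lle. Qed.

Lemma labs_ge0 x : 0 <=| labs x.
Proof.
have h : 0 <=| 2 *: labs x.
  rewrite scaler_nat mulr2n -(subrr x).
  exact: lleD (labs_ge x) (labs_geN x).
have /lleZ_ge0 : (0 : R) <= 2^-1 by rewrite invr_ge0.
by move=> /(_ _ h); rewrite scalerA mulVf// scale1r.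
Qed.

Lemma labs_id x : 0 <=| x -> labs x = x.
Proof.
move=> x0; apply: lle_anti; last exact: labs_ge.
apply: labs_le; first exact: llexx.
by apply: (lle_trans 0) => //; rewrite -oppr0; exact: lleN.
Qed.

Lemma labs_norm x y : labs x <=| labs y -> `|x| <= `|y|.
Proof. exact: lle_norm. Qed.

Lemma norm_labs x : `|labs x| = `|x|.
Proof.
have h : labs (labs x) = labs x by exact/labs_id/labs_ge0.
by apply/le_anti/andP; split; apply: labs_norm; rewrite h; exact: llexx.
Qed.

Lemma norm_lle x y : labs x <=| y -> `|x| <= `|y|.
Proof.
move=> xy; apply: labs_norm.
exact: lle_trans xy (labs_ge y).
Qed.

Lemma norm_lle0 x y : 0 <=| x -> x <=| y -> `|x| <= `|y|.
Proof. by move=> x0 xy; apply: norm_lle; rewrite labs_id. Qed.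

Definition lpos x : E := ljoin x 0.
Definition lneg x : E := ljoin (- x) 0.

Lemma lpos_ge0 x : 0 <=| lpos x. Proof. exact: lle_joinr. Qed.

Lemma lneg_ge0 x : 0 <=| lneg x. Proof. exact: lle_joinr. Qed.

Lemma ljoinD2r x y z : ljoin x y + z = ljoin (x + z) (y + z).
Proof.
apply: lle_anti; last first.
  by apply/ljoin_lle; split; apply: lleD2r; [exact: lle_joinl|exact: lle_joinr].
have : ljoin x y <=| ljoin (x + z) (y + z) - z.
  apply/ljoin_lle; split; apply/lsub_ge0.
    by rewrite -addrA -opprD [z + x]addrC; apply/lsub_ge0; exact: lle_joinl.
  by rewrite -addrA -opprD [z + y]addrC; apply/lsub_ge0; exact: lle_joinr.
by move=> /(lleD2r z); rewrite subrK.
Qed.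

Lemma lposBneg x : lpos x - lneg x = x.
Proof.
apply/eqP; rewrite subr_eq addrC /lneg ljoinD2r addNr add0r; apply/eqP.
by apply: lle_anti; apply/ljoin_lle; split;
  [exact: lle_joinr|exact: lle_joinl|exact: lle_joinr|exact: lle_joinl].
Qed.

Lemma lpos_le_labs x : lpos x <=| labs x.
Proof. by apply/ljoin_lle; split; [exact: labs_ge|exact: labs_ge0]. Qed.

Lemma lneg_le_labs x : lneg x <=| labs x.
Proof. by apply/ljoin_lle; split; [exact: labs_geN|exact: labs_ge0]. Qed.

Lemma lposDneg x : lpos x + lneg x = labs x.
Proof.
apply: lle_anti.
  apply/lsub_ge0.
  have -> : labs x - (lpos x + lneg x) = (labs x - lneg x) - lpos x.
    by rewrite opprD addrA addrAC.
  apply/lsub_ge0/ljoin_lle; split; last first.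
    by apply/lsub_ge0; exact: lneg_le_labs.
  apply/lsub_ge0.
  have -> : labs x - lneg x - x = labs x - (x + lneg x).
    by rewrite opprD addrA addrAC.
  apply/lsub_ge0; rewrite addrC /lneg ljoinD2r addNr add0r.
  by apply/ljoin_lle; split; [exact: labs_ge0|exact: labs_ge].
apply: labs_le.
  by rewrite -[X in X <=| _](addr0 x); apply: lleD; [exact: lle_joinl|exact: lle_joinr].
by rewrite -[X in X <=| _](add0r (- x)); apply: lleD; [exact: lle_joinr|exact: lle_joinl].
Qed.

(* Riesz decomposition property *)
Lemma lriesz x y z : 0 <=| x -> 0 <=| y -> 0 <=| z -> z <=| x + y ->
  exists u v, [/\ 0 <=| u, u <=| x, 0 <=| v, v <=| y & z = u + v].
Proof.
move=> x0 y0 z0 zxy; exists (lmeet x z), (z - lmeet x z); split.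
- exact/lle_lmeet.
- exact: lmeet_llel.
- by apply/lsub_ge0; exact: lmeet_ller.
- apply/lsub_ge0.
  have -> : y - (z - lmeet x z) = lmeet x z - (z - y).
    by rewrite !opprB addrCA.
  apply/lsub_ge0/lle_lmeet; split; apply/lsub_ge0.
    by rewrite opprB addrA; apply/lsub_ge0.
  by rewrite opprB addrC subrK.
- by rewrite addrC subrK.
Qed.

End banach_lattice_theory.

Definition cont_linear (R : realType) (E : banachLatticeType R) :
    {pred E -> R^o} :=
  fun f => `[< linear f /\ continuous f >].

Section cont_linear_closed.
Context {R : realType} {E : banachLatticeType R}.

Let cont_linear_submod : submod_closed (@cont_linear R E).
Proof.
split=> [|a f g /asboolP[lf cf] /asboolP[lg cg]]; apply/asboolP; split.
- by move=> a x y; rewrite /= scaler0 addr0.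
- by move=> x; exact: cvg_cst.
- move=> b x y; change (a * f (b *: x + y) + g (b *: x + y) =
    b * (a * f x + g x) + (a * f y + g y)).
  by rewrite lf lg /GRing.scale/=; ring.
- move=> x; apply: cvgD; last exact: cg.
  by apply: cvgZr; exact: cf.
Qed.

HB.instance Definition _ :=
  GRing.isSubmodClosed.Build R (E -> R^o) (@cont_linear R E)
    cont_linear_submod.

End cont_linear_closed.

Record dual (R : realType) (E : banachLatticeType R) := Dual {
  dual_val :> E -> R^o ;
  dual_valP : dual_val \in @cont_linear R E
}.

HB.instance Definition _ R E := [isSub for @dual_val R E].
HB.instance Definition _ R E := [Choice of @dual R E by <:].
HB.instance Definition _ R E := [SubChoice_isSubLmodule of @dual R E by <:].

Section dual_norm.
Context {R : realType} {E : banachLatticeType R}.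
Implicit Types (f g : dual E) (x y : E) (a M : R).

Lemma dual_linear f : linear f.
Proof. by have /asboolP[] := dual_valP f. Qed.

HB.instance Definition _ f :=
  GRing.isLinear.Build R E R^o _ (dual_val f) (dual_linear f).

Lemma dual_continuous f : continuous f.
Proof. by have /asboolP[] := dual_valP f. Qed.

Lemma dual_eqP f g : f =1 g -> f = g.
Proof. by move=> fg; apply/val_inj/funext. Qed.

Lemma dualDE f g x : (f + g) x = f x + g x. Proof. by []. Qed.
Lemma dualNE f x : (- f) x = - f x. Proof. by []. Qed.
Lemma dualBE f g x : (f - g) x = f x - g x. Proof. by []. Qed.
Lemma dualZE a f x : (a *: f) x = a * f x. Proof. by []. Qed.
Lemma dual0E x : (0 : dual E) x = 0. Proof. by []. Qed.

Lemma dual_bounded f : exists2 M, 0 <= M & forall x, `|f x| <= M * `|x|.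
Proof.
have /linear_boundedP/pinfty_ex_gt0[M M0 h] :=
  continuous_linear_bounded 0 (@dual_continuous f 0).
by exists M; [exact: ltW|exact: h].
Qed.

Definition bounded_dual (phi : E -> R^o) (lphi : linear phi)
  (bphi : exists M, forall x, `|phi x| <= M * `|x|) : dual E.
Proof.
apply: (@Dual R E phi); apply/asboolP; split => //.
pose psi : {linear E -> R^o} := HB.pack phi (GRing.isLinear.Build _ _ _ _ _ lphi).
apply: (@bounded_linear_continuous R E R^o psi); apply/linear_boundedP.
case: bphi => M hM; near=> r => x; apply: le_trans (hM x) _.
by rewrite ler_wpM2r//; near: r; apply: nbhs_pinfty_ge; rewrite num_real.
Unshelve. all: by end_near. Defined.

Lemma bounded_dualE (phi : E -> R^o) lphi bphi x :
  @bounded_dual phi lphi bphi x = phi x.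
Proof. by []. Qed.

Definition dual_norm f : R := sup [set `|f x| | x in [set x : E | `|x| <= 1]].

Let dual_norm_has_sup f : has_sup [set `|f x| | x in [set x : E | `|x| <= 1]].
Proof.
split; first by exists `|f 0|, 0 => //=; rewrite normr0.
have [M M0 fM] := dual_bounded f; exists M => _ [x /= x1 <-].
by apply: le_trans (fM x) _; rewrite ler_piMr.
Qed.

Lemma dual_norm_ge0 f : 0 <= dual_norm f.
Proof.
apply: le_trans (_ : `|f 0| <= _); first exact: normr_ge0.
by apply: sup_upper_bound => //; exists 0 => //=; rewrite normr0.
Qed.

Lemma le_dual_norm f x : `|f x| <= dual_norm f * `|x|.
Proof.
have [->|x0] := eqVneq x 0; first by rewrite linear0 !normr0 mulr0.
have nx0 : 0 < `|x| by rewrite normr_gt0.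
have : `|f (`|x|^-1 *: x)| <= dual_norm f.
  apply: sup_upper_bound => //; exists (`|x|^-1 *: x) => //=.
  by rewrite normrZ normfV normr_id mulVf// gt_eqF.
by rewrite linearZ/= normrZ normfV normr_id mulrC ler_pdivrMr.
Qed.

Lemma dual_norm_le f M : 0 <= M -> (forall x, `|f x| <= M * `|x|) ->
  dual_norm f <= M.
Proof.
move=> M0 fM; apply: ge_sup; first by case: (dual_norm_has_sup f).
by move=> _ [x /= x1 <-]; apply: le_trans (fM x) _; rewrite ler_piMr.
Qed.

Let dual_normD f g : dual_norm (f + g) <= dual_norm f + dual_norm g.
Proof.
apply: dual_norm_le => [|x]; first by rewrite addr_ge0// dual_norm_ge0.
by rewrite dualDE mulrDl (le_trans (ler_normD _ _))// lerD// le_dual_norm.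
Qed.

Let dual_normZ a f : dual_norm (a *: f) = `|a| * dual_norm f.
Proof.
have h b g : dual_norm (b *: g) <= `|b| * dual_norm g.
  apply: dual_norm_le => [|x]; first by rewrite mulr_ge0// dual_norm_ge0.
  by rewrite dualZE normrM -mulrA ler_wpM2l// le_dual_norm.
apply/le_anti; rewrite h/=.
have [->|a0] := eqVneq a 0; first by rewrite normr0 mul0r dual_norm_ge0.
have := h a^-1 (a *: f); rewrite scalerA mulVf// scale1r normfV.
by rewrite mulrC ler_pdivlMr ?normr_gt0// mulrC.
Qed.

Let dual_norm_eq0 f : dual_norm f = 0 -> f = 0.
Proof.
move=> f0; apply: dual_eqP => x; apply/eqP; rewrite -normr_le0.
by have := le_dual_norm f x; rewrite f0 mul0r.
Qed.

HB.instance Definition _ := @Lmodule_isNormed.Build R (dual E) dual_norm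
  dual_normD dual_normZ dual_norm_eq0.

Lemma dual_normE f : `|f| = dual_norm f. Proof. by []. Qed.

Lemma ler_dual f x : `|f x| <= `|f| * `|x|. Proof. exact: le_dual_norm. Qed.

Let dual_cauchy_cvg (F : set_system (dual E)) :
  ProperFilter F -> cauchy F -> cvg F.
Proof.
move=> FF /cauchy_ballP Fc.
have Fc' e : 0 < e -> \forall f & g \near F, `|f - g| < e.
  move=> e0; have := Fc e e0; rewrite -ball_normE; exact.
have cx x : cvg ((fun f : dual E => f x : R) @ F).
  apply: R_complete; apply/cauchy_ballP => e e0.
  have d0 : 0 < e / (`|x| + 1) by rewrite divr_gt0// ltr_wpDl.
  rewrite near_map2.
  apply: filterS (Fc' _ d0) => -[f g]/= fg.
  rewrite -ball_normE /= -dualBE (le_lt_trans (ler_dual _ _))//.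
  apply: le_lt_trans (_ : `|f - g| * (`|x| + 1) < e).
    by rewrite ler_wpM2l// lerDl.
  by rewrite -ltr_pdivlMr// ltr_wpDl.
pose phi x : R^o := lim ((fun f : dual E => f x : R) @ F).
have phiE x : (f x : R) @[f --> F] --> phi x by exact: cx.
have phi_dist f e : 0 <= e -> (\forall g \near F, `|f - g| <= e) ->
    forall x, `|f x - phi x| <= e * `|x|.
  move=> e0 fe x.
  have h : (Num.norm (f x - g x : R)) @[g --> F] --> Num.norm (f x - phi x).
    by apply: cvg_norm; apply: cvgB => //; exact: cvg_cst.
  rewrite -(cvg_lim _ h)//; apply: limr_le; first by apply/cvg_ex; eexists; exact: h.
  apply: filterS fe => g fg; rewrite -dualBE (le_trans (ler_dual _ _))//.
  by rewrite ler_wpM2r.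
have lphi : linear phi.
  move=> a x y; apply: (@cvg_lim R^o) => //.
  have -> : (fun f : dual E => f (a *: x + y) : R) = (fun f => a * f x + f y).
    by apply/funext => f; rewrite dual_linear.
  by apply: cvgD => //; apply: cvgM => //; exact: cvg_cst.
have [f1 f1F] : exists f, \forall g \near F, `|f - g| <= 1.
  have [f hf] := @filter_ex _ F _ _ (nearP_dep (Fc' 1 ltr01)).
  by exists f; apply: filterS hf => g /ltW.
have bphi : exists M, forall x, `|phi x| <= M * `|x|.
  exists (1 + `|f1|) => x; rewrite mulrDl.
  have -> : phi x = - (f1 x - phi x) + f1 x by rewrite opprB subrK.
  apply: le_trans (ler_normD _ _) _; rewrite normrN lerD//.
    exact: phi_dist.
  exact: ler_dual.
apply/cvg_ex; exists (bounded_dual lphi bphi).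
apply/cvgrPdist_le => e e0; have he := nearP_dep (Fc' e e0).
near=> f; have hf : \forall g \near F, `|f - g| < e by near: f; exact: he.
rewrite distrC dual_normE; apply: dual_norm_le => [|x].
  exact: ltW.
rewrite dualBE bounded_dualE; apply: phi_dist; first exact: ltW.
by apply: filterS hf => g /ltW.
Unshelve. all: by end_near. Qed.

HB.instance Definition _ := Uniform_isComplete.Build (dual E) dual_cauchy_cvg.

End dual_norm.

Section dual_lattice.
Context {R : realType} {E : banachLatticeType R}.
Implicit Types (f g h : dual E) (x y z u v : E) (a : R).

Local Hint Resolve lpos_ge0 lneg_ge0 labs_ge0 llexx : core.

Definition dual_le f g : Prop := forall x, 0 <=| x -> f x <= g x.

(* Riesz-Kantorovich formula for the positive part of a functional on E_+ *)
Let ppart f x : R := sup [set (f y : R) | y in [set y | 0 <=| y /\ y <=| x]].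

Let ppart_has_sup f x : 0 <=| x ->
  has_sup [set (f y : R) | y in [set y | 0 <=| y /\ y <=| x]].
Proof.
move=> x0; split; first by exists (f 0 : R), 0 => //=; split => //; exact: llexx.
exists (`|f| * `|x|) => _ [y /= [y0 yx] <-].
apply: le_trans (ler_norm _) _; apply: le_trans (ler_dual _ _) _.
by rewrite ler_wpM2l//; exact: norm_lle0.
Qed.

Let ppart_ub f x y : 0 <=| y -> y <=| x -> f y <= ppart f x.
Proof.
move=> y0 yx; apply: sup_upper_bound; last by exists y.
exact/ppart_has_sup/(lle_trans y).
Qed.

Let ppart_le f x (M : R) : 0 <=| x ->
  (forall y, 0 <=| y -> y <=| x -> f y <= M) -> ppart f x <= M.
Proof.
move=> x0 fM; apply: ge_sup; first by case: (ppart_has_sup f x0).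
by move=> _ [y /= [y0 yx] <-]; exact: fM.
Qed.

Let ppart_ge0 f x : 0 <=| x -> 0 <= ppart f x.
Proof.
by move=> x0; have := ppart_ub f (llexx 0) x0; rewrite linear0.
Qed.

Let ppartD f x y : 0 <=| x -> 0 <=| y ->
  ppart f (x + y) = ppart f x + ppart f y.
Proof.
move=> x0 y0; have xy0 := ladd_ge0 x0 y0; apply/le_anti/andP; split.
  apply: ppart_le => // z z0 /(lriesz x0 y0 z0)[u [v [u0 ux v0 vy ->]]].
  by rewrite linearD; apply: lerD; exact: ppart_ub.
rewrite -lerBrDr; apply: ppart_le => // u u0 ux.
rewrite lerBrDr -lerBrDl; apply: ppart_le => // v v0 vy.
rewrite lerBrDl -[leLHS]linearD; apply: ppart_ub; first exact: ladd_ge0.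
exact: lleD.
Qed.

Let ppartZ f a x : 0 <= a -> 0 <=| x -> ppart f (a *: x) = a * ppart f x.
Proof.
have h b y : 0 < b -> 0 <=| y -> ppart f (b *: y) <= b * ppart f y.
  move=> b0 y0; apply: ppart_le => [|z z0 zy]; first exact: lleZ_ge0 (ltW b0) y0.
  have b'0 : 0 <= b^-1 by rewrite invr_ge0 ltW.
  rewrite -ler_pdivrMl// -[leLHS]linearZ; apply: ppart_ub.
    exact: lleZ_ge0.
  have := lleZ _ _ _ b'0 zy.
  by rewrite scalerA mulVf ?gt_eqF// scale1r.
rewrite le_eqVlt => /predU1P[<- x0|a0 x0].
  rewrite scale0r mul0r; apply/le_anti/andP; split.
    apply: ppart_le => [|y y0 yl0]; first exact: llexx.
    by rewrite (lle_anti _ _ yl0 y0) linear0.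
  exact/ppart_ge0/llexx.
apply/le_anti; rewrite h//=.
have := h a^-1 (a *: x); rewrite invr_gt0 => /(_ a0 (lleZ_ge0 (ltW a0) x0)).
by rewrite scalerA mulVf ?gt_eqF// scale1r ler_pdivlMl.
Qed.

Let ppart0 f : ppart f 0 = 0.
Proof.
by have := ppartZ f (lexx 0) (llexx 0); rewrite scale0r mul0r.
Qed.

Let phi f x : R^o := ppart f (lpos x) - ppart f (lneg x).

Let phiB f u v : 0 <=| u -> 0 <=| v -> phi f (u - v) = ppart f u - ppart f v.
Proof.
move=> u0 v0; rewrite /phi.
have : lpos (u - v) + v = u + lneg (u - v).
  by rewrite -[X in X + v](subrK (lneg (u - v))) lposBneg addrAC subrK.
move=> /(congr1 (ppart f)); rewrite !ppartD// => e.
by rewrite -[ppart f (lpos _)](addrK (ppart f v)) e addrAC addrK.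
Qed.

Let phi_linear f : linear (phi f).
Proof.
move=> a x y.
have phiD u v : phi f (u + v) = phi f u + phi f v.
  rewrite -{1}(lposBneg u) -{1}(lposBneg v) addrACA -opprD phiB; try exact: ladd_ge0.
  by rewrite !ppartD// /phi opprD addrACA.
rewrite phiD; congr (_ + _).
rewrite -{1}(lposBneg x) scalerBr.
have [a0|/ltW a0] := leP 0 a.
  by rewrite phiB ?ppartZ// -?mulrBr//; exact: lleZ_ge0.
have Na0 : 0 <= - a by rewrite oppr_ge0.
have -> : a *: lpos x - a *: lneg x = - a *: lneg x - (- a) *: lpos x.
  by rewrite !scaleNr opprK addrC.
rewrite phiB ?ppartZ//; try exact: lleZ_ge0.
by rewrite -mulrBr mulNr -mulrN opprB.
Qed.

Let phi_bounded f : exists M, forall x, `|phi f x| <= M * `|x|.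
Proof.
exists `|f| => x; apply: le_trans (ler_normB _ _) _.
rewrite !ger0_norm; try exact: ppart_ge0.
rewrite -ppartD//.
rewrite lposDneg; apply: ppart_le => [|y y0 yx]; first exact: labs_ge0.
apply: le_trans (ler_norm _) _; apply: le_trans (ler_dual _ _) _.
by rewrite -(norm_labs x) ler_wpM2l//; exact: norm_lle0.
Qed.

Definition dual_pos f : dual E := bounded_dual (phi_linear f) (phi_bounded f).

Let dual_posE f x : 0 <=| x -> dual_pos f x = ppart f x.
Proof.
move=> x0; rewrite /dual_pos bounded_dualE -{1}(subr0 x) phiB//.
by rewrite ppart0 subr0.
Qed.

Lemma dual_pos_le f h :
  dual_le (dual_pos f) h <-> dual_le f h /\ dual_le 0 h.
Proof.
split=> [fh|[fh h0] x x0].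
  split=> x x0; apply: le_trans (fh x x0); rewrite dual_posE//.
    by apply: ppart_ub => //; exact: llexx.
  exact: ppart_ge0.
rewrite dual_posE//; apply: ppart_le => // y y0 yx.
apply: le_trans (fh y y0) _; rewrite -subr_ge0 -[leRHS]linearB.
exact/h0/lsub_ge0.
Qed.

Definition dual_join f g : dual E := g + dual_pos (f - g).
Definition dual_meet f g : dual E := f - dual_pos (f - g).

Let dual_lexx f : dual_le f f. Proof. by []. Qed.

Let dual_le_anti f g : dual_le f g -> dual_le g f -> f = g.
Proof.
move=> fg gf; apply: dual_eqP => x.
have e y : 0 <=| y -> f y = g y by move=> y0; apply/le_anti; rewrite fg ?gf.
by rewrite -(lposBneg x) !linearB/= !e.
Qed.

Let dual_le_trans g f h : dual_le f g -> dual_le g h -> dual_le f h.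
Proof. by move=> fg gh x x0; exact: le_trans (fg x x0) (gh x x0). Qed.

Let dual_leBrD f g h : dual_le f (h - g) <-> dual_le (g + f) h.
Proof.
by split=> H x x0; have := H x x0; rewrite !(dualBE,dualDE) lerBrDl.
Qed.

Let dual_join_le f g h :
  dual_le (dual_join f g) h <-> dual_le f h /\ dual_le g h.
Proof.
rewrite /dual_join -dual_leBrD dual_pos_le !dual_leBrD.
by rewrite addr0 [g + _]addrC subrK.
Qed.

Let dual_le_meet f g h :
  dual_le h (dual_meet f g) <-> dual_le h f /\ dual_le h g.
Proof.
rewrite /dual_meet dual_leBrD addrC -dual_leBrD dual_pos_le !dual_leBrD addr0.
split=> -[]; last first.
  move=> hf hg; split => // x x0; have := hg x x0.
  by rewrite !(dualBE,dualDE) addrCA gerDl subr_le0.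
move=> h1 hf; split => // x x0; have := h1 x x0.
by rewrite !(dualBE,dualDE) addrCA gerDl subr_le0.
Qed.

Let dual_leD2r h f g : dual_le f g -> dual_le (f + h) (g + h).
Proof. by move=> fg x x0; rewrite !dualDE lerD2r fg. Qed.

Let dual_leZ a f g : 0 <= a -> dual_le f g -> dual_le (a *: f) (a *: g).
Proof. by move=> a0 fg x x0; rewrite !dualZE ler_wpM2l// fg. Qed.

Let dual_le_norm f g :
  dual_le (dual_join f (- f)) (dual_join g (- g)) -> `|f| <= `|g|.
Proof.
move=> fg; set F := dual_join f _ in fg; set G := dual_join g _ in fg.
have [fF NfF] : dual_le f F /\ dual_le (- f) F by apply/dual_join_le.
have Gg x : 0 <=| x -> G x <= `|g| * `|x|.
  move=> x0; rewrite /G /dual_join dualDE dual_posE// -lerBrDl.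
  apply: ppart_le => // y y0 yx; rewrite lerBrDl opprK.
  have -> : (- g) x + (g + g) y = g (y + y - x).
    by rewrite dualNE dualDE [RHS]linearB [in RHS]linearD/= addrC.
  apply: le_trans (ler_norm _) _; apply: le_trans (ler_dual _ _) _.
  rewrite ler_wpM2l//; apply: norm_lle; apply: labs_le; apply/lsub_ge0.
    have -> : x - (y + y - x) = (x - y) + (x - y).
      by rewrite opprB addrA opprD addrACA.
    by apply: ladd_ge0; apply/lsub_ge0.
  by rewrite opprK addrC subrK; exact: ladd_ge0.
have fFx x : `|f x| <= F (labs x).
  rewrite -lposDneg linearD /= ler_norml; apply/andP; split.
    rewrite -[X in _ <= f X]lposBneg linearB/= opprD; apply: lerD.
      by rewrite lerNl; apply: NfF; exact: lpos_ge0.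
    by rewrite lerN2; apply: fF; exact: lneg_ge0.
  rewrite -[X in f X <= _]lposBneg linearB/=; apply: lerD.
    by apply: fF; exact: lpos_ge0.
  by apply: NfF; exact: lneg_ge0.
rewrite {1}dual_normE; apply: dual_norm_le => // x.
apply: le_trans (fFx x) _; apply: le_trans (fg _ (labs_ge0 x)) _.
by rewrite -(norm_labs x); apply: Gg; exact: labs_ge0.
Qed.

HB.instance Definition _ :=
  CompleteNormedModule_isBanachLattice.Build R (dual E)
    dual_lexx dual_le_anti dual_le_trans dual_join_le dual_le_meet
    dual_leD2r dual_leZ dual_le_norm.

Lemma dual_lleE f g : (f <=| g) = (forall x, 0 <=| x -> f x <= g x).
Proof. by []. Qed.

End dual_lattice.

Record positive_operator (R : realType) (C D : banachLatticeType R) :=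
  PositiveOperator {
    posop_val :> {linear C -> D} ;
    posop_ge0 : forall c, lle 0 c -> lle 0 (posop_val c)
  }.

Section positive_operator_theory.
Context {R : realType} {C D : banachLatticeType R}.

Lemma lle0_cvg (u : nat -> C) (x : C) :
  u @ \oo --> x -> (\forall n \near \oo, 0 <=| u n) -> 0 <=| x.
Proof.
move=> ux u0; suff n0 : lneg x = 0.
  by rewrite -(lposBneg x) n0 subr0; exact: lpos_ge0.
apply/eqP; rewrite -normr_le0; apply/ler_addgt0Pr => e e0; rewrite add0r.
have /cvgrPdist_le/(_ e e0) ue := ux.
have [n [un0 une]] : exists n, 0 <=| u n /\ `|x - u n| <= e.
  have [N _ hN] := filterI u0 ue.
  by exists N; exact: (hN N (leqnn N)).
apply: le_trans une; rewrite -(norm_labs (x - u n)).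
apply: norm_lle0; first exact: lneg_ge0.
apply/ljoin_lle; split; last exact: labs_ge0.
apply: lle_trans (labs_geN _); rewrite opprB; apply/lsub_ge0.
by rewrite opprK subrK.
Qed.

Lemma posop_lle (T : positive_operator C D) x y : x <=| y -> T x <=| T y.
Proof.
by move=> /lsub_ge0/(posop_ge0 T); rewrite linearB => /lsub_ge0.
Qed.

Lemma posop_labs (T : positive_operator C D) x : `|T x| <= `|T (labs x)|.
Proof.
apply: norm_lle; apply: labs_le; first exact/posop_lle/labs_ge.
by rewrite -linearN; exact/posop_lle/labs_geN.
Qed.

Lemma posop_bounded (T : positive_operator C D) :
  exists M, forall x, `|T x| <= M * `|x|.
Proof.
apply: contrapT => unb.
have h n : exists y : C, [/\ 0 <=| y, `|y| <= 2^-1 ^+ n & n%:R <= `|T y|].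
  apply: contrapT => hn; apply: unb; exists (n%:R * 2 ^+ n) => x.
  have [->|x0] := eqVneq x 0; first by rewrite linear0 !normr0 mulr0.
  rewrite leNgt; apply/negP => xT; apply: hn.
  have nx : 0 < `|x| by rewrite normr_gt0.
  exists ((`|x|^-1 * 2^-1 ^+ n) *: labs x); split.
  - by apply: lleZ_ge0; [rewrite mulr_ge0// exprn_ge0|exact: labs_ge0].
  - by rewrite normrZ norm_labs ger0_norm ?mulr_ge0 ?exprn_ge0// mulrAC mulVf
      ?gt_eqF// mul1r.
  - rewrite linearZ/= normrZ ger0_norm ?mulr_ge0 ?exprn_ge0//.
    have {1}-> : n%:R = `|x|^-1 * 2^-1 ^+ n * (n%:R * 2 ^+ n * `|x|) :> R.
      by rewrite exprVn; field; rewrite expf_neq0//= normr_eq0.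
    rewrite ler_wpM2l ?mulr_ge0 ?exprn_ge0//.
    exact: le_trans (ltW xT) (posop_labs T x).
pose y n := sval (cid (h n)).
have yP n : [/\ 0 <=| y n, `|y n| <= 2^-1 ^+ n & n%:R <= `|T (y n)|].
  exact: svalP (cid (h n)).
have cy : cvgn (series y).
  apply: normed_cvg; apply: (series_le_cvg (v_ := geometric 1 2^-1)) => //.
  - by move=> n; exact: normr_ge0.
  - by move=> n; apply: geometric_ge0.
  - by move=> n; rewrite -exprn_geometric /=; case: (yP n).
  - by apply: is_cvg_geometric_series; rewrite ger0_norm// invf_lt1// ltr1n.
set S := limn (series y).
have yS n : y n <=| S.
  apply/lsub_ge0; apply: (@lle0_cvg (fun m => series y m - y n)).
    by apply: cvgB => //; exact: cvg_cst.
  near=> m; apply/lsub_ge0.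
  have nm : (n < m)%N by near: m; exact: nbhs_infty_gt.
  rewrite /series/= big_mkord (bigD1 (Ordinal nm))//=.
  apply/lsub_ge0; rewrite addrAC subrr add0r.
  by elim/big_ind : _ => [|u v|i _]; [exact: llexx|exact: ladd_ge0|case: (yP i)].
have : (Num.truncn `|T S|).+1%:R <= `|T S|.
  have [_ _] := yP (Num.truncn `|T S|).+1; move=> /le_trans; apply.
  apply: norm_lle0; first by apply: posop_ge0; case: (yP (Num.truncn `|T S|).+1).
  exact: posop_lle.
by rewrite leNgt truncnS_gt.
Unshelve. all: by end_near. Qed.

Let adjoint_linear (T : positive_operator C D) (g : dual D) :
  linear (g \o T : C -> R^o).
Proof. by move=> a x y /=; rewrite !linearP. Qed.

Let adjoint_bounded (T : positive_operator C D) (g : dual D) :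
  exists M, forall x, `|(g \o T : C -> R^o) x| <= M * `|x|.
Proof.
have [M hM] := posop_bounded T; exists (`|g| * M) => x /=.
by apply: le_trans (ler_dual _ _) _; rewrite -mulrA ler_wpM2l.
Qed.

Definition adjoint (T : positive_operator C D) (g : dual D) : dual C :=
  bounded_dual (adjoint_linear T g) (adjoint_bounded T g).

Lemma adjointE (T : positive_operator C D) (g : dual D) (c : C) :
  adjoint T g c = g (T c).
Proof. by []. Qed.

End positive_operator_theory.

(* The product sigma-algebra of the Borel sets of R, i.e. the Borel
   sigma-algebra of R^d. *)
Definition Rd (R : realType) (d : nat) : Type := d.-tuple (measurableTypeR R).
HB.instance Definition _ R d := Measurable.on (@Rd R d).

Section lebesgue_Rd.
Context {R : realType}.
Local Open Scope ereal_scope.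

Local Notation mR := (measurableTypeR R).

Let consRd n (z : mR * Rd R n) : Rd R n.+1 := [the n.+1.-tuple mR of z.1 :: z.2].

Let measurable_consRd n : measurable_fun setT (@consRd n).
Proof. exact: measurable_cons. Qed.

HB.instance Definition _ n := @isMeasurableFun.Build _ _ _ _ (@consRd n)
  (@measurable_consRd n).

Section step.
Variables (n : nat) (m : {sigma_finite_measure set (Rd R n) -> \bar R}).

Let lebm : {sigma_finite_measure set mR -> \bar R} := lebesgue_measure.

Definition lebesgue_Rd_step : set (Rd R n.+1) -> \bar R :=
  pushforward (lebm \x m) (@consRd n).

Let step0 : lebesgue_Rd_step set0 = 0. Proof. exact: measure0. Qed.

Let step_ge0 A : 0 <= lebesgue_Rd_step A. Proof. exact: measure_ge0. Qed.

Let step_sigma_additive : semi_sigma_additive lebesgue_Rd_step.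
Proof. exact: measure_semi_sigma_additive. Qed.

HB.instance Definition _ := isMeasure.Build _ _ _ lebesgue_Rd_step
  step0 step_ge0 step_sigma_additive.

Let consRdK (A : set mR) (B : set (Rd R n)) :
  @consRd n @^-1` [set x | A (thead x) /\ B [tuple of behead x]] = A `*` B.
Proof.
have e (b : Rd R n) a : [tuple of behead [the n.+1.-tuple mR of a :: b]] = b.
  exact/val_inj.
by apply/seteqP; split => -[a b]/=; rewrite /consRd /= theadE e.
Qed.

Lemma lebesgue_Rd_stepE (A : set mR) (B : set (Rd R n)) :
  measurable A -> measurable B ->
  lebesgue_Rd_step [set x | A (thead x) /\ B [tuple of behead x]] =
  lebesgue_measure A * m B.
Proof.
by move=> mA mB; rewrite /lebesgue_Rd_step /pushforward consRdK product_measure1E.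
Qed.

Let measurable_step (A : set mR) (B : set (Rd R n)) :
  measurable A -> measurable B ->
  measurable [set x : Rd R n.+1 | A (thead x) /\ B [tuple of behead x]].
Proof.
move=> mA mB; apply: measurableI.
  by rewrite -[X in measurable X]setTI; exact: (@measurable_tnth _ mR n.+1 ord0).
by rewrite -[X in measurable X]setTI; exact: (@measurable_behead _ mR n).
Qed.

Let step_sigma_finite : sigma_finite setT lebesgue_Rd_step.
Proof.
have /sigma_finiteP[F [TF ndF Foo]] := sigma_finiteT lebm.
have /sigma_finiteP[G [TG ndG Goo]] := sigma_finiteT m.
exists (fun k => [set x | F k (thead x) /\ G k [tuple of behead x]]).
  rewrite predeqE => x; split => // _.
  have : setT (thead x : mR) by []. rewrite {1}TF => -[i _ Fi].
  have : setT ([tuple of behead x] : Rd R n) by []. rewrite {1}TG => -[j _ Gj].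
  exists (maxn i j) => //; split.
    by apply: (subsetPset _ _ (ndF _ _ (leq_maxl i j))).
  by apply: (subsetPset _ _ (ndG _ _ (leq_maxr i j))).
move=> k; have [mF Fk] := Foo k; have [mG Gk] := Goo k.
split; first exact: measurable_step.
by rewrite lebesgue_Rd_stepE// lte_mul_pinfty// ge0_fin_numE.
Qed.

HB.instance Definition _ := Measure_isSigmaFinite.Build _ _ _ lebesgue_Rd_step
  step_sigma_finite.

End step.

Fixpoint lebesgue_Rd (d : nat) : {sigma_finite_measure set (Rd R d) -> \bar R} :=
  match d with
  | 0 => dirac ([tuple] : Rd R 0)
  | n.+1 => lebesgue_Rd_step (lebesgue_Rd n)
  end.

Lemma measurable_Rd_prod d (A : 'I_d -> set mR) :
  (forall i, measurable (A i)) ->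
  measurable [set x : Rd R d | forall i, A i (tnth x i)].
Proof.
move=> mA.
have -> : [set x : Rd R d | forall i, A i (tnth x i)] =
    \bigcap_(i in [set: 'I_d]) [set x : Rd R d | A i (tnth x i)].
  by apply/seteqP; split => [x Ax i _|x Ax i]; [exact: Ax|exact: (Ax i)].
apply: fin_bigcap_measurable => [|i _]; first exact: finite_finset.
by rewrite -[X in measurable X]setTI; exact: (@measurable_tnth _ mR d i).
Qed.

Lemma lebesgue_Rd_prod d (A : 'I_d -> set mR) : (forall i, measurable (A i)) ->
  lebesgue_Rd d [set x | forall i, A i (tnth x i)] =
  \prod_(i < d) lebesgue_measure (A i).
Proof.
elim: d A => [|d IHd] A mA.
  rewrite big_ord0 /= /dirac indicE mem_set//=.
  by case.
rewrite big_ord_recl -IHd//= -lebesgue_Rd_stepE//.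
  congr lebesgue_Rd_step; apply/seteqP; split => x /= Ax.
    split; first exact: Ax.
    by move=> i; have := Ax (lift ord0 i); rewrite {1}(tuple_eta x) tnthS.
  move=> i; case: (unliftP ord0 i) => [j ->|->]; last exact: Ax.1.
  by rewrite (tuple_eta x) tnthS; exact: Ax.2.
by apply: (@measurable_Rd_prod d (fun i => A (lift ord0 i))) => i.
Qed.

End lebesgue_Rd.

Definition locally_finite (R : realType) (d : nat)
    (mu : {measure set (Rd R d) -> \bar R}) : Prop :=
  forall x : Rd R d, exists2 r : R, 0 < r &
    (mu [set y : Rd R d | forall i, (`|tnth y i - tnth x i : R| < r)%R] < +oo)%E.

Section bochner.
Context {d : measure_display} {T : measurableType d} {R : realType}
  {E : completeNormedModType R}.
Implicit Types (mu : {measure set T -> \bar R}) (A : set T) (s f : T -> E).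

Definition simple_function s : Prop :=
  finite_set (range s) /\ forall e, measurable (s @^-1` [set e]).

(* Pointwise limit everywhere, with no exceptional null set: every class modulo
   mu-null sets of mu-strongly measurable functions, mu sigma-finite, has such a
   representative. *)
Definition strongly_measurable f : Prop :=
  exists s_ : nat -> T -> E, (forall n, simple_function (s_ n)) /\
    forall x, s_ n x @[n --> \oo] --> f x.

Definition simple_integrable mu A s : Prop :=
  simple_function s /\
  forall e, e != 0 -> (mu (A `&` s @^-1` [set e]) < +oo)%E.

(* The term e = 0 vanishes even when mu is infinite there: fine +oo = 0 *)
Definition simple_integral mu A s : E :=
  \sum_(e \in range s) fine (mu (A `&` s @^-1` [set e])) *: e.

(* Functions on A are extended by 0; `f \_ A` would extend by `point`, which is
   not known to be 0 in an abstract normed module. *)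
Definition is_bochner_integral mu A f (v : E) : Prop :=
  strongly_measurable (patch (fun=> 0) A f) /\
  exists s_ : nat -> T -> E,
    [/\ forall n, simple_integrable mu A (s_ n),
        (\int[mu]_(x in A) (`|f x - s_ n x|)%:E)%E @[n --> \oo] --> 0%E
      & simple_integral mu A (s_ n) @[n --> \oo] --> v].

Definition bochner_integral mu A f : E := xget 0 (is_bochner_integral mu A f).

Definition Lp_norm mu (p : R) f : \bar R :=
  Lnorm mu p%:E (fun x => (`|f x|)%:E).

Definition Lp mu (p : R) : set (T -> E) :=
  [set f | strongly_measurable f /\ (Lp_norm mu p f < +oo)%E].

Definition Linfty_norm mu A f : \bar R :=
  Lnorm mu +oo (fun x => (`|patch (fun=> 0) A f x|)%:E).

Definition Linfty mu A : set (T -> E) :=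
  [set f | strongly_measurable (patch (fun=> 0) A f) /\
           (Linfty_norm mu A f < +oo)%E].

End bochner.

(* +oo when no finite K is admissible *)
Definition opnorm (R : realType) (d1 d2 : measure_display)
    (X : measurableType d1) (Y : measurableType d2)
    (C D : completeNormedModType R)
    (mu : {measure set X -> \bar R}) (nu : {measure set Y -> \bar R}) (p q : R)
    (S : (X -> C) -> (Y -> D)) : \bar R :=
  ereal_inf [set K%:E | K in [set K : R | 0 <= K /\
    forall f, Lp mu p f -> (Lp_norm nu q (S f) <= K%:E * Lp_norm mu p f)%E]].

(* (k, m) stands for the cube 2^-k (m + [0, 1)^d); for d > 0 distinct pairs
   give distinct cubes. *)
Definition dyadic_cube (d : nat) : Type := (int * d.-tuple int)%type.
HB.instance Definition _ d := Choice.on (dyadic_cube d).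

Definition cube (R : realType) (d : nat) (Q : dyadic_cube d) : set (Rd R d) :=
  [set x | forall i, 2 ^ (- Q.1) * (tnth Q.2 i)%:~R <= tnth x i
                     /\ tnth x i < 2 ^ (- Q.1) * ((tnth Q.2 i)%:~R + 1)].
Arguments cube : clear implicits.
Arguments cube R {d} Q.

Section dyadic_operators.
Context {R : realType} {d : nat}.
Implicit Types (Q P : dyadic_cube d) (DD : {fset dyadic_cube d}).

Definition average (E : completeNormedModType R) Q (f : Rd R d -> E) : E :=
  (fine (lebesgue_Rd d (cube R Q)))^-1 *:
    bochner_integral (lebesgue_Rd d) (cube R Q) f.

(* Supremum of a nonempty finite family; 0 on the empty one is a convention
   that leaves maximal_norm unchanged. *)
Definition lsup (E : banachLatticeType R) (s : seq E) : E :=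
  if s is x :: s' then foldr ljoin x s' else 0.

Definition dyadic_maximal (E : banachLatticeType R) DD (f : Rd R d -> E) :
    Rd R d -> E :=
  fun x => lsup [seq \1_(cube R Q) x *: average Q f | Q <- DD].

Definition maximal_norm (E : banachLatticeType R) (p : R) : \bar R :=
  ereal_sup [set opnorm (lebesgue_Rd d) (lebesgue_Rd d) p p
                   (@dyadic_maximal E DD)
            | DD in [set: {fset dyadic_cube d}]].

Definition hardy_littlewood (E : banachLatticeType R) : Prop :=
  exists2 p : R, 1 < p & (maximal_norm E p < +oo)%E.

Definition dyadic_operator (C D : completeNormedModType R)
    (sigma : {measure set (Rd R d) -> \bar R}) DD
    (lambda : dyadic_cube d -> C -> D) (f : Rd R d -> C) : Rd R d -> D :=
  fun x => \sum_(Q <- DD)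
    \1_(cube R Q) x *: lambda Q (bochner_integral sigma (cube R Q) f).

Definition subcubes DD P : {fset dyadic_cube d} :=
  [fset Q in DD | `[< (cube R Q `<=` cube R P)%classic >]]%fset.

(* The dual testing constant is
   testing_constant omega sigma q' p' DD (adjoint \o lambda). *)
Definition testing_constant (C D : completeNormedModType R)
    (sigma omega : {measure set (Rd R d) -> \bar R}) (p q : R) DD
    (lambda : dyadic_cube d -> C -> D) : \bar R :=
  ereal_inf [set K%:E | K in [set K : R | 0 <= K /\
    forall P, P \in DD -> forall f, Linfty sigma (cube R P) f ->
      (Lp_norm omega q (dyadic_operator sigma (subcubes DD P) lambda f) <=
       K%:E * Linfty_norm sigma (cube R P) f * sigma (cube R P) `^ (p^-1)%R)%E]].

End dyadic_operators.

Arguments maximal_norm {R} d E p.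
Arguments hardy_littlewood {R} d E.

(* Main.v *)
Require Import Defs.
From mathcomp Require Import all_boot all_order all_algebra finmap.
From mathcomp Require Import all_classical all_reals all_analysis.
From mathcomp Require Import ess_sup_inf measurable_realfun ring lra.

(** The operator norm dominates the testing constants by positivity: on the
subcubes of [P] the operator only sees the part of a bounded function inside [P],
whose norm in L^p is at most its supremum times the mass of [P] to the power
[1/p] ([testing_of_operator_bound]); the dual testing constant is reached in the
same way after testing the adjoint on functions that almost norm its values
([dual_testing_of_operator_bound]).

For the upper bound, the operator only sees the means of a function over the
atoms of the finite collection of cubes, and averaging over the atoms does not
increase the norm ([jensen_bochner], [opnorm_le]). By positivity and duality
([operator_bound_of_form]) it remains to bound, for positive [f] and [g] constant
on the atoms, the form that sums over the cubes [Q] the pairing of the integral of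
[g] over [Q] against omega with the image under [lambda Q] of the integral of [f]
over [Q] against sigma. This is a finite problem about a forest
([bilinear_bound]).

Stopping cubes for [f] are chosen where the mean of the norm of [f] has grown by
the factor 4, or where the lattice supremum of the averages of [f] since the last
stopping cube has a norm above a multiple of the mean on that cube.
They cover at most half of the previous stopping cube ([sparse_stop]), so that
the means over them satisfy a Carleson embedding ([carleson_anchor]), by Doob's
inequality. The stopping cubes of [f] and of [g] that belong to a cube are nested,
which splits the form into two parts exchanged by symmetry. In the part where the
stopping cube of [g] is the smaller one ([one_sided_bound]), [f] may be replaced,
inside each of its stopping cubes [F], by the supremum of its averages over the
cubes stopped at [F], which is bounded by the stopping rule, and [g] by its
conditional expectation on the next stopping cubes. The testing condition
applies to this pair, and Hoelder's inequality sums over the stopping cubes,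
since the inverses of the exponents [p] and [q'] add up to at least 1
([hoelder_sum]).

That few cubes are stopped by the lattice supremum is a weak type (1,1)
inequality for the lattice maximal operator of an arbitrary measure, while the
constant in the theorem concerns Lebesgue measure. A binary martingale is realized
on the dyadic children of a cube, so that the Lebesgue bound controls its maximal
function in L^p ([strong_btree_maximal]);
stopping it as in the Calderon-Zygmund decomposition gives the weak type (1,1)
bound with a constant linear in the norm ([weak_type_btree]). The best excess
over all binary martingales with given mean and given past supremum is a concave
Bellman function ([weak_bellman_concave]), and concavity carries the bound to
forests with arbitrary masses ([weak_type_forest]).

When one of the constants vanishes the operator vanishes, and when all are
nonzero and one is infinite the bound is trivial ([ereal_bound_of_finite]). *)

Set Implicit Arguments.
Unset Strict Implicit.
Unset Printing Implicit Defensive.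

Import Order.TTheory GRing.Theory Num.Theory.
Import numFieldNormedType.Exports.

Local Open Scope ring_scope.
Local Open Scope set_scope.

(** * Averages over a finite forest of sets *)

Lemma eqr_le (R : numDomainType) (x y : R) : x = y -> x <= y.
Proof. by move->. Qed.

(** Dyadic cubes ordered by inclusion. An index stands at once for a cube and
for its atom, the part of the cube outside its smaller cubes: [le A Q] says that
the atom of [A] lies in the cube of [Q], and masses and functions are given by
their values on the atoms. *)
Definition is_forest (I : finType) (le : rel I) : Prop :=
  [/\ reflexive le, antisymmetric le, transitive le
    & forall A P Q, le A P -> le A Q -> le P Q || le Q P].

Section forest_averages.
Context {R : realType} {I : finType} {V : lmodType R}.
Implicit Types (le : rel I) (s : I -> R) (f : I -> V) (U X : {set I}) (Q : I).

Definition below le Q : {set I} := [set A | le A Q].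

Definition smass s U : R := \sum_(A in U) s A.
Definition sinteg s f U : V := \sum_(A in U) s A *: f A.
Definition savg s f U : V := (smass s U)^-1 *: sinteg s f U.

Lemma smass_ge0 s U : (forall A, 0 <= s A) -> 0 <= smass s U.
Proof. by move=> s0; apply: sumr_ge0. Qed.

Lemma smass0_sinteg s f U : (forall A, 0 <= s A) -> smass s U = 0 ->
  sinteg s f U = 0.
Proof.
move=> s0 /eqP; rewrite psumr_eq0// => /allP h; apply: big1 => A AU.
by have := h A (mem_index_enum _); rewrite AU/= => /eqP->; rewrite scale0r.
Qed.

Lemma smass_savg s f U : (forall A, 0 <= s A) ->
  smass s U *: savg s f U = sinteg s f U.
Proof.
move=> s0; have [m0|m0] := eqVneq (smass s U) 0.
  by rewrite m0 scale0r smass0_sinteg.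
by rewrite scalerA divff// scale1r.
Qed.

End forest_averages.

Lemma in_below (I : finType) (le : rel I) A Q : (A \in below le Q) = le A Q.
Proof. by rewrite inE. Qed.

Section bellman.
Context {R : realType} {I : finType} {V : lmodType R}.
Variables (le : rel I) (s : I -> R) (f : I -> V) (dom : V -> Prop).
Variables (gain : {set I} -> R) (cost : V -> R) (B : V -> {set I} -> R).
Implicit Types (U X : {set I}) (Q : I).
Hypothesis le_forest : is_forest le.
Hypothesis s_ge0 : forall A, 0 <= s A.
Hypothesis dom0 : dom 0.
Hypothesis domD : forall x y, dom x -> dom y -> dom (x + y).
Hypothesis domZ : forall (a : R) x, 0 <= a -> dom x -> dom (a *: x).
Hypothesis domf : forall A, dom (f A).
Hypothesis B_concave : forall X (t : R) x y, dom x -> dom y -> 0 <= t -> t <= 1 ->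
  t * B x X + (1 - t) * B y X <= B (t *: x + (1 - t) *: y) X.
Hypothesis B_jump : forall X Q,
  B (savg s f (below le Q)) (Q |: X) <= B (savg s f (below le Q)) X.
Hypothesis B_end : forall X x, dom x -> gain X - cost x <= B x X.

Let dom_sinteg U : dom (sinteg s f U).
Proof. by rewrite /sinteg; elim/big_ind : _ => // A _; exact: domZ. Qed.

Let dom_savg U : dom (savg s f U).
Proof. by apply: domZ => //; rewrite invr_ge0 smass_ge0. Qed.

Let bellman_split U W X :
  smass s (U :&: W) * B (savg s f (U :&: W)) X +
  smass s (U :\: W) * B (savg s f (U :\: W)) X <=
  smass s U * B (savg s f U) X.
Proof.
set U1 := (U :&: W); set U2 := (U :\: W).
have mE : smass s U = smass s U1 + smass s U2 by exact: big_setID.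
have iE : sinteg s f U = sinteg s f U1 + sinteg s f U2 by exact: big_setID.
have m1 := smass_ge0 U1 s_ge0; have m2 := smass_ge0 U2 s_ge0.
have [m0|m0] := eqVneq (smass s U) 0.
  have /andP[/eqP -> /eqP ->] : (smass s U1 == 0) && (smass s U2 == 0).
    by rewrite -paddr_eq0// -mE m0.
  by rewrite m0 !mul0r addr0.
have mp : 0 < smass s U by rewrite lt_def m0 smass_ge0.
pose t := smass s U1 / smass s U.
have t0 : 0 <= t by rewrite divr_ge0// ltW.
have t1 : t <= 1 by rewrite ler_pdivrMr// mul1r mE lerDl.
have tE : 1 - t = smass s U2 / smass s U by rewrite /t mE; field; rewrite -mE.
have -> : savg s f U = t *: savg s f U1 + (1 - t) *: savg s f U2.
  rewrite /savg -/(savg s f U1) -/(savg s f U2) iE.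
  rewrite -(smass_savg f U1 s_ge0) -(smass_savg f U2 s_ge0) scalerDr !scalerA.
  by rewrite tE /t ![_ / smass s U]mulrC.
apply: le_trans (_ : smass s U * (t * B (savg s f U1) X +
    (1 - t) * B (savg s f U2) X) <= _); last first.
  by apply: ler_wpM2l; [exact: ltW|exact: B_concave].
by rewrite tE /t le_eqVlt; apply/orP; left; apply/eqP; field.
Qed.

(** [B x X] bounds the excess of gain over cost for all continuations with mean
[x] after the cubes of [X]. A maximal cube of a down-closed family either
contains the whole family, and then joins the past by [B_jump], or splits off by
[B_concave]. *)
Lemma bellman_down_closed U X :
  (forall A Q, le A Q -> Q \in U -> A \in U) ->
  \sum_(A in U) s A * (gain (X :|: [set Q in U | le A Q]) - cost (f A)) <=
  smass s U * B (savg s f U) X.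
Proof.
have [lerefl leanti letrans lecomp] := le_forest.
have [n nU] := ubnP #|U|; elim: n => // n IHn in U nU X * => dU.
have [->|/set0Pn[P0 P0U]] := eqVneq U finset.set0.
  by rewrite big_set0 /smass big_set0 mul0r.
have [Q QU Qmax] : exists2 Q, Q \in U & forall P, P \in U -> le Q P -> P = Q.
  case: (@arg_maxnP _ P0 (fun Q => Q \in U) (fun Q => #|below le Q|) P0U) => Q QU mQ.
  exists Q => // P PU QP; apply: leanti; rewrite QP andbT.
  have sub : below le Q \subset below le P.
    by apply/fintype.subsetP => A; rewrite !inE => /letrans; apply.
  have mP : (#|below le P| <= #|below le Q|)%N := mQ P PU.
  have /eqP e : below le Q == below le P by rewrite eqEcard sub.
  by have : P \in below le P by [rewrite inE]; rewrite -e inE.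
have [UQ|UQ] := boolP (U \subset below le Q).
  have UE : U = below le Q.
    apply/eqP; rewrite finset.eqEsubset UQ/=; apply/fintype.subsetP => A.
    by rewrite inE => /dU; apply.
  rewrite (big_setD1 Q)//=.
  apply: le_trans (_ : smass s U * B (savg s f U) (Q |: X) <= _); last first.
    by rewrite UE; apply: ler_wpM2l; [exact: smass_ge0|exact: B_jump].
  apply: le_trans (bellman_split U [set Q] _).
  have -> : (U :&: [set Q]) = [set Q].
    by apply/setP => A; rewrite !inE andb_idl// => /eqP ->.
  apply: lerD.
    rewrite /smass big_set1.
    have [->|sQ] := eqVneq (s Q) 0; first by rewrite !mul0r.
    apply: ler_wpM2l => //.
    have -> : savg s f [set Q] = f Q.
      by rewrite /savg /smass /sinteg !big_set1 scalerA mulVf// scale1r.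
    have -> : [set Q0 in U | le Q Q0] = [set Q].
      by apply/setP => P; rewrite !inE; apply/andP/eqP => [[]|->]; [exact: Qmax|].
    by rewrite finset.setUC; exact: B_end.
  have dU' A P : le A P -> P \in (U :\ Q) -> A \in (U :\ Q).
    move=> AP; rewrite !inE => /andP[PQ PU]; rewrite (dU _ _ AP PU) andbT.
    apply/eqP => AQ; move: PQ; rewrite (Qmax P)// ?eqxx//.
    by rewrite -AQ.
  apply: le_trans (IHn _ _ (Q |: X) dU'); last first.
    by rewrite (cardsD1 Q) QU in nU.
  apply/eqr_le/eq_bigr => A; rewrite inE => /andP[_ AU]; congr (_ * (gain _ - _)).
  apply/setP => P; rewrite !inE.
  have AQ : le A Q by move/fintype.subsetP : UQ => /(_ _ AU); rewrite inE.
  by have [->|//] := eqVneq P Q; rewrite QU AQ !orbT.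
apply: le_trans (bellman_split U (below le Q) _).
rewrite (big_setID (below le Q))/=.
have QI : Q \in (U :&: below le Q) by rewrite !inE QU lerefl.
apply: lerD.
  apply: le_trans (IHn _ _ X _).
  - apply/eqr_le/eq_bigr => A; rewrite !inE => /andP[AU AQ].
    congr (_ * (gain _ - _)); apply/setP => P; rewrite !inE.
    congr (_ || _); apply/andP/andP => [[PU AP]|[/andP[PU _] AP]]; split => //.
    rewrite PU/=; have /orP[//|QP] := lecomp _ _ _ AP AQ.
    by rewrite (Qmax P).
  - rewrite -ltnS (leq_trans _ nU)// ltnS; apply: proper_card.
    rewrite properE finset.subsetIl/=; apply: contra UQ => UUQ.
    exact: (fintype.subset_trans UUQ (finset.subsetIr _ _)).
  - move=> A P AP; rewrite !inE => /andP[PU PQ].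
    by rewrite (dU _ _ AP PU) (letrans _ _ _ AP PQ).
apply: le_trans (IHn _ _ X _).
- apply/eqr_le/eq_bigr => A; rewrite !inE => /andP[AQ AU].
  congr (_ * (gain _ - _)); apply/setP => P; rewrite !inE.
  congr (_ || _); have [AP|] := boolP (le A P); last by rewrite !andbF.
  rewrite !andbT; apply/esym/andb_idl => _; apply: contra AQ.
  exact: letrans.
- rewrite -ltnS (leq_trans _ nU)// ltnS; apply: proper_card.
  rewrite properE finset.subsetDl/=; apply/negP => /fintype.subsetP /(_ Q QU).
  by rewrite !inE lerefl.
- move=> A P AP; rewrite !inE => /andP[PQ PU]; rewrite (dU _ _ AP PU) andbT.
  by apply: contra PQ => AQ; have /orP[//|QP] := lecomp _ _ _ AP AQ; rewrite (Qmax P).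
Qed.

Lemma bellman_forest F :
  \sum_(A in below le F) s A * (gain [set Q | le A Q & le Q F] - cost (f A)) <=
  smass s (below le F) * B (savg s f (below le F)) finset.set0.
Proof.
have [_ _ letrans _] := le_forest.
have := @bellman_down_closed (below le F) finset.set0.
move=> /(_ _)/wrap[|]; first by move=> A Q AQ; rewrite !inE; exact: letrans.
apply: le_trans; apply/eqr_le/eq_bigr => A _; congr (_ * (gain _ - _)).
by apply/setP => Q; rewrite !inE andbC.
Qed.

End bellman.

(** * Binary averaging trees in a Banach lattice *)

(** Midpoint concavity with a lower bound suffices: the infimum [m] of the
defect from the chord satisfies [m >= m / 2]. *)
Lemma midpoint_concave (R : realType) (F : R -> R) (L : R) :
  (forall x, 0 <= x <= 1 -> L <= F x) ->
  (forall x y, 0 <= x <= 1 -> 0 <= y <= 1 -> (F x + F y) / 2 <= F ((x + y) / 2)) ->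
  forall x, 0 <= x <= 1 -> x * F 1 + (1 - x) * F 0 <= F x.
Proof.
move=> FL Fmid x x01; pose G y := F y - (y * F 1 + (1 - y) * F 0).
have L' y : 0 <= y <= 1 -> L - (`|F 1| + `|F 0|) <= G y.
  move=> /andP[y0 y1]; have := FL y; rewrite y0 y1 => /(_ isT) FLy.
  have := ler_norm (F 1); have := ler_norm (F 0).
  have := normr_ge0 (F 1); have := normr_ge0 (F 0).
  rewrite /G; nra.
pose S := [set G y | y in [set y : R | 0 <= y <= 1]]%classic.
have hS : has_inf S.
  split; first by exists (G 0), 0 => //=; rewrite lexx ler01.
  by exists (L - (`|F 1| + `|F 0|)) => _ [y /= y01 <-]; exact: L'.
have infS y : 0 <= y <= 1 -> inf S <= G y.
  by move=> y01; apply: ge_inf; [case: hS|exists y].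
have half : inf S / 2 <= inf S.
  apply: lb_le_inf; first by case: hS.
  move=> _ [y /= /andP[y0 y1] <-]; have [y2|y2] := leP y (1 / 2).
    have d01 : 0 <= 2 * y <= 1 by apply/andP; split; lra.
    have := Fmid 0 (2 * y); rewrite lexx ler01 d01 => /(_ isT isT).
    rewrite add0r (_ : 2 * y / 2 = y); last by field.
    by have := infS (2 * y) d01; rewrite /G; lra.
  have d01 : 0 <= 2 * y - 1 <= 1 by apply/andP; split; lra.
  have := Fmid 1 (2 * y - 1); rewrite ler01 lexx d01 => /(_ isT isT).
  rewrite (_ : (1 + (2 * y - 1)) / 2 = y); last by field.
  by have := infS (2 * y - 1) d01; rewrite /G; lra.
by have := infS x x01; rewrite /G; lra.
Qed.

Lemma young_powR (R : realType) (p p' m y : R) : 1 < p -> p^-1 + p'^-1 = 1 -> 0 <= m -> 0 <= y ->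
  m `^ (p - 1) * y <= m `^ p / p' + y `^ p / p.
Proof.
move=> p1 pp' m0 y0; have p0 : 0 < p by apply: lt_trans p1.
have p'E : p'^-1 = (p - 1) / p by rewrite mulrBl divff ?gt_eqF// mul1r -pp' [RHS]addrC addKr.
have p'0 : 0 < p' by rewrite -invr_gt0 p'E divr_gt0// subr_gt0.
apply: le_trans (conjugate_powR _ _ p'0 p0 _) _ => //.
- exact: powR_ge0.
- by rewrite addrC.
rewrite -powRrM; have -> // : (p - 1) * p' = p.
by rewrite -[p']invrK p'E; field; rewrite !gt_eqF//= subr_gt0.
Qed.

Section finite_joins.
Context {R : realType} {E : banachLatticeType R} {I : finType}.
Implicit Types (x y : E) (a : I -> E) (X Y : {set I}).

Lemma ljoin_idl x y : lle y x -> ljoin x y = x.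
Proof.
move=> yx; apply: lle_anti; last exact: lle_joinl.
by apply/ljoin_lle; split => //; exact: llexx.
Qed.

Lemma ljoinxxr x y : ljoin (ljoin x y) y = ljoin x y.
Proof. exact/ljoin_idl/lle_joinr. Qed.

Lemma ljoin_mono x x' y : lle x x' -> lle (ljoin x y) (ljoin x' y).
Proof.
move=> xx'; apply/ljoin_lle; split; last exact: lle_joinr.
exact: lle_trans xx' (lle_joinl _ _).
Qed.

Lemma ljoin_ge0 x y : lle 0 x -> lle 0 (ljoin x y).
Proof. by move=> x0; exact: lle_trans x0 (lle_joinl _ _). Qed.

Lemma lsum_ge0 (J : Type) (r : seq J) (P : pred J) (F : J -> E) :
  (forall i, P i -> lle 0 (F i)) -> lle 0 (\sum_(i <- r | P i) F i).
Proof.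
move=> F0; elim/big_ind : _ => //; first exact: llexx.
by move=> x y; exact: ladd_ge0.
Qed.

Lemma lle_sum (J : Type) (r : seq J) (P : pred J) (F G : J -> E) :
  (forall i, P i -> lle (F i) (G i)) ->
  lle (\sum_(i <- r | P i) F i) (\sum_(i <- r | P i) G i).
Proof.
move=> FG; apply/lsub_ge0; rewrite -sumrB; apply: lsum_ge0 => i Pi.
exact/lsub_ge0/FG.
Qed.

Definition sjoin a X : E := foldr ljoin 0 [seq a Q | Q <- enum X].

Let foldr_ub (r : seq E) x : x \in r -> lle x (foldr ljoin 0 r).
Proof.
elim: r => //= y r IH; rewrite inE => /predU1P[->|/IH h]; first exact: lle_joinl.
exact: lle_trans h (lle_joinr _ _).
Qed.

Lemma sjoin_ub a X Q : Q \in X -> lle (a Q) (sjoin a X).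
Proof. by move=> QX; apply: foldr_ub; apply: map_f; rewrite mem_enum. Qed.

Lemma sjoin_ge0 a X : lle 0 (sjoin a X).
Proof.
rewrite /sjoin; elim: (enum X) => /= [|Q r IH]; first exact: llexx.
exact: lle_trans IH (lle_joinr _ _).
Qed.

Lemma sjoin_lub a X y : lle 0 y -> (forall Q, Q \in X -> lle (a Q) y) ->
  lle (sjoin a X) y.
Proof.
move=> y0 ay; rewrite /sjoin.
have : {subset enum X <= X} by move=> Q; rewrite mem_enum.
elim: (enum X) => //= Q r IH sX; apply/ljoin_lle; split.
  by apply: ay; apply: sX; rewrite inE eqxx.
by apply: IH => P Pr; apply: sX; rewrite inE Pr orbT.
Qed.

Lemma sjoin0 a : sjoin a finset.set0 = 0.
Proof. by rewrite /sjoin enum_set0. Qed.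

Lemma sjoinU1 a X Q : sjoin a (Q |: X) = ljoin (sjoin a X) (a Q).
Proof.
apply: lle_anti.
  apply: sjoin_lub; first exact/ljoin_ge0/sjoin_ge0.
  move=> P; rewrite !inE => /predU1P[->|PX]; first exact: lle_joinr.
  exact: lle_trans (sjoin_ub _ PX) (lle_joinl _ _).
apply/ljoin_lle; split; last by apply: sjoin_ub; rewrite !inE eqxx.
apply: sjoin_lub => [|P PX]; first exact: sjoin_ge0.
by apply: sjoin_ub; rewrite !inE PX orbT.
Qed.

Lemma sjoin_sub a X Y : X \subset Y -> lle (sjoin a X) (sjoin a Y).
Proof.
move=> /fintype.subsetP XY; apply: sjoin_lub => [|Q QX]; first exact: sjoin_ge0.
exact/sjoin_ub/XY.
Qed.

End finite_joins.

(** A martingale on a set of mass one that each node splits into halves, given by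
its terminal values. *)
Inductive btree (T : Type) : Type :=
  | BLeaf of T
  | BNode of btree T & btree T.

Section binary_martingales.
Context {R : realType} {E : banachLatticeType R}.
Implicit Types (t l r : btree E) (a x y : E) (h : E -> R).

Fixpoint tpos t : Prop :=
  match t with BLeaf x => lle 0 x | BNode l r => tpos l /\ tpos r end.

Fixpoint tavg t : E :=
  match t with BLeaf x => x | BNode l r => 2^-1 *: (tavg l + tavg r) end.

Fixpoint tint h t : R :=
  match t with BLeaf x => h x | BNode l r => (tint h l + tint h r) / 2 end.

(** Integral of [h] of the maximal function, where [a] is the supremum of the
averages met before the root. *)
Fixpoint tmax h t a : R :=
  match t with
  | BLeaf x => h (ljoin a x)
  | BNode l r => (tmax h l (ljoin a (2^-1 *: (tavg l + tavg r))) +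
                  tmax h r (ljoin a (2^-1 *: (tavg l + tavg r)))) / 2
  end.

Definition normE x : R := `|x|.
Definition exceeds (lam : R) x : R := if lam < `|x| then 1 else 0.

Lemma tavg_ge0 t : tpos t -> lle 0 (tavg t).
Proof.
elim: t => //= l IHl r IHr [/IHl ? /IHr ?].
by apply: lleZ_ge0; [rewrite invr_ge0|exact: ladd_ge0].
Qed.

Lemma tint_ge0 h t : (forall x, 0 <= h x) -> 0 <= tint h t.
Proof. by move=> h0; elim: t => //= l IHl r IHr; rewrite divr_ge0// addr_ge0. Qed.

Lemma tmax_le1 h t a : (forall x, h x <= 1) -> tmax h t a <= 1.
Proof.
move=> h0; elim: t a => //= l IHl r IHr a.
by rewrite ler_pdivrMr// mul1r -[2]/(1 + 1) lerD.
Qed.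

Lemma tmax_le_scale h h' (c : R) t a : (forall x, c * h x <= h' x) ->
  c * tmax h t a <= tmax h' t a.
Proof.
move=> hh'; elim: t a => //= l IHl r IHr a.
by rewrite mulrA ler_wpM2r ?invr_ge0// mulrDr lerD.
Qed.

Lemma tmax_mono h t a a' :
  (forall x y, lle 0 x -> lle x y -> h x <= h y) -> lle 0 a -> lle a a' ->
  tmax h t a <= tmax h t a'.
Proof.
move=> mh; elim: t a a' => /= [x|l IHl r IHr] a a' a0 aa'.
  by apply: mh; [exact: ljoin_ge0|exact: ljoin_mono].
rewrite ler_wpM2r ?invr_ge0// lerD//.
  by apply: IHl; [exact: ljoin_ge0|exact: ljoin_mono].
by apply: IHr; [exact: ljoin_ge0|exact: ljoin_mono].
Qed.

Lemma tmax_join_avg h t a : tmax h t (ljoin a (tavg t)) = tmax h t a.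
Proof. by case: t => /= [x|l r]; rewrite !ljoinxxr. Qed.

Lemma norm_tavg t : `|tavg t| <= tint normE t.
Proof.
elim: t => //= l IHl r IHr; rewrite normrZ ger0_norm ?invr_ge0// mulrC.
by rewrite ler_wpM2r ?invr_ge0// (le_trans (ler_normD _ _))// lerD.
Qed.

(** The martingale stopped at the first node where the mean of the norm, and not
the norm of the mean, exceeds [th]. *)
Fixpoint prune (th : R) t : btree E :=
  if th < tint normE t then BLeaf (tavg t) else
  match t with BLeaf x => BLeaf x | BNode l r => BNode (prune th l) (prune th r) end.

(** The mass of the part where [prune] stops. *)
Fixpoint pruned (th : R) t : R :=
  if th < tint normE t then 1 else
  match t with BLeaf x => 0 | BNode l r => (pruned th l + pruned th r) / 2 end.

Lemma tpos_prune th t : tpos t -> tpos (prune th t).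
Proof.
elim: t => /= [x|l IHl r IHr] tp; case: ifP => //= _.
  by apply: lleZ_ge0; [rewrite invr_ge0|case: tp => *; apply: ladd_ge0; exact: tavg_ge0].
by case: tp => *; split; [exact: IHl|exact: IHr].
Qed.

Lemma tavg_prune th t : tavg (prune th t) = tavg t.
Proof.
by elim: t => /= [x|l IHl r IHr]; case: ifP => //= _; rewrite IHl IHr.
Qed.

Lemma pruned_le th t : 0 < th -> th * pruned th t <= tint normE t.
Proof.
move=> th0; elim: t => /= [x|l IHl r IHr]; case: ifP => h.
- by rewrite mulr1 ltW.
- by rewrite mulr0 normr_ge0.
- by rewrite mulr1 ltW.
- by rewrite mulrA ler_wpM2r ?invr_ge0// mulrDr lerD.
Qed.

Lemma tmax_prune h th t a : (forall x, 0 <= h x) -> (forall x, h x <= 1) ->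
  tmax h t a <= tmax h (prune th t) a + pruned th t.
Proof.
move=> h0 h1; elim: t a => [x|l IHl r IHr] a; rewrite [prune _ _]/= [pruned _ _]/=.
  by case: ifP => // _; rewrite lerDl.
case: ifP => // _.
  by apply: le_trans (tmax_le1 _ _ h1) _; rewrite lerDr; exact: h0.
rewrite /= !tavg_prune -mulrDl ler_wpM2r ?invr_ge0// addrACA lerD//.
Qed.

Lemma tint_prune p th t : 1 < p -> 0 < th -> tint normE t <= 2 * th ->
  tint (fun x => `|x| `^ p) (prune th t) <= (2 * th) `^ (p - 1) * tint normE t.
Proof.
move=> p1 th0.
have p0 : 0 < p by apply: lt_trans p1.
have key (u v : R) : 0 <= u -> u <= v -> v <= 2 * th ->
    u `^ p <= (2 * th) `^ (p - 1) * v.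
  move=> u0 uv v2; have v0 := le_trans u0 uv.
  apply: le_trans (_ : v `^ p <= _).
    by apply: ge0_ler_powR; rewrite ?nnegrE// ltW.
  rewrite -mulr_powRB1// mulrC ler_wpM2r// ge0_ler_powR ?nnegrE//.
    by rewrite subr_ge0 ltW.
  by rewrite mulr_ge0// ltW.
elim: t => [x|l IHl r IHr] tth; rewrite [prune _ _]/=.
  by case: ifP => _ /=; apply: key.
case: ifP => [_|/negbT].
  apply: key => //; exact: (norm_tavg (BNode l r)).
rewrite -leNgt /= ler_pdivrMr// mulrC => h.
have l0 : 0 <= tint normE l by apply: tint_ge0 => x; exact: normr_ge0.
have r0 : 0 <= tint normE r by apply: tint_ge0 => x; exact: normr_ge0.
rewrite mulrA ler_wpM2r ?invr_ge0// mulrDr lerD//.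
  by apply: IHl; lra.
by apply: IHr; lra.
Qed.

Lemma exceeds_ge0 lam x : 0 <= exceeds lam x. Proof. by rewrite /exceeds; case: ifP. Qed.

Lemma exceeds_le1 lam x : exceeds lam x <= 1.
Proof. by rewrite /exceeds; case: ifP. Qed.

Lemma exceeds_mono lam x y : lle 0 x -> lle x y -> exceeds lam x <= exceeds lam y.
Proof.
move=> x0 xy; have := norm_lle0 x0 xy; rewrite /exceeds => nxy.
by case: (ltP lam `|x|) => lx; [rewrite (lt_le_trans lx)|case: ifP].
Qed.

(** The weak type (1,1) bound follows from the strong one as in the
Calderon-Zygmund decomposition: below the first crossing of the level [th] the
averages are at most [2 * th], since a node has two children of equal mass. *)
Lemma weak_type_btree (p M lam : R) t : 1 < p -> 0 < M -> 0 < lam ->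
  (forall t, tpos t -> tmax (fun x => `|x| `^ p) t 0 <=
     M `^ p * tint (fun x => `|x| `^ p) t) ->
  tpos t ->
  tmax (exceeds lam) t 0 <= (1 + 2 `^ (p - 1)) * M / lam * tint normE t.
Proof.
move=> p1 M0 lam0 strong tp.
have p0 : 0 < p by apply: lt_trans p1.
pose th := lam / M; have th0 : 0 < th by rewrite divr_gt0.
set n := tint normE t.
have n0 : 0 <= n by apply: tint_ge0 => x; exact: normr_ge0.
have -> : (1 + 2 `^ (p - 1)) * M / lam * n = n / th + 2 `^ (p - 1) * (n / th).
  by rewrite /th; field; rewrite !gt_eqF.
have c0 : 0 <= 2 `^ (p - 1) * (n / th).
  by rewrite mulr_ge0 ?powR_ge0// divr_ge0// ltW.
have [n2|n2] := leP n (2 * th); last first.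
  apply: le_trans (tmax_le1 _ _ (exceeds_le1 lam)) _.
  rewrite -[leLHS]addr0 lerD// ler_pdivlMr// mul1r; lra.
apply: le_trans (tmax_prune th t 0 (exceeds_ge0 lam) (exceeds_le1 lam)) _.
rewrite addrC lerD//.
  by rewrite ler_pdivlMr// mulrC; exact: pruned_le.
have := le_trans (strong _ (tpos_prune th tp))
  (ler_wpM2l (powR_ge0 M p) (tint_prune p1 th0 n2)).
have cheb : lam `^ p * tmax (exceeds lam) (prune th t) 0 <=
    tmax (fun x => `|x| `^ p) (prune th t) 0.
  apply: tmax_le_scale => x; rewrite /exceeds; case: ltP => [lx|_].
    by rewrite mulr1; apply: ge0_ler_powR; rewrite ?nnegrE ?(ltW lx) ?(ltW p0) ?(ltW lam0).
  by rewrite mulr0 powR_ge0.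
move=> /(le_trans cheb).
have -> : lam `^ p = M `^ p * (th `^ (p - 1) * th).
  rewrite [th `^ _ * _]mulrC mulr_powRB1//; last exact: ltW.
  by rewrite -powRM ?ltW// /th mulrC divfK// gt_eqF.
rewrite (powRM _ (ler0n R 2) (ltW th0)).
have a0 : 0 < M `^ p by exact: powR_gt0.
have b0 : 0 < th `^ (p - 1) by exact: powR_gt0.
rewrite -!mulrA ler_pM2l// [leRHS]mulrCA ler_pM2l// => h.
by rewrite mulrA ler_pdivlMr// [leLHS]mulrC; move: h; rewrite mulrA.
Qed.

End binary_martingales.

(** * Maximal inequalities in a forest *)

Section weak_type.
Context {R : realType} {E : banachLatticeType R}.
Variables (lam kap : R).
Hypothesis kap0 : 0 <= kap.
Hypothesis weak_tree : forall t : btree E, tpos t ->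
  tmax (exceeds lam) t 0 <= kap * tint normE t.

(** Bellman function of the weak type inequality: the best excess over binary
martingales started at [x] with the maximal function already at [a]. *)
Definition weak_bellman (x a : E) : R :=
  sup [set r | exists t : btree E, [/\ tpos t, tavg t = x &
    r = tmax (exceeds lam) t a - kap * tint normE t]]%classic.

Let has_sup_weak x a : lle 0 x ->
  has_sup [set r | exists t : btree E, [/\ tpos t, tavg t = x &
    r = tmax (exceeds lam) t a - kap * tint normE t]]%classic.
Proof.
move=> x0; split; first by exists (tmax (exceeds lam) (BLeaf x) a -
  kap * tint normE (BLeaf x)), (BLeaf x).
exists 1 => _ [t [_ _ ->]]; rewrite lerBlDr.
apply: le_trans (tmax_le1 _ _ (exceeds_le1 lam)) _.
by rewrite lerDl; apply: mulr_ge0 => //; apply: tint_ge0 => y; exact: normr_ge0.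
Qed.

Let weak_bellman_ub t a : tpos t ->
  tmax (exceeds lam) t a - kap * tint normE t <= weak_bellman (tavg t) a.
Proof.
move=> tp; apply: sup_upper_bound; first exact/has_sup_weak/tavg_ge0.
by exists t.
Qed.

Let weak_bellman_le x a (M : R) : lle 0 x ->
  (forall t, tpos t -> tavg t = x ->
    tmax (exceeds lam) t a - kap * tint normE t <= M) -> weak_bellman x a <= M.
Proof.
move=> x0 h; apply: ge_sup; first by case: (has_sup_weak a x0).
by move=> _ [t [tp tx ->]]; exact: h.
Qed.

Lemma weak_bellman_end x a : lle 0 x -> lle 0 a ->
  exceeds lam a - kap * `|x| <= weak_bellman x a.
Proof.
move=> x0 a0; apply: le_trans (weak_bellman_ub (t := BLeaf x) a x0) => /=.
by rewrite lerD2r exceeds_mono//; exact: lle_joinl.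
Qed.

Lemma weak_bellman0 x : lle 0 x -> weak_bellman x 0 <= 0.
Proof.
by move=> x0; apply: weak_bellman_le => // t tp _; rewrite subr_le0 weak_tree.
Qed.

Lemma weak_bellman_join x a : lle 0 x ->
  weak_bellman x (ljoin a x) <= weak_bellman x a.
Proof.
move=> x0; apply: weak_bellman_le => // t tp tx.
by rewrite -tx tmax_join_avg; exact: weak_bellman_ub.
Qed.

Let weak_bellman_mid x y a : lle 0 x -> lle 0 y -> lle 0 a ->
  (weak_bellman x a + weak_bellman y a) / 2 <= weak_bellman (2^-1 *: (x + y)) a.
Proof.
move=> x0 y0 a0; rewrite ler_pdivrMr// -lerBrDr.
apply: weak_bellman_le => // t tp tx; rewrite lerBrDr -lerBrDl.
apply: weak_bellman_le => // u up uy; rewrite lerBrDl.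
rewrite -ler_pdivrMr//.
have := weak_bellman_ub (t := BNode t u) a (conj tp up).
rewrite /= tx uy => /(le_trans _); apply.
have mono v : tmax (exceeds lam) v a <=
    tmax (exceeds lam) v (ljoin a (2^-1 *: (x + y))).
  by apply: tmax_mono => //; [exact: exceeds_mono|exact: lle_joinl].
by have := mono t; have := mono u; lra.
Qed.

Lemma weak_bellman_concave (t : R) x y a : lle 0 x -> lle 0 y -> lle 0 a ->
  0 <= t -> t <= 1 ->
  t * weak_bellman x a + (1 - t) * weak_bellman y a <=
  weak_bellman (t *: x + (1 - t) *: y) a.
Proof.
move=> x0 y0 a0 t0 t1.
pose z (u : R) := u *: x + (1 - u) *: y.
have z0 u : 0 <= u <= 1 -> lle 0 (z u).
  by case/andP => ? ?; apply: ladd_ge0; apply: lleZ_ge0; rewrite ?subr_ge0.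
have z1 : z 1 = x by rewrite /z subrr scale0r scale1r addr0.
have zy : z 0 = y by rewrite /z subr0 scale0r scale1r add0r.
rewrite -{1}z1 -{1}zy -/(z t).
apply: (@midpoint_concave R (fun u => weak_bellman (z u) a)
  (- (kap * (`|x| + `|y|)))).
- move=> u u01; apply: le_trans (weak_bellman_end (z0 u u01) a0).
  apply: le_trans (_ : 0 - kap * `|z u| <= _); last by rewrite lerD2r exceeds_ge0.
  rewrite sub0r lerN2 ler_wpM2l//; apply: le_trans (ler_normD _ _) _.
  case/andP: u01 => u0 u1; rewrite !normrZ !ger0_norm ?subr_ge0//.
  by rewrite lerD// ler_piMl// gerBl.
- move=> u v u01 v01; apply: le_trans (weak_bellman_mid _ _ a0) _; try exact: z0.
  apply/eqr_le; congr (weak_bellman _ a); rewrite /z.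
  rewrite addrACA -!scalerDl scalerDr !scalerA.
  by congr (_ *: _ + _ *: _); field.
- by rewrite t0 t1.
Qed.

Lemma weak_type_forest (I : finType) (le : rel I) (s : I -> R) (f : I -> E) F :
  is_forest le -> (forall A, 0 <= s A) -> (forall A, lle 0 (f A)) ->
  \sum_(A in below le F)
    s A * exceeds lam (sjoin (fun Q => savg s f (below le Q))
                             [set Q | le A Q & le Q F]) <=
  kap * \sum_(A in below le F) s A * `|f A|.
Proof.
move=> fle s0 f0; set a := fun Q => savg s f (below le Q).
have a0 Q : lle 0 (a Q).
  apply: lleZ_ge0; first by rewrite invr_ge0 smass_ge0.
  by apply: lsum_ge0 => A _; exact: lleZ_ge0.
have := @bellman_forest R I E le s f (fun x => lle 0 x)
  (fun X => exceeds lam (sjoin a X)) (fun x => kap * `|x|)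
  (fun x X => weak_bellman x (sjoin a X)) fle s0.
move=> /(_ (llexx 0) (@ladd_ge0 _ _) (@lleZ_ge0 _ _) f0).
move=> /(_ (fun X t x y x0 y0 => weak_bellman_concave x0 y0 (sjoin_ge0 a X))).
have jump X Q : weak_bellman (a Q) (sjoin a (Q |: X)) <=
    weak_bellman (a Q) (sjoin a X).
  by rewrite sjoinU1; exact: weak_bellman_join.
move=> /(_ jump).
move=> /(_ (fun X x x0 => weak_bellman_end x0 (sjoin_ge0 a X)) F).
rewrite sjoin0 => h.
have {}h := le_trans h (mulr_ge0_le0 (smass_ge0 _ s0) (weak_bellman0 (a0 F))).
rewrite -subr_le0; apply: le_trans h; apply/eqr_le.
rewrite mulr_sumr -sumrB; apply: eq_bigr => A _.
by rewrite mulrBr mulrCA.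
Qed.

End weak_type.

Section doob.
Context {R : realType} {I : finType}.

Implicit Types (a : I -> R) (X : {set I}).

Definition smax (a : I -> R) (X : {set I}) : R := \big[Num.max/0]_(Q in X) a Q.

Lemma smax_ge0 a X : 0 <= smax a X.
Proof. exact: bigmax_ge_id. Qed.

Lemma smax_ub a X Q : Q \in X -> a Q <= smax a X.
Proof. by move=> QX; exact: (le_bigmax_cond 0 a). Qed.

Lemma smaxU1 a X Q : smax a (Q |: X) = Num.max (smax a X) (a Q).
Proof.
apply/le_anti/andP; split.
  apply/bigmax_leP; split; first by rewrite le_max smax_ge0.
  move=> P; rewrite !inE le_max => /predU1P[->|PX]; first by rewrite lexx orbT.
  by rewrite smax_ub.
rewrite ge_max smax_ub ?inE ?eqxx// andbT.
apply/bigmax_leP; split; first exact: smax_ge0.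
by move=> P PX; apply: smax_ub; rewrite !inE PX orbT.
Qed.

(** Doob's inequality, with the Bellman function p m^(p-1) (m - p' x), affine
in [x]. *)
Lemma doob (le : rel I) (s f : I -> R) (p p' : R) :
  1 < p -> p^-1 + p'^-1 = 1 ->
  is_forest le -> (forall A, 0 <= s A) -> (forall A, 0 <= f A) ->
  \sum_A s A * smax (fun Q => savg s (f : I -> R^o) (below le Q))
                    [set Q | le A Q] `^ p <=
  p' `^ p * \sum_A s A * f A `^ p.
Proof.
move=> p1 pp' fle s0 f0; set a := fun Q => savg s (f : I -> R^o) (below le Q).
have p0 : 0 < p by apply: lt_trans p1.
have p'E : p'^-1 = (p - 1) / p.
  by rewrite mulrBl divff ?gt_eqF// mul1r -pp' [RHS]addrC addKr.
have p'0 : 0 < p' by rewrite -invr_gt0 p'E divr_gt0// subr_gt0.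
have p'p : p / p' = p - 1 by rewrite p'E mulrCA divff ?gt_eqF// mulr1.
have pM (m : R) : 0 <= m -> m `^ p = m `^ (p - 1) * m.
  by move=> m0; rewrite mulrC mulr_powRB1.
have a0 Q : 0 <= a Q.
  rewrite /a /savg; apply: mulr_ge0; first by rewrite invr_ge0 smass_ge0.
  by apply: sumr_ge0 => A _; exact: mulr_ge0.
pose B (x : R^o) (X : {set I}) : R :=
  p * smax a X `^ (p - 1) * (smax a X - p' * (x : R)).
have young m (y : R) : 0 <= m -> 0 <= y ->
    p * (m `^ (p - 1) * y) <= (p - 1) * m `^ p + y `^ p.
  move=> m0 y0; have := young_powR p1 pp' m0 y0.
  rewrite -(ler_pM2l p0) => /le_trans; apply; apply/eqr_le.
  by rewrite mulrDr mulrCA p'p mulrC; congr (_ + _); field; rewrite gt_eqF.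
have concB X (t : R) (x y : R^o) : 0 <= (x : R) -> 0 <= (y : R) -> 0 <= t -> t <= 1 ->
    t * B x X + (1 - t) * B y X <= B (t *: x + (1 - t) *: y) X.
  move=> _ _ _ _; apply/eqr_le; rewrite /B.
  have -> : (t *: x + (1 - t) *: y : R^o) = (t * x + (1 - t) * y : R) by [].
  by ring.
have jumpB X Q : B (a Q) (Q |: X) <= B (a Q) X.
  rewrite /B smaxU1.
  set m := smax a X; set x := a Q.
  have m0 : 0 <= m by exact: smax_ge0.
  have [xm|mx] := leP x m => //.
  have x0 : 0 <= x by exact: a0.
  have y := young m x m0 x0.
  have p10 : 0 < p - 1 by rewrite subr_gt0.
  have p'p1 : p' * (p - 1) = p by rewrite -p'p mulrCA divff ?gt_eqF// mulr1.
  rewrite -!mulrA ler_pM2l// -(ler_pM2l p10).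
  have -> : (p - 1) * (x `^ (p - 1) * (x - p' * x)) = - (x `^ (p - 1) * x).
    transitivity (((p - 1) - p' * (p - 1)) * (x `^ (p - 1) * x)); first by ring.
    by rewrite p'p1; ring.
  have -> : (p - 1) * (m `^ (p - 1) * (m - p' * x)) =
      (p - 1) * (m `^ (p - 1) * m) - p' * (p - 1) * (m `^ (p - 1) * x) by ring.
  by rewrite p'p1 -!pM//; lra.
have endB X (x : R^o) : 0 <= (x : R) -> smax a X `^ p - p' `^ p * (x : R) `^ p <= B x X.
  move=> x0; rewrite /B; set m := smax a X.
  have m0 : 0 <= m by exact: smax_ge0.
  have := young m (p' * x) m0 (mulr_ge0 (ltW p'0) x0).
  by rewrite powRM ?(ltW p'0)// pM//; lra.
have := @bellman_down_closed R I R^o le s f (fun x => 0 <= (x : R))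
  (fun X => smax a X `^ p) (fun x => p' `^ p * (x : R) `^ p) B fle s0 (lexx 0)
  (fun x y => @addr_ge0 R x y) (fun x y => @mulr_ge0 R x y) f0 concB jumpB endB
  [set: I] finset.set0.
move=> /(_ (fun A Q _ _ => finset.in_setT A)).
have B0 : B (savg s (f : I -> R^o) [set: I]) finset.set0 = 0.
  rewrite /B /smax big_set0 powR0 ?mulr0 ?mul0r// gt_eqF// subr_gt0//.
rewrite B0 mulr0 => h; rewrite -subr_le0; apply: le_trans h; apply/eqr_le.
rewrite mulr_sumr -sumrB; apply: eq_big => [A|A _]; first by rewrite inE.
rewrite mulrBr [_ * (s A * _)]mulrCA; congr (s A * smax a _ `^ p - _).
by apply/setP => Q; rewrite !inE.
Qed.

End doob.

(** * Sums over a forest *)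

Section finite_sums.
Context {R : numDomainType}.

Lemma ler_sum_sub (I : finType) (P Q : pred I) (F : I -> R) :
  (forall i, 0 <= F i) -> (forall i, P i -> Q i) ->
  \sum_(i | P i) F i <= \sum_(i | Q i) F i.
Proof.
move=> F0 PQ; rewrite [leRHS](bigID P)/= -[leLHS]addr0; apply: lerD.
  by apply/eqr_le/eq_bigl => i; rewrite andbC; case: (boolP (P i)) => // /PQ ->.
exact: sumr_ge0.
Qed.

Lemma ler_sum_inj (I J : finType) (h : I -> J) (P : pred I) (Q : pred J)
    (F : J -> R) : (forall j, 0 <= F j) -> {in P &, injective h} ->
  (forall i, P i -> Q (h i)) ->
  \sum_(i | P i) F (h i) <= \sum_(j | Q j) F j.
Proof.
move=> F0 hinj PQ; rewrite -(big_imset F hinj); apply: ler_sum_sub => // j.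
by move=> /imsetP[i Pi ->]; exact: PQ.
Qed.

End finite_sums.

Section stopping.
Context {I : finType}.
Variables (le stop : rel I).
Hypothesis le_forest : is_forest le.
Implicit Types (A F P Q : I).

Definition above Q : {set I} := [set P | le Q P].

Definition parent Q : option I :=
  [pick P | [&& le Q P, P != Q & [forall P', (le Q P' && (P' != Q)) ==> le P P']]].

Fixpoint anchor_rec n Q : I :=
  if n is n'.+1 then
    if parent Q is Some P then
      if stop (anchor_rec n' P) Q then Q else anchor_rec n' P
    else Q
  else Q.

(** The stopping cube of [Q], found by descending the chain of cubes above [Q]
and restarting whenever the stopping condition occurs; the length of that chain
bounds the recursion. *)
Definition anchor Q : I := anchor_rec #|above Q| Q.

Let le_refl : reflexive le. Proof. by case: le_forest. Qed.
Let le_anti : antisymmetric le. Proof. by case: le_forest. Qed.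
Let le_trans : transitive le. Proof. by case: le_forest. Qed.
Let le_comp A P Q : le A P -> le A Q -> le P Q || le Q P.
Proof. by case: le_forest => _ _ _; apply. Qed.

Lemma forest_max (S : pred I) A P : (forall Q, S Q -> le A Q) -> S P ->
  exists2 Q, S Q & forall Q', S Q' -> le Q' Q.
Proof.
move=> SA SP; have [Q SQ mQ] := @arg_maxnP _ P S (fun Q => #|below le Q|) SP.
exists Q => // Q' SQ'; have /orP[//|QQ'] := le_comp (SA _ SQ') (SA _ SQ).
have /eqP e : below le Q == below le Q'.
  rewrite eqEcard; apply/andP; split; last exact: (mQ Q' SQ').
  by apply/fintype.subsetP => B; rewrite !inE => /le_trans; apply.
by have : Q' \in below le Q by [rewrite e inE]; rewrite inE.
Qed.

Lemma forest_min (S : pred I) A P : (forall Q, S Q -> le A Q) -> S P ->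
  exists2 Q, S Q & forall Q', S Q' -> le Q Q'.
Proof.
move=> SA SP; have [Q SQ mQ] := @arg_minnP _ P S (fun Q => #|below le Q|) SP.
exists Q => // Q' SQ'; have /orP[Q'Q|//] := le_comp (SA _ SQ') (SA _ SQ).
have /eqP e : below le Q' == below le Q.
  rewrite eqEcard; apply/andP; split; last exact: (mQ Q' SQ').
  by apply/fintype.subsetP => B; rewrite !inE => /le_trans; apply.
by have : Q \in below le Q' by [rewrite e inE]; rewrite inE.
Qed.

Lemma parentP Q :
  if parent Q is Some P
  then [/\ le Q P, P != Q & forall P', le Q P' -> P' != Q -> le P P']
  else forall P', le Q P' -> P' = Q.
Proof.
rewrite /parent; case: pickP => [P /and3P[QP PQ /forallP h]|h].
  by split => // P' QP' P'Q; have := h P'; rewrite QP' P'Q.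
move=> P QP; apply/eqP/negPn/negP => PQ.
have [P0 /andP[QP0 P0Q] mP0] : exists2 P0, le Q P0 && (P0 != Q) &
    forall P', le Q P' && (P' != Q) -> le P0 P'.
  by apply: (@forest_min _ Q P) => [P' /andP[]|]; last exact/andP.
have := h P0; rewrite QP0 P0Q /= => /negbT/forallPn[P'].
by rewrite negb_imply => /andP[/mP0 ->].
Qed.

Lemma card_above_parent Q P : le Q P -> P != Q ->
  (forall P', le Q P' -> P' != Q -> le P P') -> #|above Q| = #|above P|.+1.
Proof.
move=> QP PQ mP; rewrite (cardsD1 Q) inE le_refl add1n; congr _.+1.
apply: eq_card => P'; rewrite !inE; apply/andP/idP => [[P'Q QP']|PP'].
  exact: mP.
split; last exact: le_trans PP'.
by apply: contraNneq PQ => P'Q; apply/eqP/le_anti; rewrite QP -P'Q PP'.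
Qed.

Lemma anchorE Q : anchor Q =
  if parent Q is Some P then if stop (anchor P) Q then Q else anchor P else Q.
Proof.
rewrite /anchor; have := parentP Q; case pQ: (parent Q) => [P|].
  by move=> [QP PQ mP]; rewrite (card_above_parent QP PQ mP) /= pQ.
by case: #|above Q| => //= n _; rewrite pQ.
Qed.

Lemma forest_ind (K : I -> Prop) :
  (forall Q, (forall P, le Q P -> P != Q -> K P) -> K Q) -> forall Q, K Q.
Proof.
move=> h Q; have [n] := ubnP #|above Q|; elim: n => // n IHn in Q *.
rewrite ltnS => Qn; apply: h => P QP PQ; apply: IHn; apply: leq_trans Qn.
apply: proper_card; rewrite properE; apply/andP; split.
  by apply/fintype.subsetP => B; rewrite !inE; exact: le_trans.
apply/negP => /fintype.subsetP /(_ Q); rewrite !inE le_refl => /(_ isT) PQ'.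
by move: PQ; rewrite (le_anti (introT andP (conj QP PQ'))) eqxx.
Qed.

Lemma le_anchor Q : le Q (anchor Q).
Proof.
elim/forest_ind: Q => Q IH; rewrite anchorE; have := parentP Q; case: (parent Q) => [P [QP PQ _]|_].
  by case: ifP => _; [exact: le_refl|exact: le_trans QP (IH _ QP PQ)].
exact: le_refl.
Qed.

Lemma anchor_convex Q R : le Q R -> le R (anchor Q) -> anchor R = anchor Q.
Proof.
elim/forest_ind: Q => Q IH QR; have [->//|RQ] := eqVneq R Q.
rewrite anchorE; have := parentP Q.
case: (parent Q) => [P [QP PQ mP]|/(_ _ QR) RQ']; last first.
  by rewrite RQ' eqxx in RQ.
case: ifP => _ RF; last by apply: IH => //; exact: mP.
by move: RQ; rewrite (le_anti (introT andP (conj RF QR))) eqxx.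
Qed.

Lemma anchorK Q : anchor (anchor Q) = anchor Q.
Proof. by apply: anchor_convex; [exact: le_anchor|exact: le_refl]. Qed.

Lemma anchor_nostop Q : anchor Q != Q -> ~~ stop (anchor Q) Q.
Proof.
rewrite anchorE; have := parentP Q.
case: (parent Q) => [P [QP PQ mP]|]; last by rewrite eqxx.
by case: ifP => [|/negbT//]; rewrite eqxx.
Qed.

Lemma anchor_mono Q R : le Q R -> le (anchor Q) (anchor R).
Proof.
move=> QR; have /orP[RF|FR] := le_comp QR (le_anchor Q).
  by rewrite (anchor_convex QR RF).
exact: le_trans FR (le_anchor R).
Qed.

Lemma anchor_neq_stop A F : anchor F = F -> le A F -> anchor A != F ->
  exists R, [/\ le A R, le R F & stop F R].
Proof.
move=> FF; elim/forest_ind: A => A IH AF nF.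
have AF' : F != A by apply: contraNneq nF => <-; apply/eqP.
move: nF; rewrite anchorE; have := parentP A.
case: (parent A) => [P [AP PA mP]|/(_ _ AF) FA].
  have PF : le P F by exact: mP.
  have [PF'|nF _] := eqVneq (anchor P) F.
    by rewrite PF'; case: ifP => [sA _|_]; [exists A|rewrite eqxx].
  have [R [PR RF sR]] := IH P AP PA PF nF.
  by exists R; split => //; exact: le_trans PR.
by rewrite FA eqxx in AF'.
Qed.

End stopping.

Section sparse.
Context {R : realType} {I : finType}.
Variables (le stop : rel I) (s phi : I -> R) (p p' : R).
Hypothesis le_forest : is_forest le.
Hypothesis s_ge0 : forall A, 0 <= s A.
Hypothesis phi_ge0 : forall A, 0 <= phi A.
Hypothesis p_gt1 : 1 < p.
Hypothesis pp' : p^-1 + p'^-1 = 1.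

Definition savgR (Q : I) : R := savg s (phi : I -> R^o) (below le Q).

Hypothesis sparse_stop : forall F,
  \sum_(A in below le F | [exists Q, [&& le A Q, le Q F & stop F Q]]) s A <=
  smass s (below le F) / 2.

Lemma savgR_ge0 Q : 0 <= savgR Q.
Proof.
rewrite /savgR /savg; apply: mulr_ge0; first by rewrite invr_ge0 smass_ge0.
by apply: sumr_ge0 => A _; exact: mulr_ge0.
Qed.

(** The part of a stopping cube that is not covered by later stopping cubes
carries half of its mass, and these parts are disjoint. *)
Lemma carleson_anchor :
  \sum_(F | anchor le stop F == F) smass s (below le F) * savgR F `^ p <=
  2 * (p' `^ p * \sum_A s A * phi A `^ p).
Proof.
have p0 : 0 < p by apply: lt_trans p_gt1.
have half F : anchor le stop F = F ->
    smass s (below le F) <= 2 * \sum_(A | anchor le stop A == F) s A.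
  move=> FF; have := sparse_stop F.
  have -> : smass s (below le F) =
      \sum_(A in below le F | anchor le stop A == F) s A +
      \sum_(A in below le F | anchor le stop A != F) s A.
    by rewrite -bigID.
  have -> : \sum_(A in below le F | anchor le stop A == F) s A =
      \sum_(A | anchor le stop A == F) s A.
    apply: eq_bigl => A; rewrite inE; apply/andb_idl => /eqP <-.
    exact: le_anchor.
  have : \sum_(A in below le F | anchor le stop A != F) s A <=
      \sum_(A in below le F | [exists Q, [&& le A Q, le Q F & stop F Q]]) s A.
    apply: ler_sum_sub => // A; rewrite !inE => /andP[AF nA]; rewrite AF /=.
    have [Q [AQ QF sQ]] := anchor_neq_stop le_forest FF AF nA.
    by apply/existsP; exists Q; rewrite AQ QF.
  lra.
apply: le_trans (_ : \sum_(F | anchor le stop F == F)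
    2 * \sum_(A | anchor le stop A == F) s A * savgR (anchor le stop A) `^ p <= _).
  apply: ler_sum => F /eqP FF; rewrite (eq_bigr (fun A => s A * savgR F `^ p)).
    by rewrite -mulr_suml mulrA ler_wpM2r ?powR_ge0// half.
  by move=> A /eqP ->.
rewrite -mulr_sumr ler_pM2l//; apply: le_trans (doob p_gt1 pp' le_forest s_ge0 phi_ge0).
rewrite [leRHS](partition_big (anchor le stop) (fun F => anchor le stop F == F))/=.
  apply: ler_sum => F _; apply: ler_sum => A _; apply: ler_wpM2l => //.
  apply: ge0_ler_powR; rewrite ?nnegrE ?(ltW p0) ?savgR_ge0 ?smax_ge0//.
  by apply: (smax_ub savgR); rewrite inE le_anchor.
by move=> A _; rewrite anchorK.
Qed.

End sparse.

(** * Stopping cubes *)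

(** Here the Bellman function is explicit: [1 - x / lam] once the maximal
function exceeds [lam], and the minimum of this with [0] before. *)
Lemma scalar_weak_type (R : realType) (I : finType) (le : rel I) (s phi : I -> R) (lam : R) F :
  is_forest le -> (forall A, 0 <= s A) -> (forall A, 0 <= phi A) -> 0 < lam ->
  \sum_(A in below le F)
    s A * (if lam < smax (savgR le s phi) [set Q | le A Q & le Q F] then 1 else 0) <=
  lam^-1 * \sum_(A in below le F) s A * phi A.
Proof.
move=> fle s0 f0 l0; set a := savgR le s phi.
pose gain (X : {set I}) : R := if lam < smax a X then 1 else 0.
pose B (x : R^o) (X : {set I}) : R := if lam < smax a X then 1 - lam^-1 * (x : R)
  else Num.min 0 (1 - lam^-1 * (x : R)).
have concB X (t : R) (x y : R^o) : 0 <= (x : R) -> 0 <= (y : R) -> 0 <= t -> t <= 1 ->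
    t * B x X + (1 - t) * B y X <= B (t *: x + (1 - t) *: y) X.
  move=> _ _ t0 t1; rewrite /B.
  have -> : (t *: x + (1 - t) *: y : R^o) = (t * x + (1 - t) * y : R) by [].
  case: ifP => _; first by apply/eqr_le; ring.
  have t1' : 0 <= 1 - t by rewrite subr_ge0.
  rewrite le_min; apply/andP; split.
    have mn (z : R) : Num.min 0 z <= 0 by rewrite ge_min lexx.
    by rewrite -[leRHS](addr0 0); exact: lerD (mulr_ge0_le0 t0 (mn _)) (mulr_ge0_le0 t1' (mn _)).
  apply: le_trans (_ : t * (1 - lam^-1 * x) + (1 - t) * (1 - lam^-1 * y) <= _).
    by apply: lerD; apply: ler_wpM2l => //; rewrite ge_min lexx orbT.
  by apply/eqr_le; ring.
have jumpB X Q : B (a Q) (Q |: X) <= B (a Q) X.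
  rewrite /B smaxU1; set m := smax a X; set x := a Q.
  have [xm|mx] := leP x m => //.
  case: ltP => lx; last by rewrite ltNge (le_trans (ltW mx) lx).
  case: ltP => // _; rewrite le_min lexx andbT subr_le0.
  by rewrite mulrC ler_pdivlMr// mul1r ltW.
have endB X (x : R^o) : 0 <= (x : R) -> gain X - lam^-1 * (x : R) <= B x X.
  move=> x0; have lx : 0 <= lam^-1 * (x : R) by rewrite mulr_ge0// invr_ge0 ltW.
  rewrite /gain /B; case: ifP => _ //; rewrite sub0r le_min oppr_le0 lx/=.
  by rewrite -[leLHS]add0r lerD2r.
have := @bellman_forest R I R^o le s phi (fun x => 0 <= (x : R))
  gain (fun x => lam^-1 * (x : R)) B fle s0 (lexx 0)
  (fun x y => @addr_ge0 R x y) (fun x y => @mulr_ge0 R x y) f0 concB jumpB endB F.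
have : smass s (below le F) * B (savg s (phi : I -> R^o) (below le F)) finset.set0 <= 0.
  apply: mulr_ge0_le0; first exact: smass_ge0.
  by rewrite /B /smax big_set0 ltNge (ltW l0) /= ge_min lexx.
move=> h /le_trans /(_ h) {}h; rewrite -subr_le0; apply: le_trans h; apply/eqr_le.
rewrite mulr_sumr -sumrB; apply: eq_bigr => A _.
by rewrite mulrBr mulrCA.
Qed.

Section stopping_condition.
Context {R : realType} {I : finType} {E : banachLatticeType R}.
Variables (le : rel I) (s : I -> R) (f : I -> E) (cw : R).
Hypothesis le_forest : is_forest le.
Hypothesis s_ge0 : forall A, 0 <= s A.
Hypothesis f_ge0 : forall A, lle 0 (f A).
Hypothesis cw_gt0 : 0 < cw.
Implicit Types A F Q : I.

Definition chain A F : {set I} := [set Q | le A Q & le Q F].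

Definition lavg Q : E := savg s f (below le Q).
Definition navg Q : R := savgR le s (fun A => `|f A|) Q.

Hypothesis weak : forall lam F, 0 < lam ->
  \sum_(A in below le F) s A * exceeds lam (sjoin lavg (chain A F)) <=
  cw / lam * \sum_(A in below le F) s A * `|f A|.

(** Without a jump of the second kind the supremum of the averages between [Q] and
[F] is a bounded test function; without one of the first kind the averages of
the norm are comparable to those over the stopping cubes. *)
Definition stop F Q : bool :=
  (4 * navg F < navg Q) || (4 * cw * navg F < `|sjoin lavg (chain Q F)|).

Lemma navg_ge0 Q : 0 <= navg Q. Proof. exact: savgR_ge0. Qed.

Lemma lavg_ge0 Q : lle 0 (lavg Q).
Proof.
apply: lleZ_ge0; first by rewrite invr_ge0 smass_ge0.
by apply: lsum_ge0 => A _; exact: lleZ_ge0.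
Qed.

Lemma norm_savg (U : {set I}) :
  `|savg s f U| <= savg s ((fun A => `|f A|) : I -> R^o) U.
Proof.
rewrite normrZ ger0_norm ?invr_ge0 ?smass_ge0// ler_wpM2l ?invr_ge0 ?smass_ge0//.
apply: le_trans (ler_norm_sum _ _ _) _; apply: ler_sum => A _.
by rewrite normrZ ger0_norm.
Qed.

Lemma norm_lavg Q : `|lavg Q| <= navg Q. Proof. exact: norm_savg. Qed.

Lemma smass_navg Q :
  smass s (below le Q) * navg Q = \sum_(A in below le Q) s A * `|f A|.
Proof.
exact: (@smass_savg R I R^o s (fun A => `|f A|) (below le Q) s_ge0).
Qed.

Lemma navg0 F Q : le Q F -> navg F = 0 -> navg Q = 0.
Proof.
have [_ _ letr _] := le_forest.
move=> QF F0; have := smass_navg F; rewrite F0 mulr0 => /esym/eqP.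
rewrite psumr_eq0 => [|A _]; last by rewrite mulr_ge0.
move=> /allP h; rewrite /navg /savgR /savg /sinteg big1 ?scaler0// => A.
rewrite inE => AQ; have := h A (mem_index_enum _).
by rewrite inE (letr _ _ _ AQ QF) => /eqP.
Qed.

Lemma stop_navg_gt0 F Q : le Q F -> stop F Q -> 0 < navg F.
Proof.
have [_ _ letr _] := le_forest.
move=> QF; rewrite lt_def navg_ge0 andbT; apply: contraTneq => F0.
rewrite /stop F0 !mulr0 (navg0 QF F0) ltxx /= -leNgt normr_le0; apply/eqP.
apply: lle_anti; last exact: sjoin_ge0.
apply: sjoin_lub => [|P]; first exact: llexx.
rewrite inE => /andP[_ PF].
have -> : lavg P = 0 by apply/eqP; rewrite -normr_le0 -(navg0 PF F0) norm_lavg.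
exact: llexx.
Qed.

(** Both halves of the stopping condition are of weak type (1,1); the constants
are chosen so that each covers a quarter of the mass. *)
Lemma sparse_stop F :
  \sum_(A in below le F | [exists Q, [&& le A Q, le Q F & stop F Q]]) s A <=
  smass s (below le F) / 2.
Proof.
have [_ _ letr _] := le_forest.
have [F0|F0] := eqVneq (navg F) 0.
  rewrite big1 ?divr_ge0 ?smass_ge0// => A /andP[_ /existsP[Q /and3P[_ QF]]].
  by move=> /(stop_navg_gt0 QF); rewrite F0 ltxx.
have Fp : 0 < navg F by rewrite lt_def F0 navg_ge0.
have l4 : 0 < 4 * navg F by rewrite mulr_gt0.
have lc : 0 < 4 * cw * navg F by apply: mulr_gt0 => //; exact: mulr_gt0.
have w1 := @scalar_weak_type R I le s (fun A => `|f A|) _ F le_forest s_ge0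
  (fun A => normr_ge0 _) l4.
have w2 := weak F lc.
rewrite -smass_navg in w1 w2.
set m := smass _ _ in w1 w2 *.
have e1 : (4 * navg F)^-1 * (m * navg F) = m / 4 by field.
have e2 : cw / (4 * cw * navg F) * (m * navg F) = m / 4.
  by field; rewrite F0/= gt_eqF.
rewrite e1 in w1; rewrite e2 in w2.
apply: le_trans (_ : m / 4 + m / 4 <= _); last by lra.
apply: le_trans (lerD w1 w2); rewrite -big_split/= big_mkcondr/=.
apply: ler_sum => A AF; rewrite -mulrDr; case: ifPn => [/existsP[Q /and3P[AQ QF sQ]]|_].
  rewrite ler_peMr//; case/orP: sQ => [sQ|sQ].
    rewrite ifT; first by rewrite lerDl exceeds_ge0.
    apply: lt_le_trans sQ _; apply: (@smax_ub _ _ (savgR le s (fun A => `|f A|))).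
    by rewrite inE AQ QF.
  apply: ler_wpDl; first by case: ifP.
  apply: le_trans (_ : exceeds (4 * cw * navg F) (sjoin lavg (chain Q F)) <= _).
    by rewrite /exceeds sQ.
  apply: exceeds_mono; first exact: sjoin_ge0.
  apply: sjoin_sub; apply/fintype.subsetP => P; rewrite !inE => /andP[QP ->].
  by rewrite (letr _ _ _ AQ QP).
by rewrite mulr_ge0// addr_ge0 ?exceeds_ge0//; case: ifP.
Qed.

Lemma stop_irrefl F : ~~ stop F F.
Proof.
have [ler _ _ _] := le_forest.
apply/negP => sF; have Fp := stop_navg_gt0 (ler F) sF.
have := sparse_stop F.
rewrite (eq_bigl (fun A => A \in below le F)) => [|A]; last first.
  rewrite inE; apply/andb_idr => AF; apply/existsP; exists F.
  by rewrite AF ler.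
rewrite -/(smass s _) => h; have m0 := smass_ge0 (below le F) s_ge0.
have {h m0}m0 : smass s (below le F) = 0 by apply/le_anti/andP; split => //; lra.
by move: Fp; rewrite /navg /savgR /savg m0 invr0 scale0r ltxx.
Qed.

Definition stopping Q : I := anchor le stop Q.

Lemma stopping_nostop Q : ~~ stop (stopping Q) Q.
Proof.
have [e|] := eqVneq (stopping Q) Q; last exact: anchor_nostop.
by rewrite e; exact: stop_irrefl.
Qed.

Lemma navg_stopping Q : navg Q <= 4 * navg (stopping Q).
Proof. by have := stopping_nostop Q; rewrite negb_or -!leNgt => /andP[]. Qed.

Lemma sjoin_stopping Q :
  `|sjoin lavg (chain Q (stopping Q))| <= 4 * cw * navg (stopping Q).
Proof. by have := stopping_nostop Q; rewrite negb_or -!leNgt => /andP[]. Qed.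

Lemma carleson_stopping (p p' : R) : 1 < p -> p^-1 + p'^-1 = 1 ->
  \sum_(F | stopping F == F) smass s (below le F) * navg F `^ p <=
  2 * (p' `^ p * \sum_A s A * `|f A| `^ p).
Proof.
by move=> p1 pp'; apply: (carleson_anchor le_forest s_ge0 _ p1 pp' sparse_stop).
Qed.

End stopping_condition.

(** * The one-sided part of the bilinear form *)

Lemma powR_div (R : realType) (x y e : R) : 0 <= x -> 0 <= y ->
  (x / y) `^ e = x `^ e / y `^ e.
Proof.
move=> x0 y0; rewrite powRM ?invr_ge0//; congr (_ * _).
by rewrite -[y^-1]powR_inv1// -powRrM mulN1r powRN.
Qed.

Section finite_hoelder.
Context {R : realType} {I : finType}.

Lemma psum_powR_eq0 (P : pred I) (x : I -> R) (p : R) : p != 0 ->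
  (forall i, 0 <= x i) -> \sum_(i | P i) x i `^ p = 0 -> forall i, P i -> x i = 0.
Proof.
move=> p0 x0 /eqP; rewrite psumr_eq0 => [/allP h i Pi|i _]; last exact: powR_ge0.
by have := h i (mem_index_enum _); rewrite Pi => /eqP/powR_eq0_eq0.
Qed.

(** Hoelder's inequality on a counting measure allows exponents whose inverses
add up to more than one, since l^r norms decrease with r. *)
Lemma hoelder_sum (P : pred I) (x y : I -> R) (p r : R) :
  1 < p -> 0 < r -> 1 <= p^-1 + r^-1 ->
  (forall i, 0 <= x i) -> (forall i, 0 <= y i) ->
  \sum_(i | P i) x i * y i <=
  (\sum_(i | P i) x i `^ p) `^ p^-1 * (\sum_(i | P i) y i `^ r) `^ r^-1.
Proof.
move=> p1 r0 pr x0 y0; have p0 : 0 < p by apply: lt_trans p1.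
have sum_ge0 (z : I -> R) e : 0 <= \sum_(i | P i) z i `^ e.
  by apply: sumr_ge0 => i _; exact: powR_ge0.
set X := _ `^ p^-1; set Y := _ `^ r^-1.
have X0 : 0 <= X by exact: powR_ge0.
have Y0 : 0 <= Y by exact: powR_ge0.
have XE : X `^ p = \sum_(i | P i) x i `^ p.
  by rewrite -powRrM mulVf ?gt_eqF// powRr1.
have YE : Y `^ r = \sum_(i | P i) y i `^ r.
  by rewrite -powRrM mulVf ?gt_eqF// powRr1.
clearbody X Y.
have [X00|Xn] := eqVneq X 0.
  move: XE; rewrite X00 powR0 ?gt_eqF// => /esym/(psum_powR_eq0 (lt0r_neq0 p0) x0) h.
  by rewrite big1 => [|i /h ->]; rewrite mul0r.
have [Y00|Yn] := eqVneq Y 0.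
  move: YE; rewrite Y00 powR0 ?gt_eqF// => /esym/(psum_powR_eq0 (lt0r_neq0 r0) y0) h.
  by rewrite big1 => [|i /h ->]; rewrite mulr0.
have Xp : 0 < X by rewrite lt_def Xn.
have Yp : 0 < Y by rewrite lt_def Yn.
pose p' := (1 - p^-1)^-1.
have ip1 : p^-1 < 1 by rewrite invf_lt1.
have p'0 : 0 < p' by rewrite invr_gt0 subr_gt0.
have pp' : p^-1 + p'^-1 = 1 by rewrite invrK addrC subrK.
have rp' : r <= p' by rewrite -[r]invrK lef_pV2 ?posrE ?invr_gt0 ?subr_gt0//; lra.
have key i : P i -> (x i / X) * (y i / Y) <=
    (x i `^ p / X `^ p) / p + (y i `^ r / Y `^ r) / p'.
  move=> Pi; have u0 : 0 <= x i / X by rewrite divr_ge0.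
  have v0 : 0 <= y i / Y by rewrite divr_ge0.
  have v1 : y i / Y <= 1.
    rewrite ler_pdivrMr// mul1r leNgt; apply/negP => Yy.
    have : Y `^ r < y i `^ r by apply: gt0_ltr_powR; rewrite ?nnegrE.
    rewrite YE ltNge => /negP; apply.
    by rewrite (bigD1 i)//= lerDl sumr_ge0// => j _; exact: powR_ge0.
  apply: le_trans (conjugate_powR u0 v0 p0 p'0 pp') _; apply: lerD.
    by rewrite powR_div.
  apply: ler_wpM2r; first by rewrite invr_ge0 ltW.
  rewrite -powR_div//.
  have [->|vn] := eqVneq (y i / Y) 0; first by rewrite !powR0 ?gt_eqF.
  by apply: ger_powR => //; rewrite lt_def vn v0.
rewrite -[leRHS]mul1r -ler_pdivrMr ?mulr_gt0// mulr_suml.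
apply: le_trans (_ : \sum_(i | P i) ((x i `^ p / X `^ p) / p + (y i `^ r / Y `^ r) / p') <= _).
  by apply: ler_sum => i Pi; apply: le_trans (key i Pi); rewrite invfM mulrACA.
rewrite big_split/= -!mulr_suml -XE -YE !divff ?mul1r ?pp'//;
  by rewrite gt_eqF// powR_gt0.
Qed.

End finite_hoelder.

Section one_sided_sum.
Context {R : realType} {I : finType} {C E : banachLatticeType R}.
Variables (le : rel I) (s w : I -> R) (f : I -> C) (g : I -> E).
Variables (cf cg p p' r r' T : R) (beta : I -> C -> E -> R).
Hypothesis le_forest : is_forest le.
Hypothesis s_ge0 : forall A, 0 <= s A.
Hypothesis w_ge0 : forall A, 0 <= w A.
Hypothesis f_ge0 : forall A, lle 0 (f A).
Hypothesis g_ge0 : forall A, lle 0 (g A).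
Hypothesis cf_gt0 : 0 < cf.
Hypothesis cg_gt0 : 0 < cg.
Hypothesis weak_f : forall lam F, 0 < lam ->
  \sum_(A in below le F) s A * exceeds lam (sjoin (lavg le s f) (chain le A F)) <=
  cf / lam * \sum_(A in below le F) s A * `|f A|.
Hypothesis weak_g : forall lam F, 0 < lam ->
  \sum_(A in below le F) w A * exceeds lam (sjoin (lavg le w g) (chain le A F)) <=
  cg / lam * \sum_(A in below le F) w A * `|g A|.
Hypothesis p_gt1 : 1 < p.
Hypothesis r_gt1 : 1 < r.
Hypothesis pp' : p^-1 + p'^-1 = 1.
Hypothesis rr' : r^-1 + r'^-1 = 1.
Hypothesis pr : 1 <= p^-1 + r^-1.
Hypothesis T_ge0 : 0 <= T.
Hypothesis beta_ge0 : forall Q c e, lle 0 c -> lle 0 e -> 0 <= beta Q c e.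
Hypothesis beta_mono : forall Q c c' e e',
  lle 0 c -> lle c c' -> lle 0 e -> lle e e' -> beta Q c e <= beta Q c' e'.
Hypothesis testing : forall F (h : I -> C) (k : I -> E) L,
  0 <= L -> (forall A, lle 0 (h A)) -> (forall A, lle 0 (k A)) ->
  (forall A, `|h A| <= L) ->
  \sum_(Q in below le F) beta Q (sinteg s h (below le Q)) (sinteg w k (below le Q)) <=
  T * L * smass s (below le F) `^ p^-1 * (\sum_A w A * `|k A| `^ r) `^ r^-1.

Let le_refl : reflexive le. Proof. by case: le_forest. Qed.
Let le_anti : antisymmetric le. Proof. by case: le_forest. Qed.
Let le_tr : transitive le. Proof. by case: le_forest. Qed.
Let le_comp A P Q : le A P -> le A Q -> le P Q || le Q P.
Proof. by case: le_forest => _ _ _; apply. Qed.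

Let r_gt0 : 0 < r. Proof. exact: lt_trans r_gt1. Qed.
Let p_gt0 : 0 < p. Proof. exact: lt_trans p_gt1. Qed.

Let pif := stopping le s f cf.
Let pig := stopping le w g cg.

Let le_pif Q : le Q (pif Q). Proof. exact: le_anchor. Qed.
Let le_pig Q : le Q (pig Q). Proof. exact: le_anchor. Qed.
Let pif_convex Q P : le Q P -> le P (pif Q) -> pif P = pif Q.
Proof. exact: anchor_convex. Qed.
Let pifK Q : pif (pif Q) = pif Q. Proof. exact: anchorK. Qed.
Let pif_mono Q P : le Q P -> le (pif Q) (pif P). Proof. exact: anchor_mono. Qed.
Let pig_mono Q P : le Q P -> le (pig Q) (pig P). Proof. exact: anchor_mono. Qed.

(** The supremum of the averages of [f] over the cubes stopped at [F] that contain
[A]: it dominates all these averages, and the stopping condition bounds it. *)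
Definition test_f F A : C :=
  if [pick Q | [&& le A Q, pif Q == F &
        [forall Q', (le A Q' && (pif Q' == F)) ==> le Q Q']]] is Some Q
  then sjoin (lavg le s f) (chain le Q F) else 0.

Let test_f_ge0 F A : lle 0 (test_f F A).
Proof. by rewrite /test_f; case: pickP => *; [exact: sjoin_ge0|exact: llexx]. Qed.

Let norm_test_f F A : `|test_f F A| <= 4 * cf * navg le s f F.
Proof.
rewrite /test_f; case: pickP => [Q /and3P[_ /eqP <- _]|_].
  exact: sjoin_stopping.
rewrite normr0; apply: mulr_ge0; last exact: navg_ge0.
by rewrite mulr_ge0// ltW.
Qed.

Let lavg_le_test_f Q A : le A Q -> lle (lavg le s f Q) (test_f (pif Q) A).
Proof.
move=> AQ; rewrite /test_f; case: pickP => [Q0 /and3P[AQ0 _ /forallP/(_ Q)]|].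
  by rewrite AQ eqxx /= => Q0Q; apply: sjoin_ub; rewrite inE Q0Q le_pif.
have [Q0 /andP[AQ0 QQ0] mQ0] : exists2 Q0, le A Q0 && (pif Q0 == pif Q) &
    forall P, le A P && (pif P == pif Q) -> le Q0 P.
  by apply: (forest_min le_forest (A := A) (P := Q)) => [P /andP[]//|]; rewrite AQ eqxx.
move=> /(_ Q0); rewrite AQ0 QQ0 /= => /negbT/forallPn[P].
by rewrite negb_imply => /andP[/mQ0 ->].
Qed.

Let integ_f_le Q :
  lle (sinteg s f (below le Q)) (sinteg s (test_f (pif Q)) (below le Q)).
Proof.
rewrite -(smass_savg f _ s_ge0) /smass scaler_suml.
apply/lsub_ge0; rewrite -sumrB; apply: lsum_ge0 => A; rewrite inE => AQ.
apply/lsub_ge0; apply: lleZ => //; exact: lavg_le_test_f.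
Qed.

(** The largest cube between [A] and [F] that is not stopped at [F]; it is itself
a stopping cube. *)
Definition child F A : option I :=
  [pick P | [&& le A P, le P F, pif P != F &
     [forall P', [&& le A P', le P' F & pif P' != F] ==> le P' P]]].

Lemma childP F A P : child F A = Some P -> [/\ le A P, le P F, pif P != F &
  forall P', le A P' -> le P' F -> pif P' != F -> le P' P].
Proof.
rewrite /child; case: pickP => // Q /and4P[AQ QF nQ /forallP h] [<-]; split => //.
by move=> P' AP' P'F nP'; have := h P'; rewrite AP' P'F nP'.
Qed.

Lemma child_some F A : le A F -> pif A != F -> exists P, child F A = Some P.
Proof.
move=> AF nA; rewrite /child; case: pickP => [P _|]; first by exists P.
have [P /and3P[AP PF nP] mP] : exists2 P, [&& le A P, le P F & pif P != F] &
    forall P', [&& le A P', le P' F & pif P' != F] -> le P' P.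
  apply: (forest_max le_forest (A := A) (P := A)) => [P /and3P[]//|].
  by rewrite le_refl AF nA.
move=> /(_ P); rewrite AP PF nP /= => /negbT/forallPn[P'].
by rewrite negb_imply => /andP[/mP ->].
Qed.

Lemma child_stopping F A P : pif F = F -> child F A = Some P -> pif P = P.
Proof.
move=> FF /childP[AP PF nP mP]; apply: le_anti; rewrite le_pif andbT.
apply: mP; first exact: le_tr (le_pif P).
  by rewrite -[X in le _ X]FF pif_mono.
by rewrite pifK.
Qed.

Definition relevant F P : bool :=
  [exists Q, [&& le P Q, pif Q == F & le (pig Q) F]].

(** The conditional expectation of [g] with respect to the stopping children of
[F], kept only where some cube of the one-sided sum stopped at [F] sees it. *)
Definition test_g F A : E :=
  if pif A == F then g A else
  if child F A is Some P then if relevant F P then lavg le w g P else 0 else 0.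

Let test_g_ge0 F A : lle 0 (test_g F A).
Proof.
rewrite /test_g; case: ifP => // _; case: child => [P|]; last exact: llexx.
by case: ifP => _; [exact: lavg_ge0|exact: llexx].
Qed.

Let integ_g_eq Q : le (pig Q) (pif Q) ->
  sinteg w (test_g (pif Q)) (below le Q) = sinteg w g (below le Q).
Proof.
set F := pif Q => gF; have FF : pif F = F by exact: pifK.
have QF : le Q F by exact: le_pif.
rewrite /sinteg [LHS](bigID (fun A => pif A == F))/= [RHS](bigID (fun A => pif A == F))/=.
congr (_ + _).
  by apply: eq_bigr => A /andP[_ AF]; rewrite /test_g AF.
pose ch A := odflt A (child F A).
rewrite [LHS](partition_big ch predT)//= [RHS](partition_big ch predT)//=.
apply: eq_bigr => P _.
have [[A0 /andP[]]|nA] := pselect (exists A0, [&& A0 \in below le Q, pif A0 != F & ch A0 == P]); last first.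
  by rewrite !big_pred0// => A; apply/negP => hA; apply: nA; exists A; rewrite andbA.
rewrite inE => A0Q /andP[nA0 /eqP chA0].
have A0F : le A0 F by exact: le_tr QF.
have [P' cP'] := child_some A0F nA0.
have P'P : P' = P by rewrite -chA0 /ch cP'.
rewrite {}P'P in cP'; have [A0P PF nP mP] := childP cP'.
have PP := child_stopping FF cP'.
have PQ : le P Q.
  have /orP[//|QP] := le_comp A0P A0Q.
  by move: nP; rewrite (pif_convex QP PF) eqxx.
have rel : relevant F P by apply/existsP; exists Q; rewrite PQ eqxx.
have cell A : le A P -> child F A = Some P.
  move=> AP; have nA : pif A != F.
    by apply: contraNneq nP => AF; rewrite (pif_convex AP)// AF.
  have [P1 cP1] := child_some (le_tr AP PF) nA; rewrite cP1; congr Some.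
  have [AP1 P1F nP1 mP1] := childP cP1; apply: le_anti; apply/andP; split.
    by apply: mP => //; apply: le_tr A0P _; exact: mP1.
  exact: mP1.
have eqcell A : [&& A \in below le Q, pif A != F & ch A == P] = (A \in below le P).
  rewrite !inE; apply/and3P/idP => [[AQ nA /eqP <-]|AP].
    by have [P1 cP1] := child_some (le_tr AQ QF) nA; rewrite /ch cP1; case: (childP cP1).
  split; first exact: le_tr PQ.
  - by apply: contraNneq nP => AF; rewrite (pif_convex AP)// AF.
  - by rewrite /ch cell.
rewrite (eq_bigl (fun A => A \in below le P)) => [|A]; last by rewrite -andbA eqcell.
rewrite [RHS](eq_bigl (fun A => A \in below le P)) => [|A]; last by rewrite -andbA eqcell.
rewrite -/(sinteg w g (below le P)) -(smass_savg g _ w_ge0) /smass scaler_suml.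
apply: eq_bigr => A; rewrite inE => AP; rewrite /test_g (cell _ AP) rel.
rewrite ifF//; apply/negP => /eqP AF; move: nP.
by rewrite (pif_convex AP) ?AF// eqxx.
Qed.

Let seen F A : bool := (pif A != F) &&
  (if child F A is Some P then relevant F P else false).

Let ch F A : I := odflt A (child F A).

Let norm_test_g F A : `|test_g F A| `^ r <=
  (if pif A == F then `|g A| `^ r else 0) +
  (if seen F A then navg le w g (ch F A) `^ r else 0).
Proof.
have z0 : (0 : R) `^ r = 0 by rewrite powR0// gt_eqF.
rewrite /test_g /seen /ch; case: ifP => _ /=; first by rewrite addr0.
rewrite add0r; case: child => [P|] /=; last by rewrite normr0 z0.
case: ifP => _ /=; last by rewrite normr0 z0.
by apply: ge0_ler_powR; rewrite ?nnegrE ?(ltW r_gt0) ?navg_ge0// norm_lavg.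
Qed.

(** At a fixed point each stopping cube of [g] is charged at most twice: once as
a stopping child, once as the stopping cube of [g] strictly above a child. *)
Let sum_seen A :
  \sum_(F | (pif F == F) && seen F A) navg le w g (ch F A) `^ r <=
  (1 + 4 `^ r) * \sum_(G | (pig G == G) && le A G) navg le w g G `^ r.
Proof.
have r0 := ltW r_gt0.
pose S : pred I := fun F => (pif F == F) && seen F A.
have SP F : S F -> [/\ le A (ch F A), le (ch F A) F, ch F A != F,
    le (pig (ch F A)) F & forall P', le A P' -> le P' F -> pif P' != F -> le P' (ch F A)].
  move=> /and3P[/eqP FF _]; rewrite /ch; case cP : (child F A) => [P|//] /=.
  have [AP PF nP mP] := childP cP => /existsP[Q /and3P[PQ _ gQ]]; split => //.
    by apply: contraNneq nP => ->; rewrite FF.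
  exact: le_tr (pig_mono PQ) gQ.
have step F1 F2 : S F1 -> S F2 -> F1 != F2 -> le F1 F2 -> le F1 (ch F2 A).
  move=> S1 S2 F12 F1F2; have [AP1 PF1 _ _ _] := SP _ S1; have [_ _ _ _ mP2] := SP _ S2.
  apply: mP2 => //; first exact: le_tr PF1.
  by case/andP : S1 => /eqP ->.
have comp F1 F2 : S F1 -> S F2 -> le F1 F2 || le F2 F1.
  move=> /SP[AP1 PF1 _ _ _] /SP[AP2 PF2 _ _ _].
  exact: le_comp (le_tr AP1 PF1) (le_tr AP2 PF2).
have inj1 F1 F2 : S F1 -> S F2 -> le F1 F2 -> ch F1 A = ch F2 A -> F1 = F2.
  move=> S1 S2 F12 e; apply/eqP/negPn/negP => nF.
  have := step _ _ S1 S2 nF F12; rewrite -e => F1P.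
  have [_ PF nP _ _] := SP _ S1; move: nP.
  by rewrite (le_anti (introT andP (conj PF F1P))) eqxx.
have inj2 F1 F2 : S F1 -> S F2 -> pig (ch F2 A) != ch F2 A -> le F1 F2 ->
    pig (ch F1 A) = pig (ch F2 A) -> F1 = F2.
  move=> S1 S2 n2 F12 e; apply/eqP/negPn/negP => nF.
  have F1P := step _ _ S1 S2 nF F12; have [_ _ _ G1 _] := SP _ S1; move: n2.
  have h : le (pig (ch F2 A)) (ch F2 A) by rewrite -e; exact: le_tr F1P.
  by rewrite (le_anti (introT andP (conj h (le_pig _)))) eqxx.
have nn (Q : I) : 0 <= navg le w g Q by exact: navg_ge0.
have sq0 (Q : I) : 0 <= navg le w g Q `^ r by exact: powR_ge0.
rewrite (bigID (fun F => pig (ch F A) == ch F A))/= mulrDl mul1r; apply: lerD.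
  apply: (@ler_sum_inj _ _ _ (fun F => ch F A)
    (fun F => S F && (pig (ch F A) == ch F A))
    (fun G => (pig G == G) && le A G) (fun G => navg le w g G `^ r)) => //.
    move=> F1 F2 /andP[S1 _] /andP[S2 _] e.
    by have /orP[h|h] := comp _ _ S1 S2; [exact: inj1|apply/esym/inj1].
  by move=> F /andP[/SP[AP _ _ _ _] ->].
rewrite mulr_sumr.
apply: le_trans (_ : \sum_(F | S F && (pig (ch F A) != ch F A))
    4 `^ r * navg le w g (pig (ch F A)) `^ r <= _).
  apply: ler_sum => F _; rewrite -powRM ?nn//.
  apply: ge0_ler_powR; rewrite ?nnegrE ?nn// ?(mulr_ge0 _ (nn _))//.
  exact: (navg_stopping le_forest w_ge0 cg_gt0 weak_g).
apply: (@ler_sum_inj _ _ _ (fun F => pig (ch F A))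
    (fun F => S F && (pig (ch F A) != ch F A))
    (fun G => (pig G == G) && le A G) (fun G => 4 `^ r * navg le w g G `^ r)) => //.
- by move=> G; rewrite mulr_ge0 ?powR_ge0.
- move=> F1 F2 /andP[S1 n1] /andP[S2 n2] e.
  by have /orP[h|h] := comp _ _ S1 S2; [exact: inj2|apply/esym/inj2].
- move=> F /andP[/SP[AP _ _ _ _] _]; rewrite [pig _ == _](_ : _ = true).
    exact: le_tr (le_pig _).
  by apply/eqP; exact: anchorK.
Qed.

Let sum_test_g :
  \sum_(F | pif F == F) \sum_A w A * `|test_g F A| `^ r <=
  (1 + (1 + 4 `^ r) * (2 * r' `^ r)) * \sum_A w A * `|g A| `^ r.
Proof.
rewrite exchange_big/= mulrDl mul1r.
apply: le_trans (_ : \sum_A (w A * `|g A| `^ r + (1 + 4 `^ r) *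
    \sum_(G | (pig G == G) && le A G) w A * navg le w g G `^ r) <= _).
  apply: ler_sum => A _; rewrite -!mulr_sumr mulrCA -mulrDr ler_wpM2l//.
  apply: le_trans (ler_sum _ (fun F _ => norm_test_g F A)) _; rewrite big_split/=.
  apply: lerD; last by rewrite -big_mkcondr; exact: sum_seen.
  rewrite -big_mkcondr/= (bigD1 (pif A))/=; last by rewrite pifK !eqxx.
  by rewrite big1 ?addr0// => F /andP[/andP[_ /eqP <-]]; rewrite eqxx.
rewrite big_split/= lerD2l -mulr_sumr -mulrA ler_wpM2l ?addr_ge0 ?powR_ge0//.
rewrite (exchange_big_dep (fun G => pig G == G))/=; last by move=> A G _ /andP[].
have := carleson_stopping le_forest w_ge0 cg_gt0 weak_g r_gt1 rr'.
rewrite -mulrA; apply: le_trans; apply: ler_sum => G GG.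
rewrite -mulr_suml /smass ler_wpM2r ?powR_ge0//.
by apply/eqr_le/eq_bigl => A; rewrite inE GG.
Qed.

Definition one_sided_const (p p' r r' : R) : R :=
  4 * ((2 * p' `^ p) `^ p^-1 * (1 + (1 + 4 `^ r) * (2 * r' `^ r)) `^ r^-1).

(** The pairs of stopping cubes with that of [g] inside that of [f]: testing on
[test_f] against [test_g], then Hoelder over the stopping cubes. *)
Lemma one_sided_bound :
  \sum_(Q | le (pig Q) (pif Q))
    beta Q (sinteg s f (below le Q)) (sinteg w g (below le Q)) <=
  one_sided_const p p' r r' * cf * T *
  ((\sum_A s A * `|f A| `^ p) `^ p^-1 * (\sum_A w A * `|g A| `^ r) `^ r^-1).
Proof.
pose X F := navg le s f F * smass s (below le F) `^ p^-1.
pose Y F := (\sum_A w A * `|test_g F A| `^ r) `^ r^-1.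
have m0 F : 0 <= smass s (below le F) by exact: smass_ge0.
have wr0 (k : I -> E) : 0 <= \sum_A w A * `|k A| `^ r.
  by apply: sumr_ge0 => A _; rewrite mulr_ge0 ?powR_ge0.
have sp0 : 0 <= \sum_A s A * `|f A| `^ p.
  by apply: sumr_ge0 => A _; rewrite mulr_ge0 ?powR_ge0.
have X0 F : 0 <= X F by rewrite mulr_ge0 ?navg_ge0 ?powR_ge0.
have Y0 F : 0 <= Y F by exact: powR_ge0.
have i0 (U : {set I}) : lle 0 (sinteg w g U).
  by apply: lsum_ge0 => A _; exact: lleZ_ge0.
have j0 (U : {set I}) : lle 0 (sinteg s f U).
  by apply: lsum_ge0 => A _; exact: lleZ_ge0.
have step F : pif F == F ->
    \sum_(Q | le (pig Q) (pif Q) && (pif Q == F))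
      beta Q (sinteg s f (below le Q)) (sinteg w g (below le Q)) <=
    4 * cf * T * (X F * Y F).
  move=> FF; apply: le_trans (_ : \sum_(Q in below le F)
      beta Q (sinteg s (test_f F) (below le Q)) (sinteg w (test_g F) (below le Q)) <= _).
    apply: le_trans (_ : \sum_(Q | le (pig Q) (pif Q) && (pif Q == F))
      beta Q (sinteg s (test_f F) (below le Q)) (sinteg w (test_g F) (below le Q)) <= _).
      apply: ler_sum => Q /andP[gQ /eqP QF]; rewrite -QF integ_g_eq//.
      by apply: beta_mono => //; exact: llexx.
    apply: ler_sum_sub => [Q|Q /andP[_ /eqP <-]]; last by rewrite inE.
    by apply: beta_ge0; apply: lsum_ge0 => A _; exact: lleZ_ge0.
  have L0 : 0 <= 4 * cf * navg le s f F.
    by apply: mulr_ge0; [rewrite mulr_ge0// ltW|exact: navg_ge0].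
  apply: le_trans (@testing F _ _ _ L0 (test_f_ge0 F) (test_g_ge0 F) (norm_test_f F)) _.
  by apply/eqr_le; rewrite /X /Y; ring.
rewrite (partition_big pif (fun F => pif F == F))/=; last by move=> Q _; rewrite pifK.
apply: le_trans (ler_sum _ step) _; rewrite -mulr_sumr.
have -> : one_sided_const p p' r r' * cf * T *
  ((\sum_A s A * `|f A| `^ p) `^ p^-1 * (\sum_A w A * `|g A| `^ r) `^ r^-1) =
  4 * cf * T * (((2 * p' `^ p) `^ p^-1 * (\sum_A s A * `|f A| `^ p) `^ p^-1) *
   ((1 + (1 + 4 `^ r) * (2 * r' `^ r)) `^ r^-1 * (\sum_A w A * `|g A| `^ r) `^ r^-1)).
  have E4 (a b c t u v : R) : 4 * (a * b) * c * t * (u * v) = 4 * c * t * ((a * u) * (b * v)).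
    by ring.
  exact: E4.
apply: ler_wpM2l; first by rewrite mulr_ge0// mulr_ge0// ltW.
have cp0 : 0 <= 2 * p' `^ p by rewrite mulr_ge0 ?powR_ge0.
have cr0 : 0 <= 1 + (1 + 4 `^ r) * (2 * r' `^ r).
  by rewrite addr_ge0// mulr_ge0 ?addr_ge0 ?mulr_ge0 ?powR_ge0.
apply: le_trans (hoelder_sum _ p_gt1 r_gt0 pr X0 Y0) _.
rewrite -!powRM//; apply: ler_pM; rewrite ?powR_ge0//; apply: ge0_ler_powR;
  rewrite ?nnegrE ?invr_ge0 ?(ltW p_gt0) ?(ltW r_gt0) ?mulr_ge0//;
  try exact: powR_ge0; try by apply: sumr_ge0 => i _; exact: powR_ge0.
- have := carleson_stopping le_forest s_ge0 cf_gt0 weak_f p_gt1 pp'.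
  rewrite -mulrA; apply: le_trans; apply: ler_sum => F _; rewrite /X powRM ?navg_ge0 ?powR_ge0//.
  by rewrite -powRrM mulVf ?gt_eqF// powRr1// mulrC.
- apply: le_trans sum_test_g; apply: ler_sum => F _; rewrite /Y.
  by rewrite -powRrM mulVf ?gt_eqF// powRr1.
Qed.

End one_sided_sum.

(** * The bilinear bound *)

Section bilinear_bound.
Context {R : realType} {I : finType}.
Variables (le : rel I).
Hypothesis le_forest : is_forest le.

Definition strong_btree (E : banachLatticeType R) (p M : R) : Prop :=
  forall t : btree E, tpos t -> tmax (fun x => `|x| `^ p) t 0 <=
    M `^ p * tint (fun x => `|x| `^ p) t.

Lemma strong_weak_forest (E : banachLatticeType R) (p M : R) (s : I -> R)
    (f : I -> E) : 1 < p -> 0 < M -> strong_btree E p M ->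
  (forall A, 0 <= s A) -> (forall A, lle 0 (f A)) ->
  forall lam F, 0 < lam ->
  \sum_(A in below le F) s A * exceeds lam (sjoin (lavg le s f) (chain le A F)) <=
  (1 + 2 `^ (p - 1)) * M / lam * \sum_(A in below le F) s A * `|f A|.
Proof.
move=> p1 M0 strong s0 f0 lam F lam0.
apply: (@weak_type_forest R E lam _ _ _ I le s f F le_forest s0 f0).
  by rewrite divr_ge0 ?mulr_ge0 ?addr_ge0 ?powR_ge0// ltW.
by move=> t tp; exact: weak_type_btree.
Qed.

Lemma split_constants (a b u v m n t t' x y : R) :
  0 <= a -> 0 <= b -> 0 <= u -> 0 <= v -> 0 <= m -> 0 <= n -> 0 <= t -> 0 <= t' ->
  0 <= x -> 0 <= y ->
  u * (a * m) * t * (x * y) + v * (b * n) * t' * (y * x) <=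
  (u * a + v * b) * (m * t + n * t') * (x * y).
Proof.
move=> a0 b0 u0 v0 m0 n0 t0 t0' x0 y0; rewrite -subr_ge0.
have -> : (u * a + v * b) * (m * t + n * t') * (x * y) -
    (u * (a * m) * t * (x * y) + v * (b * n) * t' * (y * x)) =
    (u * a * (n * t') + v * b * (m * t)) * (x * y) by ring.
by apply: mulr_ge0; [apply: addr_ge0|]; rewrite !mulr_ge0.
Qed.

Definition bilinear_const (p p' r r' : R) : R :=
  one_sided_const p p' r r' * (1 + 2 `^ (p - 1)) +
  one_sided_const r r' p p' * (1 + 2 `^ (r - 1)).

Lemma one_sided_const_ge0 (p p' r r' : R) : 0 <= one_sided_const p p' r r'.
Proof. by rewrite mulr_ge0// mulr_ge0 ?powR_ge0. Qed.

(** The two stopping cubes of a cube are nested, so that the sum splits into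
two one-sided sums, exchanged by the symmetry of the hypotheses. *)
Lemma bilinear_bound (C E : banachLatticeType R) (s w : I -> R)
    (f : I -> C) (g : I -> E) (p p' r r' T T' MC ME : R)
    (beta : I -> C -> E -> R) :
  1 < p -> 1 < r -> p^-1 + p'^-1 = 1 -> r^-1 + r'^-1 = 1 -> 1 <= p^-1 + r^-1 ->
  0 <= T -> 0 <= T' -> 0 < MC -> 0 < ME ->
  strong_btree C p MC -> strong_btree E r ME ->
  (forall A, 0 <= s A) -> (forall A, 0 <= w A) ->
  (forall A, lle 0 (f A)) -> (forall A, lle 0 (g A)) ->
  (forall Q c e, lle 0 c -> lle 0 e -> 0 <= beta Q c e) ->
  (forall Q c c' e e', lle 0 c -> lle c c' -> lle 0 e -> lle e e' ->
     beta Q c e <= beta Q c' e') ->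
  (forall F (h : I -> C) (k : I -> E) L,
    0 <= L -> (forall A, lle 0 (h A)) -> (forall A, lle 0 (k A)) ->
    (forall A, `|h A| <= L) ->
    \sum_(Q in below le F) beta Q (sinteg s h (below le Q)) (sinteg w k (below le Q)) <=
    T * L * smass s (below le F) `^ p^-1 * (\sum_A w A * `|k A| `^ r) `^ r^-1) ->
  (forall F (h : I -> C) (k : I -> E) L,
    0 <= L -> (forall A, lle 0 (h A)) -> (forall A, lle 0 (k A)) ->
    (forall A, `|k A| <= L) ->
    \sum_(Q in below le F) beta Q (sinteg s h (below le Q)) (sinteg w k (below le Q)) <=
    T' * L * smass w (below le F) `^ r^-1 * (\sum_A s A * `|h A| `^ p) `^ p^-1) ->
  \sum_Q beta Q (sinteg s f (below le Q)) (sinteg w g (below le Q)) <=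
  bilinear_const p p' r r' * (MC * T + ME * T') *
  ((\sum_A s A * `|f A| `^ p) `^ p^-1 * (\sum_A w A * `|g A| `^ r) `^ r^-1).
Proof.
move=> p1 r1 pp' rr' pr T0 T'0 MC0 ME0 sC sE s0 w0 f0 g0 b0 bm test1 test2.
have c0 (e : R) : 0 < 1 + 2 `^ e by rewrite ltr_pwDl// powR_ge0.
have cf0 := mulr_gt0 (c0 (p - 1)) MC0; have cg0 := mulr_gt0 (c0 (r - 1)) ME0.
have wf := strong_weak_forest p1 MC0 sC s0 f0.
have wg := strong_weak_forest r1 ME0 sE w0 g0.
set cf := (1 + _) * MC in cf0 wf; set cg := (1 + _) * ME in cg0 wg.
have S1 := one_sided_bound le_forest s0 w0 f0 g0 cf0 cg0 wf wg p1 r1 pp' rr' pr T0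
  b0 bm test1.
have S2 := @one_sided_bound R I E C le w s g f cg cf r r' p p' T' (fun Q e c => beta Q c e)
  le_forest w0 s0 g0 f0 cg0 cf0 wg wf r1 p1 rr' pp' _ T'0
  (fun Q e c e0 c0 => b0 Q c e c0 e0)
  (fun Q e e' c c' e0 ee' c0 cc' => bm Q c c' e e' c0 cc' e0 ee')
  (fun F h k L L0 h0 k0 hL => test2 F k h L L0 k0 h0 hL).
rewrite addrC in S2; have {}S2 := S2 pr.
have [_ _ _ lecomp] := le_forest.
set X := \sum_(Q | le _ _) _ in S1; set Y := \sum_(Q | le _ _) _ in S2.
have XY : \sum_Q beta Q (sinteg s f (below le Q)) (sinteg w g (below le Q)) <= X + Y.
  have bb Q : 0 <= beta Q (sinteg s f (below le Q)) (sinteg w g (below le Q)).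
    by apply: b0; apply: lsum_ge0 => A _; exact: lleZ_ge0.
  rewrite (bigID (fun Q => le (stopping le w g cg Q) (stopping le s f cf Q)))/=.
  apply: lerD => //; apply: ler_sum_sub => // Q nQ.
  have := lecomp Q (stopping le w g cg Q) (stopping le s f cf Q).
  rewrite !le_anchor// => /(_ isT isT).
  by rewrite (negbTE nQ).
apply: (le_trans XY); apply: le_trans (lerD S1 S2) _.
apply: split_constants; rewrite ?powR_ge0 ?one_sided_const_ge0//; try exact: ltW.
Qed.

End bilinear_bound.

(** * Duality of weighted finite sums *)

Section weighted_hoelder.
Context {R : realType} {I : finType}.
Variables (w : I -> R) (q q' : R).
Hypothesis w_ge0 : forall A, 0 <= w A.
Hypothesis q_gt1 : 1 < q.
Hypothesis qq' : q^-1 + q'^-1 = 1.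

Let q_gt0 : 0 < q. Proof. exact: lt_trans q_gt1. Qed.

Let iq'E : q'^-1 = 1 - q^-1. Proof. by rewrite -qq' addrAC subrr add0r. Qed.

Let q'_gt0 : 0 < q'.
Proof. by rewrite -invr_gt0 iq'E subr_gt0 invf_lt1. Qed.

Let q'q1 : (q - 1) * q' = q.
Proof.
have e : q'^-1 = (q - 1) / q by rewrite iq'E; field; rewrite gt_eqF.
rewrite -[q']invrK e invf_div mulrCA divff ?mulr1//.
by rewrite gt_eqF// subr_gt0.
Qed.

Lemma weighted_hoelder (x y : I -> R) : (forall A, 0 <= x A) -> (forall A, 0 <= y A) ->
  \sum_A w A * (x A * y A) <=
  (\sum_A w A * x A `^ q) `^ q^-1 * (\sum_A w A * y A `^ q') `^ q'^-1.
Proof.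
move=> x0 y0.
have pw (z : I -> R) e A : 0 < e -> 0 <= z A -> (w A `^ e^-1 * z A) `^ e = w A * z A `^ e.
  move=> e0 z0; rewrite powRM ?powR_ge0//; congr (_ * _).
  by rewrite -powRrM mulVf ?gt_eqF// powRr1.
have := @hoelder_sum R I xpredT (fun A => w A `^ q^-1 * x A)
  (fun A => w A `^ q'^-1 * y A) q q' q_gt1 q'_gt0.
rewrite qq' lexx => /(_ isT) h; have {}h := h _ _.
apply: le_trans (_ : \sum_A (w A `^ q^-1 * x A) * (w A `^ q'^-1 * y A) <= _).
  apply: ler_sum => A _; rewrite mulrACA; apply: ler_wpM2r; first exact: mulr_ge0.
  have [->|w0] := eqVneq (w A) 0; first by rewrite mulr_ge0 ?powR_ge0.
  by rewrite -powRD ?qq' ?powRr1// oner_eq0.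
rewrite (eq_bigr (fun A => (w A `^ q^-1 * x A) * (w A `^ q'^-1 * y A)))//.
apply: le_trans (h _ _) _.
- by move=> A; rewrite mulr_ge0// powR_ge0.
- by move=> A; rewrite mulr_ge0// powR_ge0.
rewrite (eq_bigr (fun A => w A * x A `^ q)) => [|A _]; last exact: pw.
by rewrite [X in _ * X `^ _](eq_bigr (fun A => w A * y A `^ q')) => [|A _]; last exact: pw.
Qed.

(** Testing on [x ^ (q - 1)], the extremal function of Hoelder's inequality. *)
Lemma converse_hoelder (x : I -> R) (L : R) : (forall A, 0 <= x A) -> 0 <= L ->
  (forall y : I -> R, (forall A, 0 <= y A) ->
     \sum_A w A * (x A * y A) <= L * (\sum_A w A * y A `^ q') `^ q'^-1) ->
  (\sum_A w A * x A `^ q) `^ q^-1 <= L.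
Proof.
move=> x0 L0 h; set S := \sum_A w A * x A `^ q.
have S0 : 0 <= S by apply: sumr_ge0 => A _; rewrite mulr_ge0// powR_ge0.
have [->|Sn] := eqVneq S 0; first by rewrite powR0// invr_eq0 gt_eqF.
have Sp : 0 < S by rewrite lt_def Sn.
have := h (fun A => x A `^ (q - 1)) (fun A => powR_ge0 _ _).
rewrite (eq_bigr (fun A => w A * x A `^ q)) => [|A _]; last by rewrite mulr_powRB1.
rewrite [X in _ <= L * X `^ _](eq_bigr (fun A => w A * x A `^ q)) => [|A _]; last first.
  by rewrite -powRrM q'q1.
rewrite -/S -{1}(powRr1 S0) -qq' powRD; last by rewrite qq' oner_eq0.
by rewrite ler_pM2r// powR_gt0.
Qed.

End weighted_hoelder.

Local Close Scope set_scope.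
Local Open Scope classical_set_scope.
Local Open Scope ring_scope.

(** * Norming functionals *)

Section hahn_banach.
Context {R : realType} {E : normedModType R}.
Implicit Types (G : set (E * R)) (x y v : E).

Definition dominated_graph v G : Prop :=
  [/\ forall a x y r s, G (x, r) -> G (y, s) -> G (a *: x + y, a * r + s),
      forall x r, G (x, r) -> r <= `|x|
    & G (v, `|v|)].

Lemma dominated_graph0 v G : dominated_graph v G -> G (0, 0).
Proof.
move=> [lG _ Gv]; have := lG (-1) _ _ _ _ Gv Gv.
by rewrite scaleN1r addNr mulN1r addNr.
Qed.

Lemma dominated_graphZ v G a x r :
  dominated_graph v G -> G (x, r) -> G (a *: x, a * r).
Proof.
move=> dG Gx; have [lG _ _] := dG.
by have := lG a _ _ _ _ Gx (dominated_graph0 dG); rewrite !addr0.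
Qed.

Lemma dominated_graphD v G x r y s :
  dominated_graph v G -> G (x, r) -> G (y, s) -> G (x + y, r + s).
Proof.
by move=> [lG _ _] Gx Gy; have := lG 1 _ _ _ _ Gx Gy; rewrite scale1r mul1r.
Qed.

Lemma dominated_graph_fun v G x r s :
  dominated_graph v G -> G (x, r) -> G (x, s) -> r = s.
Proof.
move=> dG Gr Gs; have [_ lG _] := dG.
suff h a b : G (x, a) -> G (x, b) -> a <= b by apply/le_anti; rewrite !h.
move=> Ga Gb; have := dominated_graphD dG Ga (dominated_graphZ (-1) dG Gb).
by rewrite scaleN1r subrr => /lG; rewrite normr0 mulN1r subr_le0.
Qed.

Definition extend_graph G y c : set (E * R) :=
  [set z | exists x r t, G (x, r) /\ z = (x + t *: y, r + t * c)].

Lemma extend_dominated v G y : dominated_graph v G ->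
  exists c, dominated_graph v (extend_graph G y c).
Proof.
move=> dG; have [lG bG Gv] := dG.
pose S := [set r | exists x s, G (x, s) /\ r = s - `|x - y|].
have Sub x r : G (x, r) -> ubound S (`|x + y| - r).
  move=> Gx _ [x' [r' [Gx' ->]]]; rewrite lerBlDr addrAC lerBrDr.
  apply: le_trans (bG _ _ (dominated_graphD dG Gx' Gx)) _.
  rewrite -[X in `|X|](_ : (x + y) + (x' - y) = _); first exact: ler_normD.
  by rewrite addrACA subrr addr0 addrC.
have S0 : S !=set0 by exists (0 - `|0 - y|), 0, 0; split => //; exact: dominated_graph0 dG.
have hS : has_sup S by split => //; exists (`|v + y| - `|v|); exact: Sub.
exists (sup S).
have ub x r : G (x, r) -> r + sup S <= `|x + y|.
  by move=> Gx; rewrite -lerBrDl; apply: ge_sup => //; exact: Sub.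
have lb x r : G (x, r) -> r - sup S <= `|x - y|.
  move=> Gx; rewrite lerBlDr -lerBlDl; apply: sup_upper_bound => //.
  by exists x, r.
split.
- move=> a _ _ _ _ [x [r [t [Gx [-> ->]]]]] [x' [r' [t' [Gx' [-> ->]]]]].
  exists (a *: x + x'), (a * r + r'), (a * t + t'); split; first exact: lG.
  congr (_, _); last by ring.
  by rewrite scalerDr scalerDl scalerA addrACA.
- move=> _ _ [x [r [t [Gx [-> ->]]]]].
  have [t0|t0|->] := ltgtP t 0; last by rewrite mul0r scale0r !addr0; exact: bG.
    have t0' : 0 < - t by rewrite oppr_gt0.
    have -> : x + t *: y = (- t) *: ((- t)^-1 *: x - y).
      by rewrite scalerBr scalerA divff ?gt_eqF// scale1r scaleNr opprK.
    have -> : r + t * sup S = (- t) * ((- t)^-1 * r - sup S).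
      by rewrite mulrBr mulrA divff ?gt_eqF// mul1r mulNr opprK.
    rewrite normrZ gtr0_norm// ler_pM2l//.
    exact: lb (dominated_graphZ _ dG Gx).
  have -> : x + t *: y = t *: (t^-1 *: x + y).
    by rewrite scalerDr scalerA divff ?gt_eqF// scale1r.
  have -> : r + t * sup S = t * (t^-1 * r + sup S).
    by rewrite mulrDr mulrA divff ?gt_eqF// mul1r.
  rewrite normrZ gtr0_norm// ler_pM2l//.
  exact: ub (dominated_graphZ _ dG Gx).
- by exists v, `|v|, 0; split => //; rewrite scale0r mul0r !addr0.
Qed.

Lemma dominated_line v : dominated_graph v [set z | exists t, z = (t *: v, t * `|v|)].
Proof.
split.
- move=> a _ _ _ _ [t [-> ->]] [s [-> ->]]; exists (a * t + s).
  by rewrite scalerDl scalerA; congr (_, _); ring.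
- by move=> _ _ [t [-> ->]]; rewrite normrZ ler_wpM2r// ler_norm.
- by exists 1; rewrite scale1r mul1r.
Qed.

(** Hahn-Banach for the functional that sends [v] to its norm, by Zorn's lemma
on graphs of functionals dominated by the norm. *)
Lemma hahn_banach_norming v : exists phi : E -> R^o,
  [/\ linear phi, forall x, `|phi x| <= `|x| & phi v = `|v|].
Proof.
pose P G := G = set0 \/ dominated_graph v G.
have [F FP tF|G [PG maxG]] := @Zorn_bigcup _ P.
  have [[G0 [FG0 G00]]|F0] := pselect (exists G, F G /\ G <> set0); last first.
    left; apply/seteqP; split => // z [G FG Gz]; apply: F0; exists G; split => //.
    by move=> G0; rewrite G0 in Gz.
  right.
  have dF G : F G -> G <> set0 -> dominated_graph v G by move=> /FP[].
  have ne G z : G z -> G <> set0 by move=> Gz G0'; rewrite G0' in Gz.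
  have [_ _ G0v] := dF _ FG0 G00.
  split; last by exists G0.
  - move=> a x y r s [G FG Gx] [G' FG' Gy].
    have [|] := tF _ _ FG FG' => [GG'|G'G].
      exists G' => //; have [l _ _] := dF _ FG' (ne _ _ Gy).
      by apply: l => //; exact: GG'.
    exists G => //; have [l _ _] := dF _ FG (ne _ _ Gx).
    by apply: l => //; exact: G'G.
  - by move=> x r [G FG Gx]; have [_ b _] := dF _ FG (ne _ _ Gx); exact: b.
have dG : dominated_graph v G.
  case: PG => // G0; exfalso; apply: (maxG _ _ (or_intror (dominated_line v))).
  rewrite G0; split => // h.
  by apply: (h (0 *: v, 0 * `|v|)); exists 0.
have tot x : exists r, G (x, r).
  have [c dc] := extend_dominated x dG.
  apply: contrapT => nx; apply: (maxG (extend_graph G x c)); last by right.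
  split.
    by move=> [y r] Gy; exists y, r, 0; rewrite scale0r mul0r !addr0.
  move=> GG; apply: nx; exists c; apply: GG.
  exists 0, 0, 1; rewrite scale1r mul1r !add0r; split => //.
  exact: dominated_graph0 dG.
have [phi Gphi] := choice tot.
have [lG bG Gv] := dG.
exists phi; split.
- move=> a x y; apply: (dominated_graph_fun dG (Gphi _)).
  exact: lG.
- move=> x; rewrite ler_norml bG ?andbT; last exact: Gphi.
  rewrite lerNl -normrN; apply: bG.
  by have := dominated_graphZ (-1) dG (Gphi x); rewrite scaleN1r mulN1r.
- exact: (dominated_graph_fun dG (Gphi _)).
Qed.

End hahn_banach.

Section norming.
Context {R : realType} {E : banachLatticeType R}.

Lemma norming_functional (v : E) : exists phi : dual E, `|phi| <= 1 /\ phi v = `|v|.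
Proof.
have [phi [lphi bphi phiv]] := hahn_banach_norming v.
have bphi' : exists M, forall x, `|phi x| <= M * `|x|.
  by exists 1 => x; rewrite mul1r.
exists (bounded_dual lphi bphi'); split => //.
by rewrite dual_normE dual_norm_le// => x; rewrite mul1r bounded_dualE.
Qed.

Lemma ge0_norming_functional (v : E) : lle 0 v ->
  exists phi : dual E, [/\ lle 0 phi, `|phi| <= 1 & phi v = `|v|].
Proof.
move=> v0; have [phi [phi1 phiv]] := norming_functional v.
have labs1 : `|labs phi| <= 1 by rewrite norm_labs.
exists (labs phi); split => //; first exact: labs_ge0.
apply/le_anti/andP; split.
  apply: le_trans (ler_norm _) _; apply: le_trans (ler_dual _ _) _.
  by rewrite ler_piMl.
by rewrite -phiv; apply: (labs_ge phi).
Qed.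

Lemma ler_dual_ball (x : E) (M : R) :
  (forall phi : dual E, `|phi| <= 1 -> phi x <= M) -> `|x| <= M.
Proof. by move=> h; have [phi [phi1 <-]] := norming_functional x; exact: h. Qed.

Lemma dual_separates (x y : E) : (forall phi : dual E, phi x = phi y) -> x = y.
Proof.
move=> h; apply/eqP; rewrite -subr_eq0 -normr_le0; apply: ler_dual_ball => phi _.
by rewrite linearB/= h subrr.
Qed.

End norming.

(** * The Bochner integral *)

Section strong_measurability.
Context {d : measure_display} {T : measurableType d} {R : realType}
  {E : completeNormedModType R}.
Implicit Types (f s t : T -> E) (A : set T).

Lemma simple_cst (c : E) : simple_function (cst c : T -> E).
Proof.
split; first exact: finite_image_cst.
move=> e; rewrite preimage_cst; case: ifP => _; [exact: measurableT|exact: measurable0].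
Qed.

Lemma simple_preimage2 (U : Type) (h : E -> E -> U) s t (Y : set U) :
  simple_function s -> simple_function t ->
  measurable ((fun x => h (s x) (t x)) @^-1` Y).
Proof.
move=> [fs ms] [ft mt].
have -> : (fun x => h (s x) (t x)) @^-1` Y =
    \bigcup_(e in [set e | (range s `*` range t) e /\ Y (h e.1 e.2)])
      (s @^-1` [set e.1] `&` t @^-1` [set e.2]).
  apply/seteqP; split => [x Yx|x [[a b] /= [_ Yab] [-> ->]]//].
  by exists (s x, t x) => //=; split => //; split; exists x.
apply: fin_bigcup_measurable => [|e _]; last exact: measurableI.
by apply: sub_finite_set (finite_setX fs ft) => e [].
Qed.

Lemma simple_measurable2 (h : E -> E -> R) s t :
  simple_function s -> simple_function t ->
  measurable_fun setT (fun x => h (s x) (t x)).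
Proof. by move=> ss st _ Y _; rewrite setTI; exact: simple_preimage2. Qed.

Lemma simple_if A s : measurable A -> simple_function s ->
  simple_function (fun x => if x \in A then s x else 0).
Proof.
move=> mA [fs ms]; split.
  apply: sub_finite_set (_ : finite_set (range s `|` [set 0])).
    by move=> _ [x _ <-]; case: ifP => _; [left; exists x|right].
  by rewrite finite_setU; split => //; exact: finite_set1.
move=> e; have -> : (fun x => if x \in A then s x else 0) @^-1` [set e] =
    (A `&` s @^-1` [set e]) `|` (~` A `&` [set x | 0 = e]).
  apply/seteqP; split => x /=.
    by case: ifPn => [|/negP]; rewrite inE => *; [left|right].
  by case=> -[xA <-]; [rewrite mem_set|rewrite memNset].
apply: measurableU; apply: measurableI => //; first exact: measurableC.
have [->|e0] := eqVneq e 0; first by rewrite (_ : [set _ | _] = setT)//; apply/seteqP.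
rewrite (_ : [set _ | _] = set0)//; apply/seteqP; split => // x /= ze.
by rewrite -ze eqxx in e0.
Qed.

Lemma strongly_measurable_restrict A f : measurable A ->
  strongly_measurable f -> strongly_measurable (patch (fun=> 0) A f).
Proof.
move=> mA [s_ [ss sf]]; exists (fun n x => if x \in A then s_ n x else 0); split.
  by move=> n; exact: simple_if.
move=> x; rewrite /patch; case: ifP => _; first exact: sf.
exact: cvg_cst.
Qed.

Lemma strongly_measurable_sub (h : E -> R) f t : continuous h ->
  strongly_measurable f -> simple_function t ->
  measurable_fun setT (fun x => h (f x - t x)).
Proof.
move=> ch [s_ [ss sf]] st.
apply: (measurable_fun_cvg (h := fun n x => h (s_ n x - t x))).
  by move=> n; exact: (simple_measurable2 (fun a b => h (a - b))).
move=> x _; apply: continuous_cvg; first exact: ch.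
by apply: cvgB; [exact: sf|exact: cvg_cst].
Qed.

Lemma strongly_measurable_comp (h : E -> R) f : continuous h ->
  strongly_measurable f -> measurable_fun setT (fun x => h (f x)).
Proof.
move=> ch mf; have := strongly_measurable_sub ch mf (simple_cst 0).
by under eq_fun do rewrite subr0.
Qed.

Lemma strongly_measurable_norm f : strongly_measurable f ->
  measurable_fun setT (fun x => `|f x|).
Proof. by apply: strongly_measurable_comp; exact: norm_continuous. Qed.

Lemma simple_strongly_measurable s : simple_function s -> strongly_measurable s.
Proof. by move=> ss; exists (fun=> s); split => // x; exact: cvg_cst. Qed.

End strong_measurability.

Section bochner_theory.
Context {d : measure_display} {T : measurableType d} {R : realType}
  {E : banachLatticeType R}.
Variables (mu : {measure set T -> \bar R}) (A : set T).
Hypothesis mA : measurable A.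
Hypothesis muA : (mu A < +oo)%E.
Implicit Types (f s t : T -> E) (phi : dual E).

Lemma simple_integrable_comp (h : E -> R) s : simple_function s ->
  mu.-integrable A (fun x => (h (s x))%:E).
Proof.
move=> ss; apply: (measurable_bounded_integrable (f := h \o s)) => //.
  by apply: measurable_funTS; exact: (simple_measurable2 (fun a _ => h a) ss ss).
have [fs _] := ss.
have [M hM] : exists M, forall e, range s e -> `|h e| <= M.
  exists (\sum_(e <- fset_set (range s)) `|h e|) => e re.
  have re' : e \in fset_set (range s) by rewrite in_fset_set//; exact/mem_set.
  by rewrite (big_fsetD1 e)//= lerDl sumr_ge0.
exists M; split; first exact: num_real.
move=> N MN x Ax /=; apply: le_trans (ltW MN); apply: hM.
by exists x.
Qed.

Let integrable_indic_on (B : set T) : measurable B ->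
  mu.-integrable A (fun x => (\1_B x : R)%:E).
Proof.
move=> mB; apply: (measurable_bounded_integrable (f := \1_B)) => //.
exists 1; split; first exact: num_real.
move=> N N1 x _ /=; rewrite indicE; case: (_ \in _); rewrite ?normr1 ?normr0;
  apply: ltW => //; exact: lt_trans N1.
Qed.

Lemma dual_simple_integral phi s : simple_function s ->
  (phi (simple_integral mu A s) : R) = \int[mu]_(x in A) (phi (s x) : R).
Proof.
move=> ss; have [fs ms] := ss; rewrite /simple_integral fsbig_finite//=.
rewrite linear_sum/= /Rintegral.
suff -> : (\int[mu]_(x in A) (phi (s x) : R)%:E)%E =
    (\sum_(e <- fset_set (range s)) fine (mu (A `&` s @^-1` [set e])) * phi e)%:E.
  by apply: eq_bigr => e _; rewrite linearZ.
transitivity (\int[mu]_(x in A) (\sum_(e <- fset_set (range s))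
    ((phi e : R)%:E * (\1_(s @^-1` [set e]) x)%:E)))%E.
  apply: eq_integral => x _; under eq_bigr do rewrite -EFinM.
  rewrite sumEFin; congr EFin.
  have sx : s x \in fset_set (range s).
    by rewrite in_fset_set//; apply/mem_set; exists x.
  rewrite (big_fsetD1 (s x))//= indicE mem_set// mulr1 big_seq big1 ?addr0// => e.
  rewrite !inE => /andP[/eqP ne _]; rewrite indicE memNset ?mulr0//.
  by move=> /= h; apply: ne.
rewrite integral_sum//; last by move=> e; apply: integrableZl => //; exact: integrable_indic_on.
rewrite -sumEFin; apply: eq_bigr => e _.
rewrite integralZl//; last exact: integrable_indic_on.
rewrite integral_indic// classical_sets.setIC EFinM muleC fineK// ge0_fin_numE//.
by rewrite (le_lt_trans _ muA)// le_measure ?inE//; exact: measurableI.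
Qed.

Definition bochner_integrable f : Prop :=
  strongly_measurable (patch (fun=> 0) A f) /\
  (\int[mu]_(x in A) (`|f x|)%:E < +oo)%E.

Lemma simple_bochner_integrable s : simple_function s -> bochner_integrable s.
Proof.
move=> ss; split; first exact/strongly_measurable_restrict/simple_strongly_measurable.
have /integrableP[_] := simple_integrable_comp (fun c => `|c|) ss.
by under eq_integral do rewrite gee0_abs ?lee_fin//.
Qed.

Let measurable_on (h : E -> R) f t : continuous h ->
  strongly_measurable (patch (fun=> 0) A f) -> simple_function t ->
  measurable_fun A (fun x => h (f x - t x)).
Proof.
move=> ch mf st; have := strongly_measurable_sub ch mf st.
move=> /(measurable_funTS (D := A)) hm.
apply: eq_measurable_fun hm => x xA; by rewrite /patch xA.
Qed.

Let continuous_normE : continuous (fun x : E => `|x|). Proof. exact: norm_continuous. Qed.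

Lemma measurable_dual phi f : strongly_measurable (patch (fun=> 0) A f) ->
  measurable_fun A (fun x => phi (f x) : R).
Proof.
move=> mf; have := measurable_on (@dual_continuous _ _ phi) mf (simple_cst 0).
by under eq_fun do rewrite subr0.
Qed.

Lemma measurable_norm_on f : strongly_measurable (patch (fun=> 0) A f) ->
  measurable_fun A (fun x => `|f x|).
Proof.
move=> mf; have := measurable_on continuous_normE mf (simple_cst 0).
by under eq_fun do rewrite subr0.
Qed.

Lemma integrable_norm_on f : bochner_integrable f -> mu.-integrable A (fun x => (`|f x|)%:E).
Proof.
move=> [mf lf]; apply/integrableP; split.
  exact/measurable_EFinP/measurable_norm_on.
by under eq_integral do rewrite gee0_abs ?lee_fin//.
Qed.

Lemma integrable_dual phi f : bochner_integrable f ->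
  mu.-integrable A (fun x => (phi (f x) : R)%:E).
Proof.
move=> bf.
apply: (le_integrable mA _ _ (integrableZl mA `|phi| (integrable_norm_on bf))) => //.
  by apply/measurable_EFinP/measurable_dual; case: bf.
move=> x _; rewrite -EFinM !abse_EFin lee_fin [leRHS]ger0_norm ?mulr_ge0//.
exact: ler_dual.
Qed.

Let integrable_dual_simple phi s : simple_function s ->
  mu.-integrable A (fun x => (phi (s x) : R)%:E).
Proof. exact: (simple_integrable_comp phi). Qed.

(** With the Hahn-Banach theorem this reduces the vector-valued integral to
scalar ones. *)
Lemma dual_is_bochner_integral phi f v : bochner_integrable f ->
  is_bochner_integral mu A f v -> (phi v : R) = \int[mu]_(x in A) (phi (f x) : R).
Proof.
move=> bf [_ [s_ [ss cs cv]]]; have [mf _] := bf.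
have ssn n : simple_function (s_ n) by case: (ss n).
have c1 : (phi (simple_integral mu A (s_ n)) : R) @[n --> \oo] --> (phi v : R).
  by apply: continuous_cvg => //; exact: dual_continuous.
suff c2 : (phi (simple_integral mu A (s_ n)) : R) @[n --> \oo] -->
    (\int[mu]_(x in A) (phi (f x) : R)).
  by rewrite -(cvg_lim _ c1)// (cvg_lim _ c2).
apply/cvgrPdist_le => e e0.
have d0 : 0 < e / (`|phi| + 1) by rewrite divr_gt0// ltr_wpDl.
have /fine_cvgP[fin /cvgrPdist_le /(_ _ d0) cs'] := cs.
near=> n.
have finn : (\int[mu]_(x in A) (`|f x - s_ n x|)%:E)%E \is a fin_num by near: n.
have le_n : `|0 - fine (\int[mu]_(x in A) (`|f x - s_ n x|)%:E)%E| <= e / (`|phi| + 1).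
  by near: n.
have ineq : mu.-integrable A (fun x => (`|f x - s_ n x|)%:E).
  apply/integrableP; split.
    by apply/measurable_EFinP; exact: measurable_on.
  by under eq_integral do rewrite gee0_abs ?lee_fin//; rewrite -ge0_fin_numE ?integral_ge0.
rewrite dual_simple_integral// -RintegralB//; [|exact: integrable_dual|exact: integrable_dual_simple].
apply: le_trans (le_normr_Rintegral _ _) _ => //.
  under eq_fun do rewrite -linearB/=.
  apply: (le_integrable mA _ _ (integrableZl mA `|phi| ineq)).
    apply/measurable_EFinP; apply: measurable_on => //; exact: dual_continuous.
  move=> x _; rewrite -EFinM !abse_EFin lee_fin [leRHS]ger0_norm ?mulr_ge0//.
  exact: ler_dual.
apply: le_trans (_ : \int[mu]_(x in A) (`|phi| * `|f x - s_ n x|) <= _).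
  apply: le_Rintegral => //.
  - under eq_fun do rewrite -linearB/=.
    apply: (le_integrable mA _ _ (integrableZl mA `|phi| ineq)).
      apply/measurable_EFinP; apply: measurableT_comp => //.
      apply: measurable_on => //; exact: dual_continuous.
    move=> x _; rewrite -EFinM !abse_EFin lee_fin normr_id [leRHS]ger0_norm ?mulr_ge0//.
    exact: ler_dual.
  - exact: (integrableZl mA `|phi| ineq).
  - by move=> x _; rewrite -linearB/=; exact: ler_dual.
rewrite RintegralZl//.
move: le_n; rewrite sub0r normrN ger0_norm ?fine_ge0 ?integral_ge0// => le_n.
rewrite /Rintegral; apply: le_trans (ler_wpM2l (normr_ge0 _) le_n) _.
rewrite mulrCA ler_piMr ?(ltW e0)// ler_pdivrMr ?ltr_wpDl// mul1r lerDl//.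
Unshelve. all: by end_near. Qed.

Lemma norm_simple_integralB s t (M : R) : simple_function s -> simple_function t ->
  (forall phi : dual E, `|phi| <= 1 ->
     \int[mu]_(x in A) (phi (s x - t x) : R) <= M) ->
  `|simple_integral mu A s - simple_integral mu A t| <= M.
Proof.
move=> ss st h; apply: ler_dual_ball => phi phi1.
rewrite linearB/= !dual_simple_integral// -RintegralB//; try exact: integrable_dual_simple.
by have := h phi phi1; under eq_Rintegral do rewrite linearB/=.
Qed.

(** Truncating the approximating simple functions where they exceed twice the
norm of the limit makes dominated convergence available. *)
Lemma dominated_simple_approximation f : strongly_measurable f ->
  exists t_ : nat -> T -> E, [/\ forall n, simple_function (t_ n),
    forall n x, `|f x - t_ n x| <= 3 * `|f x| &
    forall x, t_ n x @[n --> \oo] --> f x].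
Proof.
move=> mf; have [s_ [ss sf]] := mf.
pose B n := [set x | `|s_ n x| <= 2 * `|f x|].
have mB n : measurable (B n).
  rewrite -[B n]setTI; apply: measurable_fun_le => //.
    exact: (simple_measurable2 (fun a _ => `|a|)).
  by apply: measurable_funM => //; exact: strongly_measurable_norm.
exists (fun n x => if x \in B n then s_ n x else 0); split.
- by move=> n; exact: simple_if.
- move=> n x; case: ifPn => [|_]; last by rewrite subr0 ler_peMl// ler1n.
  rewrite inE /B /= => sn; apply: le_trans (ler_normB _ _) _; lra.
- move=> x; have [fx0|fx0] := eqVneq (f x) 0.
    rewrite fx0; apply: cvg_near_cst; near=> n; case: ifPn => //.
    by rewrite inE /B /= fx0 normr0 mulr0 normr_le0 => /eqP.
  apply: cvg_trans (sf x); apply: near_eq_cvg; near=> n.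
  rewrite ifT//; apply/mem_set; rewrite /B /=; apply: ltW; near: n.
  have nx : `|f x| < 2 * `|f x| by rewrite ltr_pMl ?normr_gt0// ltr1n.
  by apply: (cvgr_lt `|f x|) => //; apply: cvg_norm; exact: sf.
Unshelve. all: by end_near. Qed.

Lemma is_bochner_integral_exists f : bochner_integrable f ->
  exists v, is_bochner_integral mu A f v.
Proof.
move=> bf; have [mf lf] := bf.
have [t_ [st dt ct]] := dominated_simple_approximation mf.
have fE x : A x -> patch (fun=> 0) A f x = f x by move=> Ax; rewrite /patch mem_set.
have m3 : mu.-integrable A (fun x => ((3 : R)%:E * (`|f x|)%:E)%E).
  by apply: integrableZl => //; exact: integrable_norm_on.
have mn n : measurable_fun A (fun x => (`|f x - t_ n x|)%:E).
  by apply/measurable_EFinP; exact: measurable_on.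
have dn n x : A x -> `|f x - t_ n x| <= 3 * `|f x|.
  by move=> Ax; have := dt n x; rewrite fE.
have cvg0 : (\int[mu]_(x in A) (`|f x - t_ n x|)%:E)%E @[n --> \oo] --> 0%E.
  rewrite -(integral0 mu A); apply: (dominated_cvg mA mn _ _ m3) => //.
  - move=> x Ax; apply: cvg_EFin; first by near=> n.
    rewrite -[X in _ --> X](normr0 E) -(subrr (f x)).
    by apply: cvg_norm; apply: cvgB; [exact: cvg_cst|have := ct x; rewrite fE].
  - move=> n x Ax; rewrite abse_EFin normr_id -EFinM lee_fin; exact: dn.
have inn n : mu.-integrable A (fun x => (`|f x - t_ n x|)%:E).
  apply: (le_integrable mA (mn n) _ m3) => x Ax.
  by rewrite -EFinM !abse_EFin lee_fin normr_id ger0_norm ?mulr_ge0//; exact: dn.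
pose a n := \int[mu]_(x in A) `|f x - t_ n x|.
have a0 : a n @[n --> \oo] --> 0 by exact: (fine_cvg cvg0).
have dist n m : `|simple_integral mu A (t_ n) - simple_integral mu A (t_ m)| <= a n + a m.
  apply: norm_simple_integralB => // phi phi1.
  rewrite /a -(RintegralD mA (inn n) (inn m)); apply: le_Rintegral => //.
  - under eq_fun do rewrite linearB/=.
    exact: (integrableB mA (integrable_dual_simple phi (st n)) (integrable_dual_simple phi (st m))).
  - exact: (integrableD mA (inn n) (inn m)).
  - move=> x Ax; apply: le_trans (ler_norm _) _; apply: le_trans (ler_dual _ _) _.
    apply: le_trans (_ : `|t_ n x - t_ m x| <= _); first by rewrite ler_piMl.
    rewrite (distrC (f x) (t_ n x)).
    have -> : t_ n x - t_ m x = (t_ n x - f x) + (f x - t_ m x).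
      by rewrite addrA subrK.
    exact: ler_normD.
have cI : cvgn (fun n => simple_integral mu A (t_ n)).
  apply: cauchy_cvg; apply: cauchy_exP => e e0.
  have e2 : 0 < e / 2 by rewrite divr_gt0.
  have /cvgrPdist_lt /(_ _ e2) [N _ aN] := a0.
  exists (simple_integral mu A (t_ N)); exists N => // n Nn.
  rewrite -ball_normE /=; apply: le_lt_trans (dist _ _) _.
  have := aN N (leqnn N); have := aN n Nn; rewrite !sub0r !normrN => h1 h2.
  by have := le_lt_trans (ler_norm _) h1; have := le_lt_trans (ler_norm _) h2; lra.
exists (limn (fun n => simple_integral mu A (t_ n))); split => //; exists t_; split => //.
move=> n; split => // e _; apply: le_lt_trans muA.
by rewrite le_measure ?inE//; apply: measurableI => //; case: (st n).
Unshelve. all: by end_near. Qed.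

Lemma bochner_integralP f : bochner_integrable f ->
  is_bochner_integral mu A f (bochner_integral mu A f).
Proof. by move=> /is_bochner_integral_exists[v hv]; exact: (xgetPex 0 (ex_intro _ v hv)). Qed.

Lemma dual_bochner_integral phi f : bochner_integrable f ->
  (phi (bochner_integral mu A f) : R) = \int[mu]_(x in A) (phi (f x) : R).
Proof. by move=> bf; apply: dual_is_bochner_integral => //; exact: bochner_integralP. Qed.

Lemma norm_bochner_integral f : bochner_integrable f ->
  `|bochner_integral mu A f| <= \int[mu]_(x in A) `|f x|.
Proof.
move=> bf; apply: ler_dual_ball => phi phi1; rewrite dual_bochner_integral//.
apply: le_Rintegral => //.
- exact: integrable_dual.
- exact: integrable_norm_on.
- move=> x Ax; apply: le_trans (ler_norm _) _; apply: le_trans (ler_dual _ _) _.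
  by rewrite ler_piMl.
Qed.

Lemma eq_bochner_integrable f h : {in A, f =1 h} ->
  bochner_integrable f -> bochner_integrable h.
Proof.
move=> fh [mf lf]; split.
  have <- // : patch (fun=> 0) A f = patch (fun=> 0) A h.
  by apply/funext => x; rewrite /patch; case: ifPn => // /fh ->.
by rewrite (eq_integral (fun x => (`|f x|)%:E))// => x /fh ->.
Qed.

Lemma eq_bochner_integral f h : {in A, f =1 h} -> bochner_integrable f ->
  bochner_integral mu A f = bochner_integral mu A h.
Proof.
move=> fh bf; apply: dual_separates => phi.
transitivity (\int[mu]_(x in A) (phi (f x) : R)); first exact: dual_bochner_integral.
transitivity (\int[mu]_(x in A) (phi (h x) : R)).
  by apply: eq_Rintegral => x /fh ->.
by apply/esym/dual_bochner_integral; exact: eq_bochner_integrable bf.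
Qed.

Lemma bochner_integral_cst (c : E) :
  bochner_integral mu A (cst c) = fine (mu A) *: c.
Proof.
apply: dual_separates => phi; rewrite dual_bochner_integral//; last first.
  exact/simple_bochner_integrable/simple_cst.
transitivity ((phi c : R) * fine (mu A)); first exact: (Rintegral_cst mu mA (phi c : R)).
by rewrite linearZ mulrC.
Qed.

End bochner_theory.

Section bochner_additivity.
Context {d : measure_display} {T : measurableType d} {R : realType}
  {E : banachLatticeType R}.
Variables (mu : {measure set T -> \bar R}).
Implicit Types (f : T -> E) (A B : set T).

Lemma sub_bochner_integrable A B f : measurable A -> measurable B -> B `<=` A ->
  bochner_integrable mu A f -> bochner_integrable mu B f.
Proof.
move=> mA mB BA [mf lf]; split.
  have -> : patch (fun=> 0) B f = patch (fun=> 0) B (patch (fun=> 0) A f).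
    apply/funext => x; rewrite /patch; case: ifPn => // xB.
    by rewrite mem_set//; exact/BA/set_mem.
  exact: strongly_measurable_restrict.
apply: le_lt_trans lf; apply: ge0_subset_integral => //.
have := strongly_measurable_norm mf => /(measurable_funTS (D := A)) h.
apply/measurable_EFinP; apply: eq_measurable_fun h => x xA.
by rewrite /patch xA.
Qed.

Lemma bochner_integral_bigsetU (I : choiceType) (F : I -> set T) (r : seq I) A f :
  (mu A < +oo)%E -> (forall i, measurable (F i)) -> uniq r ->
  trivIset [set` r] F -> A = \big[setU/set0]_(i <- r) F i ->
  bochner_integrable mu A f ->
  bochner_integral mu A f = \sum_(i <- r) bochner_integral mu (F i) f.
Proof.
move=> muA mF ur tF AE bf.
have mA : measurable A by rewrite AE; exact: bigsetU_measurable.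
have FA i : i \in r -> F i `<=` A by move=> ir; rewrite AE -bigcup_seq; exact: (bigcup_sup (i := i)).
have muF i : i \in r -> (mu (F i) < +oo)%E.
  by move=> ir; apply: le_lt_trans muA; rewrite le_measure ?inE//; exact: FA.
have bF i : i \in r -> bochner_integrable mu (F i) f.
  by move=> ir; apply: sub_bochner_integrable bf => //; exact: FA.
apply: dual_separates => phi; rewrite linear_sum/= dual_bochner_integral//.
rewrite big_seq (eq_bigr (fun i => \int[mu]_(x in F i) (phi (f x) : R))); last first.
  by move=> i ir; rewrite dual_bochner_integral//; [exact: muF|exact: bF].
rewrite -big_seq /Rintegral AE integral_bigsetU_EFin//; last first.
  by rewrite -AE; apply/measurable_EFinP; apply: measurable_dual => //; case: bf.
rewrite [X in fine X]big_seq (eq_bigr (fun i => (fine (\int[mu]_(x in F i) (phi (f x) : R)%:E)%E)%:E)).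
  by rewrite sumEFin [RHS]big_seq.
move=> i ir; rewrite fineK//; apply: integrable_fin_num => //.
by apply: integrable_dual => //; exact: bF.
Qed.

End bochner_additivity.

(** * Dyadic cubes *)

Section dyadic_cubes.
Context {R : realType} {d : nat}.
Implicit Types (P Q : dyadic_cube d) (x : Rd R d).

Definition side Q : R := 2 ^ (- Q.1).

Lemma side_gt0 Q : 0 < side Q. Proof. exact: exprz_gt0. Qed.

Lemma cubeP Q x : cube R Q x <-> forall i, side Q * (tnth Q.2 i)%:~R <= tnth x i :> R
  /\ (tnth x i : R) < side Q * ((tnth Q.2 i)%:~R + 1).
Proof. by []. Qed.

Definition cube_side Q (i : 'I_d) : set (measurableTypeR R) :=
  `[side Q * (tnth Q.2 i)%:~R, side Q * ((tnth Q.2 i)%:~R + 1)[%classic.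

Lemma cubeE Q : cube R Q = [set x | forall i, cube_side Q i (tnth x i)].
Proof.
apply/seteqP; split => x h i; have := h i; rewrite /cube_side /= in_itv /=.
  by move=> [-> ->].
by move=> /andP[].
Qed.

Lemma measurable_cube_side Q i : measurable (cube_side Q i).
Proof. exact: measurable_itv. Qed.

Lemma measurable_cube Q : measurable (cube R Q).
Proof. by rewrite cubeE; apply: measurable_Rd_prod => i; exact: measurable_cube_side. Qed.

Lemma lebesgue_cube Q : lebesgue_Rd d (cube R Q) = (side Q ^+ d)%:E.
Proof.
rewrite cubeE lebesgue_Rd_prod => [|i]; last exact: measurable_cube_side.
rewrite (eq_bigr (fun=> (side Q)%:E)) => [|i _].
  by rewrite prodEFin; congr EFin; rewrite prodr_const card_ord.
rewrite /cube_side lebesgue_measure_itv /= lte_fin ltr_pM2l ?side_gt0// ltrDl ltr01.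
by rewrite -EFinD; congr EFin; ring.
Qed.

Lemma lebesgue_cube_lty Q : (lebesgue_Rd d (cube R Q) < +oo)%E.
Proof. by rewrite lebesgue_cube ltry. Qed.

Lemma cube_corner Q : cube R Q [tuple side Q * (tnth Q.2 i)%:~R : measurableTypeR R | i < d].
Proof.
by move=> i; rewrite tnth_mktuple; split => //; rewrite ltr_pM2l ?side_gt0// ltrDl.
Qed.

Lemma side_coarse P Q : P.1 <= Q.1 -> side P = side Q * (2 ^ `|Q.1 - P.1|%N)%:R.
Proof.
move=> PQ; rewrite /side natrX exprnP gez0_abs ?subr_ge0// -expfzDr ?pnatr_eq0//.
by rewrite addrA [- Q.1 + _]addrC subrr add0r.
Qed.

(** Both cubes are located by integers on the grid of the finer one, where the
inequalities between their faces are strict or off by at least one. *)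
Lemma cube_sub P Q x : P.1 <= Q.1 -> cube R P x -> cube R Q x ->
  cube R Q `<=` cube R P.
Proof.
move=> PQ xP xQ y yQ i; have [xP1 xP2] := xP i; have [xQ1 xQ2] := xQ i.
have [yQ1 yQ2] := yQ i; rewrite -!/(side _) in xP1 xP2 xQ1 xQ2 yQ1 yQ2 *.
rewrite (side_coarse PQ) in xP1 xP2 *; set N := (2 ^ _)%N in xP1 xP2 *.
have s0 := side_gt0 Q.
have h1 : (N%:Z * tnth P.2 i <= tnth Q.2 i)%R.
  rewrite -ltzD1 -(ltr_int R) -(ltr_pM2l s0) intrD intrM.
  by apply: le_lt_trans xQ2; rewrite mulrA.
have h2 : (tnth Q.2 i + 1 <= N%:Z * (tnth P.2 i + 1))%R.
  rewrite addrC lez1D -(ltr_int R) -(ltr_pM2l s0) intrM intrD.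
  by apply: le_lt_trans xQ1 _; rewrite mulrA.
split.
  apply: le_trans yQ1; rewrite -mulrA ler_pM2l//.
  by move: h1; rewrite -(ler_int R) intrM.
apply: lt_le_trans yQ2 _; rewrite -mulrA ler_pM2l//.
by move: h2; rewrite -(ler_int R) intrM !intrD.
Qed.

Lemma cube_forest P Q x : cube R P x -> cube R Q x ->
  cube R P `<=` cube R Q \/ cube R Q `<=` cube R P.
Proof.
move=> xP xQ; have /orP[h|h] := le_total P.1 Q.1; [right|left].
  exact: cube_sub h xP xQ.
exact: cube_sub h xQ xP.
Qed.

Lemma cube_corner_le P Q : cube R Q `<=` cube R P ->
  forall i, side P * (tnth P.2 i)%:~R <= side Q * (tnth Q.2 i)%:~R.
Proof.
by move=> QP i; have [+ _] := QP _ (cube_corner Q) i; rewrite tnth_mktuple.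
Qed.

Lemma cube_inj P Q : (0 < d)%N -> cube R P = cube R Q -> P = Q.
Proof.
move=> d0 PQ.
have sE : side P = side Q.
  have := congr1 (lebesgue_Rd d) PQ; rewrite !lebesgue_cube => -[].
  by move=> /eqP; rewrite eqrXn2 ?ltW ?side_gt0// => /eqP.
have kE : P.1 = Q.1.
  have i2 : (2 : R) != 1 by rewrite gt_eqF// ltr1n.
  exact/oppr_inj/(ieexprIz (ltr0Sn R 1) i2).
have mE : P.2 = Q.2.
  apply: eq_from_tnth => i; apply/eqP; rewrite -(eqr_int R); apply/eqP/le_anti/andP.
  have s0 := side_gt0 Q.
  split; rewrite -(ler_pM2l s0) -{1}sE; last rewrite sE -[X in _ <= X * _]sE.
    by apply: cube_corner_le; rewrite PQ.
  by apply: cube_corner_le; rewrite PQ.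
by rewrite [P]surjective_pairing kE mE -surjective_pairing.
Qed.

Definition child_cube P (e : {ffun 'I_d -> bool}) : dyadic_cube d :=
  (P.1 + 1, [tuple 2 * tnth P.2 i + (e i : nat)%:Z | i < d]).

Lemma side_child P e : side (child_cube P e) = side P / 2.
Proof. by rewrite /side /= opprD expfzDr ?pnatr_eq0// exprN1. Qed.

Let child_low P e i : (tnth (child_cube P e).2 i)%:~R =
  2 * (tnth P.2 i)%:~R + (if e i then 1 else 0) :> R.
Proof. by rewrite tnth_mktuple intrD intrM; congr (_ + _); case: (e i). Qed.

Lemma child_cubeP P e x : cube R (child_cube P e) x <-> forall i,
  let m := side P * ((tnth P.2 i)%:~R + (if e i then 2^-1 else 0)) in
  m <= tnth x i :> R /\ (tnth x i : R) < m + side P / 2.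
Proof.
have s0 := side_gt0 P.
split=> [/cubeP h i|h]; [have := h i|apply/cubeP => i; have := h i];
  rewrite side_child child_low; case: (e i) => -[h1 h2]; split; nra.
Qed.

Lemma child_cube_sub P e : cube R (child_cube P e) `<=` cube R P.
Proof.
move=> x /child_cubeP xc i; have := xc i; rewrite -!/(side _).
have s0 := side_gt0 P.
by case: (e i) => /= -[h1 h2]; split; nra.
Qed.

Lemma child_cube_cover P x : cube R P x -> exists e, cube R (child_cube P e) x.
Proof.
move=> xP; exists [ffun i => side P * ((tnth P.2 i)%:~R + 2^-1) <= (tnth x i : R)].
apply/child_cubeP => i; have /cubeP/(_ i) := xP; rewrite ffunE.
have s0 := side_gt0 P.
by move=> [h1 h2]; case: ifPn; rewrite -?ltNge => h /=; split; nra.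
Qed.

Lemma child_cube_disj P e e' x :
  cube R (child_cube P e) x -> cube R (child_cube P e') x -> e = e'.
Proof.
move=> /child_cubeP xe /child_cubeP xe'; apply/ffunP => i; have := xe i; have := xe' i.
have s0 := side_gt0 P.
by case: (e i); case: (e' i) => //= -[h1 h2] [h3 h4]; exfalso; nra.
Qed.

(** Half of the children of a cube lie on each side of the middle of its first
coordinate; flipping that bit exchanges them. *)
Lemma sum_child (i0 : 'I_d) P (u v : R) :
  \sum_(e : {ffun 'I_d -> bool}) (if e i0 then v else u) * side (child_cube P e) ^+ d =
  side P ^+ d * ((u + v) / 2).
Proof.
pose flip (e : {ffun 'I_d -> bool}) := [ffun i => if i == i0 then ~~ e i else e i].
have flipK : involutive flip.
  by move=> e; apply/ffunP => i; rewrite !ffunE; case: eqP => // _; rewrite negbK.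
under eq_bigr do rewrite side_child.
rewrite -mulr_suml; set S := \sum_(e | _) _.
have S2 : S + S = (u + v) * 2 ^+ d.
  rewrite {2}/S (reindex_inj (inv_inj flipK))/= -big_split/=.
  rewrite (eq_bigr (fun=> u + v)) => [|e _]; last first.
    by rewrite ffunE eqxx; case: (e i0) => //=; rewrite addrC.
  by rewrite sumr_const card_ffun card_ord card_bool -[LHS]mulr_natr natrX.
have -> : S = (u + v) * 2 ^+ d / 2 by rewrite -S2; field.
by rewrite exprMn exprVn; field; rewrite expf_neq0.
Qed.

End dyadic_cubes.

(** The closed cube is compact, hence covered by finitely many of the boxes of
finite measure. *)
Lemma locally_finite_cube (R : realType) (d : nat)
    (mu : {measure set (Rd R d) -> \bar R}) (Q : dyadic_cube d) :
  locally_finite mu -> (mu (cube R Q) < +oo)%E.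
Proof.
move=> lf.
pose tup (v : 'rV[R]_d) : Rd R d := [tuple v ord0 i : measurableTypeR R | i < d].
have tot (v : 'rV[R]_d) : exists r : R, 0 < r /\
    (mu [set y : Rd R d | forall i, (`|tnth y i - tnth (tup v) i : R| < r)%R] < +oo)%E.
  by have [r r0 h] := lf (tup v); exists r.
have [rad radP] := choice tot.
have mbox (x : Rd R d) (r : R) :
    measurable [set y : Rd R d | forall i, (`|tnth y i - tnth x i : R| < r)%R].
  rewrite (_ : [set _ | _] = [set y : Rd R d | forall i,
     (`](tnth x i - r : R), (tnth x i + r : R)[%classic : set (measurableTypeR R)) (tnth y i)]).
    apply: (@measurable_Rd_prod R d (fun i => `](tnth x i - r : R), (tnth x i + r : R)[%classic)).
    by move=> i; exact: measurable_itv.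
  by apply/seteqP; split => y h i; have := h i; rewrite /= in_itv /= ltr_distl.
have cK := @rV_compact R d (fun i => `[(side Q * (tnth Q.2 i)%:~R : R),
    side Q * ((tnth Q.2 i)%:~R + 1)]%classic) (fun i => @segment_compact R _ _).
rewrite compact_cover in cK.
have cov v : [set v : 'rV[R]_d | forall i, `[(side Q * (tnth Q.2 i)%:~R : R),
    side Q * ((tnth Q.2 i)%:~R + 1)]%classic (v ord0 i)] v ->
    cover setT (fun v => (ball v (rad v))°) v.
  move=> _; exists v => //; apply: nbhsx_ballx.
  by case: (radP v).
have [D' _ cov'] := cK _ setT _ (fun v _ => @open_interior _ _) cov.
pose box v := [set y : Rd R d | forall i, (`|tnth y i - tnth (tup v) i : R| < rad v)%R].
apply: (@le_lt_trans _ _ (mu (\big[setU/set0]_(v <- D') box v))).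
  apply: le_measure; rewrite ?inE; first exact: measurable_cube.
    by apply: bigsetU_measurable => v _; exact: mbox.
  move=> x xQ; pose u : 'rV[R]_d := \row_i (tnth x i : R).
  have [|v vD' uv] := cov' u.
    move=> i; rewrite /u mxE /= in_itv /=; have [h1 h2] := xQ i.
    by apply/andP; split => //; exact: ltW.
  rewrite -bigcup_seq; exists v => // i.
  have : ball (v ord0 i : R) (rad v) (u ord0 i) by have [_] := interior_subset uv; apply.
  by rewrite -ball_normE /= mxE tnth_mktuple distrC.
elim: (D' : seq _) => [|v r IH]; first by rewrite big_nil measure0.
rewrite big_cons; have mU : measurable (\big[setU/set0]_(u <- r) box u).
  by apply: bigsetU_measurable => u _; exact: mbox.
have mB : measurable (box v) by exact: mbox.
apply: (@le_lt_trans _ _ (mu (box v) + mu (\big[setU/set0]_(u <- r) box u))%E).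
  exact: measureU2.
by apply: lte_add_pinfty => //; case: (radP v).
Qed.

(** * From the maximal operator to trees *)

Section Lp_norms.
Context {d : measure_display} {T : measurableType d} {R : realType}
  {E : completeNormedModType R}.
Variable mu : {measure set T -> \bar R}.
Implicit Types (f : T -> E) (p : R).

Lemma Lp_norm_pow p f : 0 < p ->
  (Lp_norm mu p f `^ p = \int[mu]_x ((`|f x|) `^ p)%:E)%E.
Proof.
move=> p0; have pn : p != 0 by rewrite gt_eqF.
rewrite /Lp_norm (poweR_Lnorm _ _ pn).
by apply: eq_integral => x _; rewrite /= normr_id.
Qed.

Lemma Lp_norm_ge0 p f : (0 <= Lp_norm mu p f)%E. Proof. exact: Lnorm_ge0. Qed.

Lemma Lp_normE p f (I : R) : 0 < p -> 0 <= I ->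
  (\int[mu]_x ((`|f x|) `^ p)%:E = I%:E)%E -> Lp_norm mu p f = (I `^ p^-1)%:E.
Proof.
move=> p0 I0 hI; rewrite -poweR_EFin -hI -Lp_norm_pow// -poweRrM divff ?gt_eqF// poweRe1//.
exact: Lp_norm_ge0.
Qed.

End Lp_norms.

(** The infimum of the admissible constants is itself admissible. *)
Lemma ereal_inf_bound (R : realType) (S : set R) (t y : R) (x : \bar R) :
  (ereal_inf [set K%:E | K in S] <= t%:E)%E -> 0 <= y ->
  (forall K, S K -> (x <= (K * y)%:E)%E) -> (x <= (t * y)%:E)%E.
Proof.
move=> it y0 h; apply/lee_addgt0Pr => e e0.
have y1 : 0 < y + 1 by rewrite ltr_wpDl.
have [|_ [K SK <-]] := @ereal_inf_lt R [set K%:E | K in S] (t + e / (y + 1))%:E.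
  by apply: le_lt_trans it _; rewrite lte_fin ltrDl divr_gt0.
rewrite lte_fin => Kt; apply: le_trans (h K SK) _; rewrite -EFinD lee_fin.
apply: le_trans (_ : (t + e / (y + 1)) * y <= _); first by rewrite ler_wpM2r// ltW.
rewrite mulrDl lerD2l mulrAC ler_pdivrMr// ler_wpM2l ?(ltW e0)// lerDl//.
Qed.

Section simple_functions.
Context {d : measure_display} {T : measurableType d} {R : realType}
  {E : completeNormedModType R}.
Implicit Types (s t : T -> E).

Lemma simple_map2 (h : E -> E -> E) s t : simple_function s -> simple_function t ->
  simple_function (fun x => h (s x) (t x)).
Proof.
move=> ss st; split=> [|e]; last exact: (simple_preimage2 _ [set e]).
have [[fs _] [ft _]] := (ss, st).
apply: sub_finite_set (_ : finite_set [set h z.1 z.2 | z in range s `*` range t]).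
  by move=> _ [x _ <-]; exists (s x, t x) => //; split; exists x.
by apply: finite_image; exact: finite_setX.
Qed.

Lemma simple_sum (I : Type) (r : seq I) (P : pred I) (F : I -> T -> E) :
  (forall i, simple_function (F i)) ->
  simple_function (fun x => \sum_(i <- r | P i) F i x).
Proof.
move=> sF; elim: r => [|i r IH].
  by under eq_fun do rewrite big_nil; exact: simple_cst.
under eq_fun do rewrite big_cons; case: (P i) => //.
exact: (simple_map2 (fun a b => a + b)).
Qed.

Lemma indic_scale (A : set T) (x : T) (c : E) :
  (\1_A x : R) *: c = if x \in A then c else 0.
Proof. by rewrite indicE; case: (x \in A); rewrite ?scale1r ?scale0r. Qed.

Lemma simple_indic (A : set T) (c : E) : measurable A ->
  simple_function (fun x => (\1_A x : R) *: c).
Proof.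
move=> mA; under eq_fun do rewrite indic_scale.
by apply: (simple_if mA); exact: simple_cst.
Qed.

End simple_functions.

Section realization.
Context {R : realType} {d : nat} {E : banachLatticeType R}.
Variable i0 : 'I_d.
Implicit Types (t : btree E) (P Q : dyadic_cube d) (x : Rd R d) (a c : E).

Local Notation leb := (lebesgue_Rd d).

(** Realization of a binary martingale on a cube: the two halves of a node are
the children of the cube on the two sides of one coordinate hyperplane. *)
Fixpoint treal t P x : E :=
  match t with
  | BLeaf c => (\1_(cube R P) x : R) *: c
  | BNode l r => \sum_(e : {ffun 'I_d -> bool})
      treal (if e i0 then r else l) (child_cube P e) x
  end.

(** The cubes whose averages enter the maximal function of the realization. *)
Fixpoint tcubes t P : seq (dyadic_cube d) :=
  match t with
  | BLeaf c => [:: P]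
  | BNode l r => P :: flatten [seq tcubes (if (e : {ffun 'I_d -> bool}) i0 then r else l)
                                     (child_cube P e) | e <- enum {ffun 'I_d -> bool}]
  end.

(** Integral and realization of a function [H] of the running supremum and the
terminal value; [tint] and [tmax] are special cases. *)
Fixpoint tgen (H : E -> E -> R) t a : R :=
  match t with
  | BLeaf c => H a c
  | BNode l r => (tgen H l (ljoin a (tavg (BNode l r))) +
                  tgen H r (ljoin a (tavg (BNode l r)))) / 2
  end.

Fixpoint tgreal (H : E -> E -> R) t P a x : R :=
  match t with
  | BLeaf c => \1_(cube R P) x * H a c
  | BNode l r => \sum_(e : {ffun 'I_d -> bool})
      tgreal H (if e i0 then r else l) (child_cube P e) (ljoin a (tavg (BNode l r))) x
  end.

Lemma tgen_tint h t a : tgen (fun _ c => h c) t a = tint h t.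
Proof. by elim: t a => //= l IHl r IHr a; rewrite IHl IHr. Qed.

Lemma tgen_tmax h t a : tgen (fun a c => h (ljoin a c)) t a = tmax h t a.
Proof. by elim: t a => //= l IHl r IHr a; rewrite IHl IHr. Qed.

Lemma treal_out t P x : ~ cube R P x -> treal t P x = 0.
Proof.
elim: t P => /= [c|l IHl r IHr] P xP; first by rewrite indic_scale memNset.
rewrite big1// => e _; have xc : ~ cube R (child_cube P e) x.
  by move=> /child_cube_sub.
by case: (e i0); [exact: IHr|exact: IHl].
Qed.

Lemma tgreal_out H t P a x : ~ cube R P x -> tgreal H t P a x = 0.
Proof.
elim: t P a => /= [c|l IHl r IHr] P a xP; first by rewrite indicE memNset ?mul0r.
rewrite big1// => e _; have xc : ~ cube R (child_cube P e) x.
  by move=> /child_cube_sub.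
by case: (e i0); [exact: IHr|exact: IHl].
Qed.

Let sum_child_at (V : zmodType) (F : {ffun 'I_d -> bool} -> V) P e x :
  cube R (child_cube P e) x ->
  (forall e', ~ cube R (child_cube P e') x -> F e' = 0) -> \sum_e' F e' = F e.
Proof.
move=> xe F0; rewrite (bigD1 e)//= big1 ?addr0// => e' e'e; apply: F0 => xe'.
by move/eqP : e'e; apply; exact: child_cube_disj xe' xe.
Qed.

Lemma treal_child l r P e x : cube R (child_cube P e) x ->
  treal (BNode l r) P x = treal (if e i0 then r else l) (child_cube P e) x.
Proof.
move=> xe; rewrite /= (sum_child_at (F := fun e' => treal (if e' i0 then r else l) (child_cube P e') x) xe)//.
by move=> e' /treal_out ->.
Qed.

Lemma tgreal_child H l r P a e x : cube R (child_cube P e) x ->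
  tgreal H (BNode l r) P a x = tgreal H (if e i0 then r else l) (child_cube P e)
    (ljoin a (tavg (BNode l r))) x.
Proof.
move=> xe; rewrite /= (sum_child_at (F := fun e' =>
  tgreal H (if e' i0 then r else l) (child_cube P e') (ljoin a (tavg (BNode l r))) x) xe)//.
by move=> e' /tgreal_out ->.
Qed.

Lemma treal_tgreal h t P a x : h 0 = 0 ->
  h (treal t P x) = tgreal (fun _ c => h c) t P a x.
Proof.
move=> h0; have [xP|xP] := pselect (cube R P x); last by rewrite treal_out// tgreal_out.
elim: t P a xP => [c|l IHl r IHr] P a xP.
  by rewrite /= indic_scale indicE mem_set// mul1r.
have [e xe] := child_cube_cover xP.
by rewrite (treal_child _ _ xe) (tgreal_child _ _ _ _ xe); case: (e i0);
  [exact: IHr|exact: IHl].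
Qed.

Lemma simple_treal t P : simple_function (treal t P).
Proof.
elim: t P => /= [c|l IHl r IHr] P; first by apply: simple_indic; exact: measurable_cube.
by apply: simple_sum => e; case: (e i0).
Qed.

Lemma measurable_tgreal H t P a : measurable_fun setT (tgreal H t P a).
Proof.
elim: t P a => /= [c|l IHl r IHr] P a.
  by apply: measurable_funM => //; apply: measurable_indic; exact: measurable_cube.
by apply: measurable_sum => e; case: (e i0).
Qed.

Lemma tgreal_ge0 H t P a x : (forall a c, 0 <= H a c) -> 0 <= tgreal H t P a x.
Proof.
move=> H0; elim: t P a => /= [c|l IHl r IHr] P a; first by apply: mulr_ge0; rewrite ?indicE.
by apply: sumr_ge0 => e _; case: (e i0).
Qed.

Lemma integral_tgreal H t P a : (forall a c, 0 <= H a c) ->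
  (\int[leb]_x (tgreal H t P a x)%:E = (side P ^+ d * tgen H t a)%:E)%E.
Proof.
move=> H0; elim: t P a => [c|l IHl r IHr] P a /=.
  under eq_integral do rewrite mulrC EFinM.
  rewrite ge0_integralZl//; last 2 first.
    by apply/measurable_EFinP; apply: measurable_indic; exact: measurable_cube.
    by rewrite lee_fin.
  rewrite integral_indic//; last exact: measurable_cube.
  rewrite mulrC EFinM; congr (_ * _)%E.
  by rewrite classical_sets.setIT; exact: lebesgue_cube.
under eq_integral do rewrite -sumEFin.
rewrite ge0_integral_sum//; last 2 first.
  by move=> e; apply/measurable_EFinP; exact: measurable_tgreal.
  by move=> e x _; rewrite lee_fin; exact: tgreal_ge0.
set b := ljoin a _.
rewrite (eq_bigr (fun e : {ffun 'I_d -> bool} =>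
  ((if e i0 then tgen H r b else tgen H l b) * side (child_cube P e) ^+ d)%:E)).
  by rewrite sumEFin sum_child.
by move=> e _; case: (e i0); rewrite ?IHl ?IHr mulrC.
Qed.

Lemma treal_integrable t P Q : bochner_integrable leb (cube R Q) (treal t P).
Proof.
apply: simple_bochner_integrable; [exact: measurable_cube|exact: lebesgue_cube_lty|].
exact: simple_treal.
Qed.

Lemma bochner_integral_treal t P (f : Rd R d -> E) :
  {in cube R P, f =1 treal t P} -> bochner_integrable leb (cube R P) f ->
  bochner_integral leb (cube R P) f = side P ^+ d *: tavg t.
Proof.
elim: t P => [c|l IHl r IHr] P fE bf.
  rewrite (eq_bochner_integral (h := cst c) (measurable_cube P) (lebesgue_cube_lty P))//.
    rewrite bochner_integral_cst; [|exact: measurable_cube|exact: lebesgue_cube_lty].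
    by congr (_ *: _); exact: (congr1 fine (lebesgue_cube P)).
  by move=> x xP; rewrite fE//= indic_scale xP.
have chE e x : x \in cube R (child_cube P e) ->
    f x = treal (if e i0 then r else l) (child_cube P e) x.
  move=> /set_mem xe; rewrite fE; last exact/mem_set/(child_cube_sub xe).
  exact: treal_child.
have bch e : bochner_integrable leb (cube R (child_cube P e)) f.
  apply: sub_bochner_integrable bf; [exact: measurable_cube|exact: measurable_cube|].
  exact: child_cube_sub.
rewrite (bochner_integral_bigsetU (r := enum {ffun 'I_d -> bool})
  (F := fun e => cube R (child_cube P e)) (lebesgue_cube_lty P))//; last 4 first.
- by move=> e; exact: measurable_cube.
- exact: enum_uniq.
- by apply/trivIsetP => e e' _ _ ee'; apply/seteqP; split => // x [xe xe'];
    move/eqP: ee'; apply; exact: child_cube_disj xe xe'.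
- rewrite -bigcup_seq; apply/seteqP; split => x.
    by move=> /child_cube_cover[e xe]; exists e => //=; rewrite mem_enum.
  by move=> [e _] /child_cube_sub.
rewrite big_enum/= (eq_bigr (fun e : {ffun 'I_d -> bool} =>
  side (child_cube P e) ^+ d *: tavg (if e i0 then r else l))) => [|e _]; last first.
  move: (chE e) (bch e); case: (e i0) => h b; [exact: IHr|exact: IHl].
apply: dual_separates => phi; rewrite linear_sum linearZ/= linearZ linearD/=.
transitivity (side P ^+ d * ((phi (tavg l) + phi (tavg r)) / 2)); last first.
  by congr (_ * _); exact: mulrC.
rewrite -(sum_child i0); apply: eq_bigr => e _.
by rewrite linearZ/= [LHS]/GRing.scale/= mulrC; case: (e i0).
Qed.

Lemma average_treal t P (f : Rd R d -> E) :
  {in cube R P, f =1 treal t P} -> bochner_integrable leb (cube R P) f ->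
  average P f = tavg t.
Proof.
move=> fE bf; rewrite /average (bochner_integral_treal fE bf) lebesgue_cube /=.
by rewrite scalerA mulVf ?scale1r// gt_eqF// exprn_gt0// side_gt0.
Qed.

Lemma tgreal_le_max (h : E -> R) t P (f : Rd R d -> E) (a y : E) x :
  (forall b c, lle 0 b -> lle b c -> h b <= h c) ->
  {in cube R P, f =1 treal t P} -> bochner_integrable leb (cube R P) f ->
  lle 0 a -> lle a y -> cube R P x ->
  (forall Q, Q \in tcubes t P -> cube R Q x -> lle (average Q f) y) ->
  tgreal (fun a c => h (ljoin a c)) t P a x <= h y.
Proof.
move=> mh; elim: t P a => [c|l IHl r IHr] P a fE bf a0 ay xP yQ.
  rewrite /= indicE mem_set// mul1r; apply: mh; first exact: ljoin_ge0.
  apply/ljoin_lle; split => //; rewrite -[c]/(tavg (BLeaf c)) -(average_treal fE bf).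
  by apply: yQ => //=; rewrite inE.
have [e xe] := child_cube_cover xP.
rewrite (tgreal_child _ _ _ _ xe).
have fch x' : x' \in cube R (child_cube P e) ->
    f x' = treal (if e i0 then r else l) (child_cube P e) x'.
  move=> /set_mem xe'; rewrite fE; last exact/mem_set/(child_cube_sub xe').
  exact: treal_child.
have bch : bochner_integrable leb (cube R (child_cube P e)) f.
  apply: sub_bochner_integrable bf; [exact: measurable_cube|exact: measurable_cube|].
  exact: child_cube_sub.
have ay' : lle (ljoin a (tavg (BNode l r))) y.
  apply/ljoin_lle; split => //; rewrite -(average_treal fE bf); apply: yQ => //=.
  by rewrite inE eqxx.
have yQ' Q : Q \in tcubes (if e i0 then r else l) (child_cube P e) ->
    cube R Q x -> lle (average Q f) y.
  move=> Qt; apply: yQ; rewrite /= inE; apply/orP; right; apply/flattenP.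
  exists (tcubes (if e i0 then r else l) (child_cube P e)) => //.
  by apply/mapP; exists e => //; rewrite mem_enum.
move: fch yQ'; case: (e i0) => fch yQ'; [apply: IHr|apply: IHl] => //; exact: ljoin_ge0.
Qed.

End realization.

Section maximal_operator.
Context {R : realType} {d : nat}.

Lemma lsup_ub (E : banachLatticeType R) (s : seq E) (x : E) :
  x \in s -> lle x (lsup s).
Proof.
case: s => // y s /=; elim: s => [|z s IH] /=; first by rewrite inE => /eqP ->; exact: llexx.
rewrite !inE => /or3P[/eqP xy|/eqP ->|xs].
- by apply: lle_trans (lle_joinr _ _); apply: IH; rewrite xy inE eqxx.
- exact: lle_joinl.
- by apply: lle_trans (lle_joinr _ _); apply: IH; rewrite inE xs orbT.
Qed.

Lemma simple_maximal (E : banachLatticeType R) (DD : {fset dyadic_cube d})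
  (f : Rd R d -> E) : simple_function (dyadic_maximal DD f).
Proof.
rewrite /dyadic_maximal; case: (DD : seq _) => [|Q s] /=; first exact: (simple_cst 0).
elim: s => [|P s IH] /=; first by apply: simple_indic; exact: measurable_cube.
apply: (simple_map2 (fun a b => ljoin a b)) IH.
by apply: simple_indic; exact: measurable_cube.
Qed.

(** The averages of the realization over its cubes are the averages of the
martingale at its nodes, so the dyadic maximal function of the realization
dominates the realized maximal function. *)
Lemma strong_btree_maximal (E : banachLatticeType R) (p M : R) :
  (0 < d)%N -> 0 < p -> 0 <= M -> (maximal_norm d E p <= M%:E)%E ->
  strong_btree E p M.
Proof.
move=> d0 p0 M0 maxM t tp; pose i0 := Ordinal d0.
pose P : dyadic_cube d := (0, [tuple 0 | i < d]).
pose leb := @lebesgue_Rd R d.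
pose f := treal i0 t P; pose h (x : E) : R := `|x| `^ p.
have h0 : h 0 = 0 by rewrite /h normr0 powR0// gt_eqF.
have hge0 x : 0 <= h x by exact: powR_ge0.
have s1 : side P = 1 :> R by rewrite /side /= oppr0 expr0z.
have bf : bochner_integrable leb (cube R P) f by exact: treal_integrable.
pose DD : {fset dyadic_cube d} := seq_fset tt (tcubes i0 t P).
have If : (\int[leb]_x ((`|f x|) `^ p)%:E = (tint h t)%:E)%E.
  under eq_integral do rewrite -/(h _) (treal_tgreal _ _ _ 0 _ h0).
  by rewrite integral_tgreal// s1 expr1n mul1r tgen_tint.
have tint0 : 0 <= tint h t by exact: tint_ge0.
have Nf := Lp_normE p0 tint0 If.
have fLp : Lp leb p f.
  split; first exact/simple_strongly_measurable/simple_treal.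
  by rewrite Nf ltry.
have bound : (Lp_norm leb p (dyadic_maximal DD f) <= (M * tint h t `^ p^-1)%:E)%E.
  apply: (@ereal_inf_bound _ [set K | 0 <= K /\ forall f, Lp leb p f ->
     (Lp_norm leb p (dyadic_maximal DD f) <= K%:E * Lp_norm leb p f)%E]).
  - by apply: le_trans maxM; apply: ereal_sup_ubound; exists DD.
  - exact: powR_ge0.
  - by move=> K [K0 /(_ f fLp)]; rewrite Nf.
have : (\int[leb]_x ((`|dyadic_maximal DD f x|) `^ p)%:E <=
    (M `^ p * tint h t)%:E)%E.
  rewrite -Lp_norm_pow//.
  have -> : (M `^ p * tint h t)%:E = ((M * tint h t `^ p^-1)%:E `^ p)%E.
    rewrite poweR_EFin; congr EFin.
    by rewrite powRM ?powR_ge0// -powRrM mulVf ?gt_eqF// powRr1.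
  apply: gt0_ler_poweR => //; first exact: ltW.
    by rewrite in_itv /= Lp_norm_ge0 leey.
  by rewrite in_itv /= lee_fin mulr_ge0 ?powR_ge0// leey.
rewrite -lee_fin; apply: le_trans.
have -> : (tmax (fun x => `|x| `^ p) t 0)%:E =
    (\int[leb]_x (tgreal i0 (fun a c => h (ljoin a c)) t P 0 x)%:E)%E.
  by rewrite integral_tgreal// s1 expr1n mul1r tgen_tmax.
apply: ge0_le_integral => //.
- by move=> x _; rewrite lee_fin; exact: tgreal_ge0.
- by apply/measurable_EFinP; exact: measurable_tgreal.
- apply/measurable_EFinP; have sM := simple_maximal DD f.
  exact: (simple_measurable2 (fun a _ => `|a| `^ p) sM sM).
move=> x _; rewrite lee_fin; have [xP|xP] := pselect (cube R P x); last first.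
  by rewrite tgreal_out// powR_ge0.
have memM Q : Q \in tcubes i0 t P -> cube R Q x ->
    lle (average Q f) (dyadic_maximal DD f x).
  move=> Qt xQ; rewrite /dyadic_maximal; apply: lsup_ub; apply/mapP; exists Q.
    by rewrite seq_fsetE.
  by rewrite indic_scale mem_set.
apply: (tgreal_le_max (f := f)) => //.
- move=> b c b0 bc; apply: ge0_ler_powR; rewrite ?nnegrE ?(ltW p0)//.
  exact: norm_lle0.
- exact: llexx.
- have Pt : P \in tcubes i0 t P by case: (t) => //= *; rewrite inE eqxx.
  apply: lle_trans (memM P Pt xP).
  by rewrite (average_treal (t := t) (i0 := i0))//; exact: tavg_ge0.
Qed.

End maximal_operator.

(** * Atoms of a finite collection of cubes *)

Lemma norm_le_sum (R : numDomainType) (V : normedZmodType R) (I : finType)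
  (v : I -> V) A : `|v A| <= \sum_B `|v B|.
Proof. by rewrite (bigD1 A)//= lerDl sumr_ge0. Qed.

Section atoms.
Context {R : realType} {d : nat}.
Variable DD : {fset dyadic_cube d}.
Hypothesis d_gt0 : (0 < d)%N.
Implicit Types (A B P Q : DD) (x : Rd R d).

Definition cube_le A B : bool := `[< cube R (val A) `<=` cube R (val B) >].

Lemma cube_le_forest : is_forest cube_le.
Proof.
split.
- by move=> A; apply/asboolP.
- move=> A B /andP[/asboolP AB /asboolP BA]; apply/val_inj.
  by apply: (@cube_inj R d _ _ d_gt0); apply/seteqP.
- by move=> B A C /asboolP AB /asboolP BC; apply/asboolP; exact: subset_trans BC.
- move=> A P Q /asboolP AP /asboolP AQ.
  have c := cube_corner (R := R) (val A).
  by have [h|h] := cube_forest (AP _ c) (AQ _ c); apply/orP; [left|right]; exact/asboolP.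
Qed.

(** Integrals over the cubes of the collection are sums of integrals over these
parts. *)
Definition atom A : set (Rd R d) :=
  cube R (val A) `\` \bigcup_(B in [set B | cube_le B A && (B != A)]) cube R (val B).

Lemma measurable_atom A : measurable (atom A).
Proof.
apply: measurableD; first exact: measurable_cube.
by apply: fin_bigcup_measurable => [|B _]; [exact: finite_finset|exact: measurable_cube].
Qed.

Lemma atom_cube A : atom A `<=` cube R (val A). Proof. by move=> x []. Qed.

Lemma atom_minimal A B x : atom A x -> cube R (val B) x -> cube_le A B.
Proof.
move=> [xA nA] xB; have [/asboolP//|BA] := cube_forest xA xB.
have [->|AB] := eqVneq A B; first by apply/asboolP.
exfalso; apply: nA; exists B => //=; rewrite eq_sym AB andbT.
exact/asboolP.
Qed.

Lemma atom_sub A Q : cube_le A Q -> atom A `<=` cube R (val Q).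
Proof. by move=> /asboolP AQ x /atom_cube/AQ. Qed.

Lemma atom_inj A B x : atom A x -> atom B x -> A = B.
Proof.
have [_ anti _ _] := cube_le_forest.
move=> xA xB; apply: anti; rewrite (atom_minimal xA (atom_cube xB)).
by rewrite (atom_minimal xB (atom_cube xA)).
Qed.

Lemma trivIset_atom (D : set DD) : trivIset D atom.
Proof.
apply/trivIsetP => A B _ _ AB; apply/seteqP; split => // x [xA xB].
by move/eqP : AB; apply; exact: atom_inj xA xB.
Qed.

Lemma atom_cover Q x : cube R (val Q) x -> exists2 A, cube_le A Q & atom A x.
Proof.
have [lexx anti letr _] := cube_le_forest.
move=> xQ; have SQ : (x \in cube R (val Q)) && cube_le Q Q by rewrite mem_set// lexx.
have [A /andP[/set_mem xA AQ] mA] :=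
  @arg_minnP _ Q (fun A => (x \in cube R (val A)) && cube_le A Q) (fun A => #|below cube_le A|) SQ.
exists A => //; split => // -[B /= /andP[BA nBA] xB].
have : (#|below cube_le A| <= #|below cube_le B|)%N.
  by apply: mA; rewrite mem_set// (letr _ _ _ BA AQ).
rewrite leqNgt => /negP; apply; apply: proper_card; rewrite properE.
apply/andP; split; apply/fintype.subsetP.
  by move=> C; rewrite !in_below => CB; exact: letr CB BA.
move=> /(_ A); rewrite !in_below lexx => /(_ isT) AB.
by move: nBA; rewrite (anti B A) ?BA ?AB// eqxx.
Qed.

Lemma cube_atoms Q : cube R (val Q) = \big[setU/set0]_(A <- enum (below cube_le Q)) atom A.
Proof.
rewrite -bigcup_seq; apply/seteqP; split => x.
  by move=> /atom_cover[A AQ xA]; exists A => //=; rewrite mem_enum in_below.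
by move=> [A /=]; rewrite mem_enum in_below => /atom_sub; apply.
Qed.

Section atomic_mass.
Variable mu : {measure set (Rd R d) -> \bar R}.
Hypothesis mu_cube : forall Q : dyadic_cube d, (mu (cube R Q) < +oo)%E.

Definition atom_mass A : R := fine (mu (atom A)).

Lemma mu_atom_lty A : (mu (atom A) < +oo)%E.
Proof.
apply: le_lt_trans (mu_cube (val A)); rewrite le_measure ?inE//.
- exact: measurable_atom.
- exact: measurable_cube.
- exact: atom_cube.
Qed.

Lemma mu_atom A : mu (atom A) = (atom_mass A)%:E.
Proof. by rewrite /atom_mass fineK// ge0_fin_numE// mu_atom_lty. Qed.

Lemma atom_mass_ge0 A : 0 <= atom_mass A. Proof. exact: fine_ge0. Qed.

Lemma smass_atom_mass Q : mu (cube R (val Q)) = (smass atom_mass (below cube_le Q))%:E.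
Proof.
rewrite cube_atoms -bigcup_seq measure_fin_bigcup//; last 2 first.
- exact: trivIset_atom.
- by move=> A _; exact: measurable_atom.
rewrite -fsbig_seq; last exact: enum_uniq.
by rewrite big_enum/= /smass -sumEFin; apply: eq_bigr => A _; exact: mu_atom.
Qed.

Lemma integral_piecewise (F : Rd R d -> R) (c : DD -> R) :
  (forall A x, atom A x -> F x = c A) ->
  (forall x, (forall A, ~ atom A x) -> F x = 0) -> (forall A, 0 <= c A) ->
  (\int[mu]_x (F x)%:E = (\sum_A atom_mass A * c A)%:E)%E.
Proof.
move=> Fc F0 c0.
have FE x : (F x)%:E = (\sum_A (c A)%:E * (\1_(atom A) x)%:E)%E.
  have [[A xA]|nA] := pselect (exists A, atom A x); last first.
    rewrite F0 => [|A xA]; last by apply: nA; exists A.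
    by rewrite big1// => A _; rewrite indicE memNset ?mule0// => xA; apply: nA; exists A.
  rewrite (Fc _ _ xA) (bigD1 A)//= indicE mem_set// mule1 big1 ?adde0// => B BA.
  rewrite indicE memNset ?mule0// => xB.
  by move/eqP: BA; apply; exact: atom_inj xB xA.
under eq_integral do rewrite FE.
have mI A : measurable_fun setT (fun x => (\1_(atom A) x : R)%:E).
  by apply/measurable_EFinP; apply: measurable_indic; exact: measurable_atom.
rewrite ge0_integral_sum//; last 2 first.
- by move=> A; apply: measurable_funeM.
- by move=> A x _; apply: mule_ge0; rewrite lee_fin.
rewrite -sumEFin; apply: eq_bigr => A _.
rewrite ge0_integralZl//; last by rewrite lee_fin.
by rewrite integral_indic ?classical_sets.setIT ?mu_atom 1?muleC//; exact: measurable_atom.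
Qed.

Section atomic_functions.
Context {E : banachLatticeType R}.
Implicit Types (f : Rd R d -> E) (c : DD -> E).

Definition atom_mean f A : E := (atom_mass A)^-1 *: bochner_integral mu (atom A) f.

Definition step c x : E := \sum_A (\1_(atom A) x : R) *: c A.

Lemma stepE c A x : atom A x -> step c x = c A.
Proof.
move=> xA; rewrite /step (bigD1 A)//= indic_scale mem_set// big1 ?addr0// => B BA.
rewrite indic_scale memNset// => xB.
by move/eqP: BA; apply; exact: atom_inj xB xA.
Qed.

Lemma step_out c x : (forall A, ~ atom A x) -> step c x = 0.
Proof. by move=> nA; rewrite /step big1// => A _; rewrite indic_scale memNset. Qed.

Lemma simple_step c : simple_function (step c).
Proof. by apply: simple_sum => A; apply: simple_indic; exact: measurable_atom. Qed.

Lemma integral_step_powR c p : p != 0 ->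
  (\int[mu]_x ((`|step c x|) `^ p)%:E = (\sum_A atom_mass A * `|c A| `^ p)%:E)%E.
Proof.
move=> p0; apply: integral_piecewise => [A x /stepE ->//|x /step_out ->|A].
  by rewrite normr0 powR0.
exact: powR_ge0.
Qed.

Lemma Lp_norm_step c p : 0 < p ->
  Lp_norm mu p (step c) = ((\sum_A atom_mass A * `|c A| `^ p) `^ p^-1)%:E.
Proof.
move=> p0; apply: Lp_normE => //; last by rewrite integral_step_powR// gt_eqF.
by apply: sumr_ge0 => A _; rewrite mulr_ge0 ?atom_mass_ge0 ?powR_ge0.
Qed.

Lemma Lp_step c p : 0 < p -> Lp mu p (step c).
Proof.
move=> p0; split; first exact/simple_strongly_measurable/simple_step.
by rewrite Lp_norm_step// ltry.
Qed.

Lemma atom_mass_atom_mean f A : bochner_integrable mu (atom A) f ->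
  atom_mass A *: atom_mean f A = bochner_integral mu (atom A) f.
Proof.
move=> bf; have [A0|A0] := eqVneq (atom_mass A) 0; last first.
  by rewrite scalerA divff// scale1r.
rewrite A0 scale0r; apply/esym/eqP; rewrite -normr_le0.
apply: le_trans (norm_bochner_integral (measurable_atom A) (mu_atom_lty A) bf) _.
rewrite /Rintegral null_set_integral//; first exact: measurable_atom.
  by apply/measurable_EFinP/measurable_norm_on; case: bf.
by rewrite mu_atom A0.
Qed.

Lemma cube_atom_integrable f Q A : cube_le A Q ->
  bochner_integrable mu (cube R (val Q)) f -> bochner_integrable mu (atom A) f.
Proof.
move=> AQ; apply: sub_bochner_integrable; [exact: measurable_cube|exact: measurable_atom|].
exact: atom_sub.
Qed.

Lemma bochner_integral_cube f Q : bochner_integrable mu (cube R (val Q)) f ->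
  bochner_integral mu (cube R (val Q)) f = sinteg atom_mass (atom_mean f) (below cube_le Q).
Proof.
move=> bf; rewrite (bochner_integral_bigsetU (r := enum (below cube_le Q)) (F := atom) (mu_cube _))//; last 4 first.
- by move=> A; exact: measurable_atom.
- exact: enum_uniq.
- exact: trivIset_atom.
- exact: cube_atoms.
rewrite big_enum/= /sinteg; apply: eq_bigr => A; rewrite in_below => AQ.
by rewrite atom_mass_atom_mean//; exact: cube_atom_integrable bf.
Qed.

Lemma step_integrable c (Q : dyadic_cube d) : bochner_integrable mu (cube R Q) (step c).
Proof.
apply: simple_bochner_integrable; [exact: measurable_cube|exact: mu_cube|].
exact: simple_step.
Qed.

Lemma bochner_integral_step c Q :
  bochner_integral mu (cube R (val Q)) (step c) = sinteg atom_mass c (below cube_le Q).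
Proof.
have mA := measurable_atom; have lA := mu_atom_lty.
rewrite bochner_integral_cube; last exact: step_integrable.
rewrite /sinteg; apply: eq_bigr => A _.
have bA : bochner_integrable mu (atom A) (step c).
  by apply: (@cube_atom_integrable _ A); [apply/asboolP|exact: step_integrable].
rewrite atom_mass_atom_mean// (eq_bochner_integral (h := cst (c A)) (mA A) (lA A) _ bA).
  by rewrite bochner_integral_cst.
by move=> x /set_mem xA; rewrite (stepE _ xA).
Qed.

End atomic_functions.
End atomic_mass.
End atoms.

(** * Averages of functions in L^p and L^oo *)

Section jensen.
Context {d : measure_display} {T : measurableType d} {R : realType}
  {E : banachLatticeType R}.
Variable mu : {measure set T -> \bar R}.
Variables (p p' : R).
Hypothesis p_gt1 : 1 < p.
Hypothesis pp' : p^-1 + p'^-1 = 1.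
Implicit Types (f : T -> E) (A : set T).

Let p_gt0 : 0 < p. Proof. exact: lt_trans p_gt1. Qed.

Lemma integral_Lp_lty f : Lp mu p f -> (\int[mu]_x ((`|f x|) `^ p)%:E < +oo)%E.
Proof. by move=> [_ fp]; rewrite -Lp_norm_pow// poweR_lty. Qed.

Lemma measurable_norm_powR f : strongly_measurable f ->
  measurable_fun setT (fun x => (`|f x|) `^ p).
Proof.
move=> mf; apply: (measurableT_comp (measurable_powR p)).
exact: strongly_measurable_norm.
Qed.

Lemma Lp_bochner_integrable f A : measurable A -> (mu A < +oo)%E ->
  Lp mu p f -> bochner_integrable mu A f.
Proof.
move=> mA muA fp; have [mf _] := fp; split; first exact: strongly_measurable_restrict.
have mn := measurable_funS measurableT (@subsetT _ A) (strongly_measurable_norm mf).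
have mnp := measurable_funS measurableT (@subsetT _ A) (measurable_norm_powR mf).
apply: (@le_lt_trans _ _ (\int[mu]_(x in A) (1 + (`|f x|) `^ p)%:E)%E).
  apply: ge0_le_integral => //.
  - exact/measurable_EFinP.
  - apply/measurable_EFinP; exact: measurable_funD.
  - move=> x _; rewrite lee_fin; have [u1|u1] := leP `|f x| 1.
      by apply: le_trans u1 _; rewrite lerDl powR_ge0.
    apply: (@le_trans _ _ (`|f x| `^ p)); last by rewrite lerDr.
    rewrite -[X in X <= _](powRr1 (normr_ge0 (f x))).
    by apply: ler_powR; exact: ltW.
under eq_integral do rewrite EFinD.
rewrite ge0_integralD; [|exact: mA|by []|exact: measurable_cst|by move=> z _; rewrite lee_fin powR_ge0|exact/measurable_EFinP].
rewrite (integral_cst mu mA 1%E) mul1e lte_add_pinfty//.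
apply: le_lt_trans (integral_Lp_lty fp); apply: ge0_subset_integral => //.
by apply/measurable_EFinP; exact: measurable_norm_powR.
Qed.

(** Young's inequality is the tangent line of the power function at the mean,
so integrating it over the set gives the bound. *)
Lemma jensen_bochner f A : measurable A -> (mu A < +oo)%E -> Lp mu p f ->
  ((fine (mu A) * `|(fine (mu A))^-1 *: bochner_integral mu A f| `^ p)%:E <=
   \int[mu]_(x in A) ((`|f x|) `^ p)%:E)%E.
Proof.
move=> mA muA fp; have [mf _] := fp.
have bf := Lp_bochner_integrable mA muA fp.
have mn := measurable_funS measurableT (@subsetT _ A) (strongly_measurable_norm mf).
have mnp := measurable_funS measurableT (@subsetT _ A) (measurable_norm_powR mf).
set a := fine (mu A); set m := `|_|.
have a0 : 0 <= a by exact: fine_ge0.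
have m0 : 0 <= m by exact: normr_ge0.
have nb : a * m <= \int[mu]_(x in A) `|f x|.
  apply: le_trans (norm_bochner_integral mA muA bf).
  rewrite /m normrZ ger0_norm ?invr_ge0//.
  have [->|an0] := eqVneq a 0; first by rewrite mul0r.
  by rewrite mulrA divff// mul1r.
have Ilty : (\int[mu]_(x in A) ((`|f x|) `^ p)%:E < +oo)%E.
  apply: le_lt_trans (integral_Lp_lty fp); apply: ge0_subset_integral => //.
  by apply/measurable_EFinP; exact: measurable_norm_powR.
have Ige0 : (0 <= \int[mu]_(x in A) ((`|f x|) `^ p)%:E)%E.
  by apply: integral_ge0 => x _; rewrite lee_fin powR_ge0.
pose J := fine (\int[mu]_(x in A) ((`|f x|) `^ p)%:E)%E.
have JE : (\int[mu]_(x in A) ((`|f x|) `^ p)%:E = J%:E)%E.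
  by rewrite /J fineK// ge0_fin_numE.
rewrite JE lee_fin.
pose c := m `^ (p - 1); have c0 : 0 <= c by exact: powR_ge0.
have young : (c%:E * \int[mu]_(x in A) (`|f x|)%:E <=
    (m `^ p / p')%:E * a%:E + (p^-1)%:E * J%:E)%E.
  have p'0 : 0 <= p'^-1.
    have : p^-1 < 1 by rewrite invf_lt1.
    by move: pp'; lra.
  have k0 : 0 <= m `^ p / p' by rewrite mulr_ge0// powR_ge0.
  rewrite -ge0_integralZl//; last exact/measurable_EFinP.
  rewrite -JE -ge0_integralZl//; last 2 first.
  - exact/measurable_EFinP.
  - by rewrite lee_fin invr_ge0 ltW.
  have -> : ((m `^ p / p')%:E * a%:E = \int[mu]_(x in A) cst (m `^ p / p')%:E x)%E.
    by rewrite integral_cst// /a fineK// ge0_fin_numE.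
  rewrite -ge0_integralD//; last 2 first.
  - by move=> x _; rewrite -EFinM lee_fin mulr_ge0 ?powR_ge0// invr_ge0 ltW.
  - by apply: measurable_funeM; exact/measurable_EFinP.
  apply: ge0_le_integral => //.
  - by move=> x _; rewrite -EFinM lee_fin mulr_ge0.
  - by apply: measurable_funeM; exact/measurable_EFinP.
  - apply: emeasurable_funD => //.
    by apply: measurable_funeM; exact/measurable_EFinP.
  move=> x _; rewrite /= -!EFinM -EFinD lee_fin [p^-1 * _]mulrC.
  exact: young_powR.
have IE : (\int[mu]_(x in A) (`|f x|)%:E = (\int[mu]_(x in A) `|f x|)%:E)%E.
  by rewrite /Rintegral fineK// ge0_fin_numE ?bf.2// integral_ge0.
move: young; rewrite IE -!EFinM -EFinD lee_fin => young.
have cm : c * m = m `^ p.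
  have [->|mn0] := eqVneq m 0; first by rewrite mulr0 powR0// gt_eqF.
  by rewrite /c powRD ?mn0 ?implybT// powRN powRr1// mulfVK.
have : c * (a * m) <= m `^ p / p' * a + p^-1 * J.
  by apply: le_trans young; exact: ler_wpM2l.
have p'E : p'^-1 = 1 - p^-1 by rewrite -pp' addrC addKr.
rewrite mulrCA cm p'E mulrBr mulr1 mulrBl [a * _]mulrC -lerBlDl opprB addrCA subrr addr0.
by rewrite mulrAC [X in _ <= X]mulrC ler_pM2r// invr_gt0.
Qed.

End jensen.

Section essential_bounds.
Context {d : measure_display} {T : measurableType d} {R : realType}
  {E : banachLatticeType R}.
Variable mu : {measure set T -> \bar R}.
Implicit Types (f : T -> E) (A B : set T).

Lemma Linfty_norm_ge0 A f : (0 <= Linfty_norm mu A f)%E.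
Proof. exact: Lnorm_ge0. Qed.

Lemma integral_norm_le_Linfty f A B : measurable A -> measurable B -> B `<=` A ->
  Linfty mu A f ->
  (\int[mu]_(x in B) (`|f x|)%:E <= (fine (Linfty_norm mu A f))%:E * mu B)%E.
Proof.
move=> mA mB BA [mf lf]; have L0 := Linfty_norm_ge0 A f.
have mn : measurable_fun B (fun x => (`|f x|)%:E).
  apply: (measurable_funS mA BA).
  exact/measurable_EFinP/measurable_norm_on.
rewrite fineK ?ge0_fin_numE//.
have [T0|T0] := ltP 0%E (mu setT); last first.
  have B0 : mu B = 0%E.
    apply/eqP; rewrite eq_le measure_ge0 andbT; apply: le_trans T0.
    by rewrite le_measure ?inE.
  by rewrite null_set_integral// B0 mule0.
rewrite -integral_cst//; apply: ae_ge0_le_integral => //.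
have [N [mN N0 hN]] := ess_sup_ge mu (fun x => `|(`|patch (fun=> 0) A f x|)%:E|)%E.
exists N; split=> // x /= h; apply: hN => /= h'; apply: h => Bx.
move: h'; rewrite /Linfty_norm unlock T0 /patch mem_set /=; last exact: BA.
by rewrite normr_id.
Qed.

Lemma Linfty_bochner_integrable f A : measurable A -> (mu A < +oo)%E ->
  Linfty mu A f -> bochner_integrable mu A f.
Proof.
move=> mA lA fA; split; first by case: fA.
apply: le_lt_trans (integral_norm_le_Linfty mA mA _ fA) _ => //.
by apply: lte_mul_pinfty; rewrite ?lee_fin ?fine_ge0 ?Linfty_norm_ge0.
Qed.

End essential_bounds.

Section atom_averages.
Context {R : realType} {d : nat} {E : banachLatticeType R}.
Variable DD : {fset dyadic_cube d}.
Hypothesis d_gt0 : (0 < d)%N.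
Variable mu : {measure set (Rd R d) -> \bar R}.
Hypothesis mu_cube : forall Q : dyadic_cube d, (mu (cube R Q) < +oo)%E.
Implicit Types (A B P Q : DD) (f : Rd R d -> E) (c : DD -> E).

Local Notation atom := (@atom R d DD).
Local Notation cube_le := (@cube_le R d DD).
Local Notation atom_mass := (@atom_mass R d DD mu).

Lemma sum_atom_mean_powR_le f (p p' : R) : 1 < p -> p^-1 + p'^-1 = 1 -> Lp mu p f ->
  ((\sum_A atom_mass A * `|atom_mean mu f A| `^ p)%:E <= \int[mu]_x ((`|f x|) `^ p)%:E)%E.
Proof.
move=> p1 pp' fp; have [mf _] := fp.
have mA := @measurable_atom R d DD; have lA := @mu_atom_lty R d DD mu mu_cube.
have mnp := measurable_norm_powR p mf.
apply: (@le_trans _ _ (\sum_A \int[mu]_(x in atom A) ((`|f x|) `^ p)%:E)%E).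
  rewrite -sumEFin; apply: lee_sum => A _.
  exact: (jensen_bochner p1 pp' (mA A) (lA A) fp).
rewrite -big_enum/= -ge0_integral_bigsetU//; last 3 first.
- exact: enum_uniq.
- exact: trivIset_atom.
- by apply: measurable_funS (measurableT) _ _ => //; exact/measurable_EFinP.
apply: ge0_subset_integral => //.
- by apply: bigsetU_measurable => A _; exact: mA.
- exact/measurable_EFinP.
Qed.

Lemma Lp_norm_step_atom_mean f (p p' : R) : 1 < p -> p^-1 + p'^-1 = 1 -> Lp mu p f ->
  (Lp_norm mu p (step (atom_mean mu f : DD -> E)) <= Lp_norm mu p f)%E.
Proof.
move=> p1 pp' fp; have p0 : 0 < p by exact: lt_trans p1.
rewrite Lp_norm_step// -(poweRe1 (Lp_norm_ge0 mu p f)) -(divff (lt0r_neq0 p0)).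
rewrite poweRrM Lp_norm_pow// -poweR_EFin.
apply: gt0_ler_poweR; rewrite ?in_itv/= ?leey ?andbT.
- by rewrite invr_ge0 ltW.
- by rewrite lee_fin sumr_ge0// => A _; rewrite mulr_ge0 ?atom_mass_ge0 ?powR_ge0.
- by apply: integral_ge0 => x _; rewrite lee_fin powR_ge0.
- exact: sum_atom_mean_powR_le pp' fp.
Qed.

Lemma norm_atom_mean_le_Linfty f A Q : cube_le A Q -> Linfty mu (cube R (val Q)) f ->
  `|atom_mean mu f A| <= fine (Linfty_norm mu (cube R (val Q)) f).
Proof.
move=> AQ fQ; set L := fine _.
have mA := @measurable_atom R d DD A; have lA := @mu_atom_lty R d DD mu mu_cube A.
have bA : bochner_integrable mu (atom A) f.
  exact: cube_atom_integrable AQ (Linfty_bochner_integrable (@measurable_cube _ _ _) (mu_cube _) fQ).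
have L0 : 0 <= L by apply: fine_ge0; exact: Linfty_norm_ge0.
rewrite /atom_mean normrZ ger0_norm ?invr_ge0 ?atom_mass_ge0//.
have [->|a0] := eqVneq (atom_mass A) 0; first by rewrite invr0 mul0r.
rewrite ler_pdivrMl ?lt_neqAle 1?eq_sym ?a0 ?atom_mass_ge0//.
apply: le_trans (norm_bochner_integral mA lA bA) _.
rewrite -lee_fin /Rintegral fineK; last first.
  by rewrite ge0_fin_numE ?bA.2// integral_ge0.
rewrite mulrC EFinM -mu_atom//.
exact: integral_norm_le_Linfty (@measurable_cube R d (val Q)) mA (atom_sub AQ) fQ.
Qed.

Lemma Linfty_norm_step_le c (Q : set (Rd R d)) (L : R) : 0 <= L -> (forall A, `|c A| <= L) ->
  (Linfty_norm mu Q (step c) <= L%:E)%E.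
Proof.
move=> L0 cL; rewrite /Linfty_norm unlock; case: ifPn => [_|]; last by rewrite lee_fin.
apply/ess_supP; apply: nearW => x /=.
rewrite lee_fin normr_id /patch; case: ifP => _; last by rewrite normr0.
have [[A xA]|nA] := pselect (exists A, atom A x); first by rewrite (stepE d_gt0 _ xA).
by rewrite step_out ?normr0// => A xA; apply: nA; exists A.
Qed.

Lemma Linfty_step c (Q : dyadic_cube d) : Linfty mu (cube R Q) (step c).
Proof.
split.
  apply: strongly_measurable_restrict; first exact: measurable_cube.
  exact/simple_strongly_measurable/simple_step.
apply: (@le_lt_trans _ _ (\sum_A `|c A|)%:E); last by rewrite ltry.
apply: Linfty_norm_step_le => [|A]; first by apply: sumr_ge0.
exact: norm_le_sum.
Qed.

End atom_averages.

Section dyadic_step.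
Context {R : realType} {d : nat} {C D : banachLatticeType R}.
Variable DD : {fset dyadic_cube d}.
Hypothesis d_gt0 : (0 < d)%N.
Variable mu : {measure set (Rd R d) -> \bar R}.
Variable lambda : dyadic_cube d -> C -> D.

Lemma dyadic_operator_step (SS : {fset dyadic_cube d}) (f : Rd R d -> C) :
  (SS `<=` DD)%fset ->
  dyadic_operator mu SS lambda f =
  step (fun B : DD => \sum_(Q : DD | (val Q \in SS) && @cube_le R d DD B Q)
    lambda (val Q) (bochner_integral mu (cube R (val Q)) f)).
Proof.
move=> sub; apply/funext => x; rewrite /dyadic_operator.
have SSE : SS = [fset Q in DD | Q \in SS]%fset.
  apply/fsetP => Q; rewrite !inE/=; apply/idP/andP => [QS|[]//].
  by split=> //; exact: (fsubsetP sub).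
rewrite {1}SSE -big_fset_condE big_seq_fsetE/=.
have [[B xB]|nB] := pselect (exists B : DD, atom B x); last first.
  rewrite step_out => [|B xB]; last by apply: nB; exists B.
  rewrite big1// => Q _; rewrite indic_scale memNset// => xQ.
  by apply: nB; have [A _ xA] := atom_cover d_gt0 xQ; exists A.
rewrite (stepE d_gt0 _ xB) [RHS]big_mkcond [LHS]big_mkcond; apply: eq_bigr => Q _.
case: (_ \in SS) => //=; rewrite indic_scale.
have [BQ|BQ] := boolP (cube_le B Q); first by rewrite mem_set//; exact: atom_sub BQ _ xB.
by rewrite memNset// => /(atom_minimal xB) h; rewrite h in BQ.
Qed.

End dyadic_step.

(** * The operator on the atoms *)

Section finite_operator.
Context {R : realType} {I : finType}.
Variables (le : rel I) (s w : I -> R).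
Hypothesis le_forest : is_forest le.
Hypothesis s_ge0 : forall A, 0 <= s A.
Hypothesis w_ge0 : forall A, 0 <= w A.

Local Notation "''L_' p ( w , c )" := ((\sum_A w A * `|c A| `^ p) `^ p^-1)
  (at level 8, p at level 2).

(** The positive dyadic operator over the cubes of [S], for functions constant on
the atoms. *)
Definition forest_operator (V W : lmodType R) (u : I -> R) (lam : I -> V -> W)
    (S : {set I}) (c : I -> V) (B : I) : W :=
  \sum_(Q in S | le B Q) lam Q (sinteg u c (below le Q)).

Lemma dual_sinteg (E : banachLatticeType R) (u : I -> R) (k : I -> dual E) U v :
  (sinteg u k U v : R) = \sum_(B in U) u B * k B v.
Proof.
rewrite /sinteg; pose h (e : dual E) : R := e v.
exact: (big_morph h (id1 := 0) (op1 := +%R)).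
Qed.

Lemma dual_near_norm (E : banachLatticeType R) (h : dual E) (e : R) : 0 < e ->
  exists2 c : E, `|c| <= 1 & `|h| - e <= h c.
Proof.
move=> e0; apply: contrapT => nh.
have M0 : 0 <= `|h| - e.
  rewrite leNgt; apply/negP => M0; apply: nh; exists 0; first by rewrite normr0.
  by rewrite linear0 ltW.
have hM (x : E) : `|x| <= 1 -> h x <= `|h| - e.
  by move=> x1; rewrite leNgt; apply/negP => /ltW hx; apply: nh; exists x.
have : `|h| <= `|h| - e.
  apply: dual_norm_le => // x; have [->|x0] := eqVneq x 0.
    by rewrite linear0 !normr0 mulr0.
  have nx : 0 < `|x| by rewrite normr_gt0.
  have h1 (y : E) : `|y| = `|x| -> h y <= (`|h| - e) * `|x|.
    move=> yx; rewrite -ler_pdivrMr// mulrC.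
    have := hM (`|x|^-1 *: y); rewrite linearZ/=; apply.
    by rewrite normrZ normfV normr_id yx mulVf// gt_eqF.
  rewrite ler_norml h1// andbT -lerN2 opprK -linearN.
  by rewrite (le_trans (h1 (- x) _))// normrN.
by rewrite lerBrDr gerDl leNgt e0.
Qed.

Lemma sum_dual_le (E : banachLatticeType R) (u : I -> R) (k : I -> dual E)
    (v : I -> E) (q q' : R) : (forall A, 0 <= u A) -> 1 < q -> q^-1 + q'^-1 = 1 ->
  \sum_B u B * k B (v B) <= 'L_q (u, v) * 'L_q' (u, k).
Proof.
move=> u0 q1 qq'; apply: le_trans (weighted_hoelder u0 q1 qq' _ _) => //.
apply: ler_sum => B _; apply: ler_wpM2l => //; rewrite mulrC.
exact: le_trans (ler_norm _) (ler_dual _ _).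
Qed.

Lemma wnorm_le (u x y : I -> R) p : 0 < p -> (forall A, 0 <= u A) ->
  (forall A, 0 <= x A) -> (forall A, x A <= y A) ->
  (\sum_A u A * x A `^ p) `^ p^-1 <= (\sum_A u A * y A `^ p) `^ p^-1.
Proof.
move=> p0 u0 x0 xy; apply: ge0_ler_powR; first by rewrite invr_ge0 ltW.
- by rewrite nnegrE sumr_ge0// => B _; rewrite mulr_ge0 ?powR_ge0.
- by rewrite nnegrE sumr_ge0// => B _; rewrite mulr_ge0 ?powR_ge0.
apply: ler_sum => B _; apply: ler_wpM2l => //.
by apply: ge0_ler_powR; rewrite ?nnegrE ?(ltW p0)// (le_trans _ (xy B)).
Qed.

Lemma wnorm_below_le (E : normedModType R) (u : I -> R) (c : I -> E) P p L :
  (forall A, 0 <= u A) -> 0 < p -> 0 <= L ->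
  (forall A, A \in below le P -> `|c A| <= L) ->
  (forall A, A \notin below le P -> c A = 0) ->
  'L_p (u, c) <= L * smass u (below le P) `^ p^-1.
Proof.
move=> u0 p0 L0 cL cP; have pn : p != 0 by rewrite gt_eqF.
have m0 := smass_ge0 (below le P) u0.
have -> : L = (L `^ p) `^ p^-1 by rewrite -powRrM divff// powRr1.
rewrite -powRM ?powR_ge0//; apply: ge0_ler_powR.
- by rewrite invr_ge0 ltW.
- by rewrite nnegrE sumr_ge0// => A _; rewrite mulr_ge0 ?powR_ge0.
- by rewrite nnegrE mulr_ge0 ?powR_ge0.
rewrite /smass mulr_sumr [leRHS]big_mkcond; apply: ler_sum => A _.
case: ifPn => [AP|AP]; last by rewrite cP// normr0 powR0// mulr0.
rewrite mulrC; apply: ler_wpM2r => //.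
by apply: ge0_ler_powR; rewrite ?nnegrE ?cL// ltW.
Qed.

Section positive_family.
Context {C D : banachLatticeType R}.
Variable lam : I -> positive_operator C D.
Local Notation op := (forest_operator s (fun Q => lam Q)).
Local Notation op' := (forest_operator w (fun Q => adjoint (lam Q))).
Local Notation form Q h k :=
  (sinteg w k (below le Q) (lam Q (sinteg s h (below le Q))) : R).

Lemma sum_dual_operator S (c : I -> C) (k : I -> dual D) :
  \sum_B w B * k B (op S c B) = \sum_(Q in S) form Q c k.
Proof.
under eq_bigr do rewrite /forest_operator linear_sum mulr_sumr.
rewrite (exchange_big_dep (mem S))/=; last by move=> B Q _ /andP[].
apply: eq_bigr => Q QS; rewrite dual_sinteg.
by apply: eq_bigl => B; rewrite QS in_below.
Qed.

Lemma sum_dual_adjoint S (c : I -> C) (k : I -> dual D) :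
  \sum_A s A * (op' S k A) (c A) = \sum_(Q in S) form Q c k.
Proof.
have opE A v : (op' S k A v : R) =
    \sum_(Q in S | le A Q) sinteg w k (below le Q) (lam Q v).
  pose h (e : dual C) : R := e v.
  exact: (big_morph h (id1 := 0) (op1 := +%R)).
under eq_bigr do rewrite opE mulr_sumr.
rewrite (exchange_big_dep (mem S))/=; last by move=> B Q _ /andP[].
apply: eq_bigr => Q QS; rewrite /(sinteg s) !linear_sum/=.
by apply: eq_big => A; rewrite ?QS ?in_below// => _; rewrite !linearZ.
Qed.

Lemma sinteg_labs_le (c c' : I -> C) (U : {set I}) :
  (forall A, A \in U -> lle (labs (c A)) (c' A)) ->
  lle (labs (sinteg s c U)) (sinteg s c' U).
Proof.
move=> cc'; apply: labs_le.
  apply: lle_sum => A AU; apply: lleZ => //; apply: lle_trans (cc' A AU).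
  exact: labs_ge.
rewrite /sinteg -sumrN; apply: lle_sum => A AU; rewrite -scalerN.
by apply: lleZ => //; apply: lle_trans (cc' A AU); exact: labs_geN.
Qed.

(** Positivity: the operator is monotone both in the function and in the family
of cubes. *)
Lemma norm_operator_le (S S' : {set I}) (c c' : I -> C) B : S \subset S' ->
  (forall A, lle 0 (c' A)) ->
  (forall Q A, Q \in S -> A \in below le Q -> lle (labs (c A)) (c' A)) ->
  `|op S c B| <= `|op S' c' B|.
Proof.
move=> /fintype.subsetP SS' c'0 cc'; apply: norm_lle.
have term0 Q : lle 0 (lam Q (sinteg s c' (below le Q))).
  by apply: posop_ge0; apply: lsum_ge0 => A _; exact: lleZ_ge0.
have term Q : Q \in S -> lle (labs (sinteg s c (below le Q))) (sinteg s c' (below le Q)).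
  by move=> QS; apply: sinteg_labs_le => A; exact: cc'.
apply: (lle_trans (\sum_(Q in S | le B Q) lam Q (sinteg s c' (below le Q)))).
  apply: labs_le.
    apply: lle_sum => Q /andP[QS _]; apply: posop_lle.
    by apply: lle_trans (term Q QS); exact: labs_ge.
  rewrite /forest_operator -sumrN; apply: lle_sum => Q /andP[QS _].
  rewrite -linearN; apply: posop_lle.
  by apply: lle_trans (term Q QS); exact: labs_geN.
rewrite /forest_operator [X in lle X _]big_mkcond [X in lle _ X]big_mkcond.
apply: lle_sum => Q _; have [QS|QS] := boolP (Q \in S).
  by rewrite SS'//; exact: llexx.
by case: ifP => // _; exact: llexx.
Qed.

Section exponents.
Variables p q p' q' : R.
Hypothesis p_gt1 : 1 < p.
Hypothesis q_gt1 : 1 < q.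
Hypothesis p'_gt1 : 1 < p'.
Hypothesis q'_gt1 : 1 < q'.
Hypothesis pp' : p^-1 + p'^-1 = 1.
Hypothesis qq' : q^-1 + q'^-1 = 1.

Let p'p : p'^-1 + p^-1 = 1. Proof. by rewrite addrC. Qed.

Lemma form_testing (T : R) (h : I -> C) (k : I -> dual D) P L :
  'L_q (w, op (below le P) h) <= T * (L * smass s (below le P) `^ p^-1) ->
  \sum_(Q in below le P) form Q h k <=
  T * L * smass s (below le P) `^ p^-1 * 'L_q' (w, k).
Proof.
move=> opT; rewrite -sum_dual_operator.
apply: le_trans (sum_dual_le k _ w_ge0 q_gt1 qq') _.
by apply: ler_wpM2r; [exact: powR_ge0|rewrite -mulrA].
Qed.

Lemma form_dual_testing (T : R) (h : I -> C) (k : I -> dual D) P L :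
  'L_p' (s, op' (below le P) k) <= T * (L * smass w (below le P) `^ q'^-1) ->
  \sum_(Q in below le P) form Q h k <=
  T * L * smass w (below le P) `^ q'^-1 * 'L_p (s, h).
Proof.
move=> opT; rewrite -sum_dual_adjoint.
apply: le_trans (sum_dual_le _ h s_ge0 p_gt1 pp') _.
by rewrite mulrC; apply: ler_wpM2r; [exact: powR_ge0|rewrite -mulrA].
Qed.

(** The operator is recovered from the form at the positive functionals
norming its values. *)
Lemma operator_bound_of_form (K : R) (c : I -> C) : 0 <= K ->
  (forall A, lle 0 (c A)) ->
  (forall k : I -> dual D, (forall A, lle 0 (k A)) ->
     \sum_Q form Q c k <= K * ('L_p (s, c) * 'L_q' (w, k))) ->
  'L_q (w, op finset.setT c) <= K * 'L_p (s, c).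
Proof.
move=> K0 c0 formK.
have v0 B : lle 0 (op finset.setT c B).
  apply: lsum_ge0 => Q _; apply: posop_ge0.
  by apply: lsum_ge0 => A _; exact: lleZ_ge0.
pose e B := sval (cid (ge0_norming_functional (v0 B))).
have [e0 e1 ev] : [/\ forall B, lle 0 (e B), forall B, `|e B| <= 1 &
    forall B, e B (op finset.setT c B) = `|op finset.setT c B|].
  by split => B; have [] := svalP (cid (ge0_norming_functional (v0 B))).
apply: (@converse_hoelder _ _ _ _ _ w_ge0 q_gt1 qq') => [A||y y0].
- exact: normr_ge0.
- by rewrite mulr_ge0 ?powR_ge0.
have := formK (fun B => y B *: e B) (fun B => lleZ_ge0 (y0 B) (e0 B)).
rewrite (eq_bigl (mem (finset.setT : {set I}))) => [|Q]; last by rewrite !inE.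
rewrite -sum_dual_operator mulrA.
rewrite (eq_bigr (fun B => w B * (`|op finset.setT c B| * y B))) => [hk|B _]; last first.
  by rewrite dualZE ev [y B * _]mulrC.
apply: le_trans hk _; apply: ler_wpM2l; first by rewrite mulr_ge0 ?powR_ge0.
apply: wnorm_le => //; first exact: lt_trans q'_gt1.
by move=> B; rewrite normrZ ger0_norm// ler_piMr.
Qed.

Section necessity.
Variable K : R.
Hypothesis K_ge0 : 0 <= K.
Hypothesis opK : forall c, 'L_q (w, op finset.setT c) <= K * 'L_p (s, c).

Lemma operator_bound_below S (c : I -> C) :
  'L_q (w, op S c) <= K * 'L_p (s, c).
Proof.
have q0 : 0 < q by exact: lt_trans q_gt1.
pose c' A := labs (c A).
have -> : 'L_p (s, c) = 'L_p (s, c').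
  by congr (_ `^ _); apply: eq_bigr => A _; rewrite norm_labs.
apply: le_trans (opK c'); apply: wnorm_le => // A.
apply: norm_operator_le; first exact: finset.subsetT.
- by move=> B; exact: labs_ge0.
- by move=> Q B _ _; exact: llexx.
Qed.

(** On the cubes inside [P] the operator only sees the part of [c] inside [P],
whose norm is controlled by its supremum and the mass of [P]. *)
Lemma testing_of_operator_bound P (c : I -> C) L : 0 <= L ->
  (forall A, A \in below le P -> `|c A| <= L) ->
  'L_q (w, op (below le P) c) <= K * (L * smass s (below le P) `^ p^-1).
Proof.
move=> L0 cL; have q0 : 0 < q by exact: lt_trans q_gt1.
have [_ _ letr _] := le_forest.
pose c' A := if A \in below le P then labs (c A) else 0.
have cc' A : A \in below le P -> c' A = labs (c A) by rewrite /c' => ->.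
apply: le_trans (_ : K * 'L_p (s, c') <= _).
  apply: le_trans (opK c'); apply: wnorm_le => // A.
  apply: norm_operator_le; first exact: finset.subsetT.
  - by move=> B; rewrite /c'; case: ifP => _; [exact: labs_ge0|exact: llexx].
  - move=> Q B; rewrite !in_below => QP BQ; rewrite cc' ?in_below; first exact: llexx.
    exact: letr BQ QP.
apply: ler_wpM2l => //; apply: wnorm_below_le => //; first exact: lt_trans p_gt1.
  by move=> A AP; rewrite cc'// norm_labs; exact: cL.
by move=> A /negbTE AP; rewrite /c' AP.
Qed.

(** Functions almost norming the values of the adjoint turn the dual testing
condition into a bound of the form. *)
Lemma dual_testing_of_operator_bound P (k : I -> dual D) L : 0 <= L ->
  (forall B, B \in below le P -> `|k B| <= L) ->
  'L_p' (s, op' (below le P) k) <= K * (L * smass w (below le P) `^ q'^-1).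
Proof.
move=> L0 kL; have p0 : 0 < p by exact: lt_trans p_gt1.
have [_ _ letr _] := le_forest.
pose k' B := if B \in below le P then k B else 0.
have -> : op' (below le P) k = op' (below le P) k'.
  apply/funext => A; apply: eq_bigr => Q /andP[QP _]; congr (adjoint _ _).
  apply: eq_bigr => B; rewrite in_below => BQ; rewrite /k' in_below.
  by move: QP; rewrite in_below => QP; rewrite (letr _ _ _ BQ QP).
set X := K * _; set H := op' _ _.
have X0 : 0 <= X by rewrite !mulr_ge0 ?powR_ge0.
apply: (@converse_hoelder _ _ _ _ _ s_ge0 p'_gt1 p'p) => [A|//|y y0].
  exact: normr_ge0.
(* an error [e'] in each value costs at most [e] in total *)
apply/ler_addgt0Pr => e e0; pose m := \sum_A s A * y A.
have m0 : 0 <= m by apply: sumr_ge0 => A _; rewrite mulr_ge0.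
pose e' := e / (1 + m); have e'0 : 0 < e' by rewrite divr_gt0// ltr_pwDl.
pose c A := sval (cid2 (dual_near_norm (H A) e'0)).
have c1 A : `|c A| <= 1 by rewrite /c; case: cid2.
have cH A : `|H A| - e' <= H A (c A) by rewrite /c; case: cid2.
apply: (@le_trans _ _ (\sum_A s A * H A (y A *: c A) + e' * m)).
  rewrite mulr_sumr -big_split/=; apply: ler_sum => A _.
  rewrite linearZ /GRing.scale/=; move: (cH A); set h := H A (c A) => hA.
  have -> : s A * (y A * h) + e' * (s A * y A) = s A * ((h + e') * y A) by ring.
  by apply: ler_wpM2l => //; apply: ler_wpM2r => //; rewrite -lerBlDr.
apply: lerD; last first.
  by rewrite /e' mulrAC ler_pdivrMr ?ltr_pwDl// ler_pM2l// lerDr.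
rewrite sum_dual_adjoint -sum_dual_operator.
apply: le_trans (sum_dual_le k' _ w_ge0 q_gt1 qq') _.
have yc : 'L_p (s, fun A => y A *: c A) <= (\sum_A s A * y A `^ p) `^ p^-1.
  by apply: wnorm_le => // A; rewrite normrZ ger0_norm// ler_piMr.
have kn : 'L_q' (w, k') <= L * smass w (below le P) `^ q'^-1.
  apply: wnorm_below_le => //; first exact: lt_trans q'_gt1.
    by move=> B BP; rewrite /k' BP; exact: kL.
  by move=> B /negbTE BP; rewrite /k' BP.
apply: (@le_trans _ _ (K * (\sum_A s A * y A `^ p) `^ p^-1 *
    (L * smass w (below le P) `^ q'^-1))); last by rewrite /X mulrAC mulrA.
apply: ler_pM; rewrite ?powR_ge0//.
apply: le_trans (operator_bound_below _ _) _.
exact: ler_wpM2l.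
Qed.

End necessity.

End exponents.
End positive_family.
End finite_operator.

(** * Testing constants and operator norms on the atoms *)

Section testing_constants.
Context {R : realType} {d : nat} {V W : banachLatticeType R}.
Variable DD : {fset dyadic_cube d}.
Hypothesis d_gt0 : (0 < d)%N.
Variables mu nu : {measure set (Rd R d) -> \bar R}.
Hypothesis mu_cube : forall Q : dyadic_cube d, (mu (cube R Q) < +oo)%E.
Hypothesis nu_cube : forall Q : dyadic_cube d, (nu (cube R Q) < +oo)%E.
Variables p q : R.
Hypothesis p_gt0 : 0 < p.
Hypothesis q_gt0 : 0 < q.
Variable lambda : dyadic_cube d -> V -> W.

Local Notation cube_le := (@cube_le R d DD).
Local Notation s := (@atom_mass R d DD mu).
Local Notation w := (@atom_mass R d DD nu).
Local Notation op := (forest_operator cube_le s (fun Q : DD => lambda (val Q))).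
Local Notation "''L_' p ( w , c )" := ((\sum_A w A * `|c A| `^ p) `^ p^-1)
  (at level 8, p at level 2).

Lemma Lp_norm_dyadic_operator (SS : {fset dyadic_cube d}) (S : {set DD})
    (f : Rd R d -> V) (c : DD -> V) : (SS `<=` DD)%fset ->
  (forall Q : DD, (val Q \in SS) = (Q \in S)) ->
  (forall Q : DD, Q \in S ->
     bochner_integral mu (cube R (val Q)) f = sinteg s c (below cube_le Q)) ->
  Lp_norm nu q (dyadic_operator mu SS lambda f) = ('L_q (w, op S c))%:E.
Proof.
move=> sub SSS fc; rewrite (dyadic_operator_step d_gt0 mu lambda f sub).
have -> : (fun B : DD => \sum_(Q : DD | (val Q \in SS) && cube_le B Q)
    lambda (val Q) (bochner_integral mu (cube R (val Q)) f)) = op S c.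
  apply/funext => B; apply: eq_big => Q; first by rewrite SSS.
  by rewrite SSS => /andP[QS _]; rewrite fc.
exact: Lp_norm_step.
Qed.

Lemma subcubes_sub (P : dyadic_cube d) : (@subcubes R d DD P `<=` DD)%fset.
Proof. by apply/fsubsetP => Q; rewrite !inE/= => /andP[]. Qed.

Lemma mem_subcubes (P Q : DD) :
  (val Q \in @subcubes R d DD (val P)) = (Q \in below cube_le P).
Proof. by rewrite in_below !inE/= fsvalP. Qed.

Lemma testing_bound (T : R) : 
  (testing_constant mu nu p q DD lambda <= T%:E)%E ->
  forall (P : DD) (c : DD -> V) (L : R), 0 <= L -> (forall A, `|c A| <= L) ->
  'L_q (w, op (below cube_le P) c) <= T * (L * smass s (below cube_le P) `^ p^-1).
Proof.
move=> hT P c L L0 cL; rewrite -lee_fin.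
apply: (ereal_inf_bound hT); first by rewrite mulr_ge0 ?powR_ge0.
move=> K [K0 hK].
have := hK _ (fsvalP P) _ (Linfty_step d_gt0 mu c (val P)).
rewrite (@Lp_norm_dyadic_operator _ (below cube_le P) _ c); last 3 first.
- exact: subcubes_sub.
- exact: mem_subcubes.
- by move=> Q _; exact: bochner_integral_step.
move=> /le_trans; apply; rewrite smass_atom_mass// poweR_EFin -muleA EFinM.
apply: lee_wpmul2l; first by rewrite lee_fin.
rewrite EFinM; apply: lee_wpmul2r; first by rewrite lee_fin powR_ge0.
exact: Linfty_norm_step_le.
Qed.

Lemma testing_constant_le (K : R) : 0 <= K ->
  (forall (P : DD) (c : DD -> V) (L : R), 0 <= L ->
     (forall A, A \in below cube_le P -> `|c A| <= L) ->
     'L_q (w, op (below cube_le P) c) <= K * (L * smass s (below cube_le P) `^ p^-1)) ->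
  (testing_constant mu nu p q DD lambda <= K%:E)%E.
Proof.
move=> K0 hK; apply: ereal_inf_lbound; exists K => //; split=> // P0 P0D f fP.
pose P : DD := [` P0D]%fset; have PE : P0 = val P by [].
rewrite PE in fP *.
have L0 := Linfty_norm_ge0 mu (cube R (val P)) f.
have mC := @measurable_cube R d.
rewrite (@Lp_norm_dyadic_operator _ (below cube_le P) _ (atom_mean mu f)); last 3 first.
- exact: subcubes_sub.
- exact: mem_subcubes.
- move=> Q; rewrite in_below => /asboolP QP; apply: bochner_integral_cube => //.
  apply: (sub_bochner_integrable (mC _) (mC _) QP).
  exact: Linfty_bochner_integrable.
rewrite smass_atom_mass// poweR_EFin -muleA.
have -> : Linfty_norm mu (cube R (val P)) f = (fine (Linfty_norm mu (cube R (val P)) f))%:E.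
  by rewrite fineK// ge0_fin_numE//; case: fP.
rewrite -!EFinM lee_fin; apply: hK; first exact: fine_ge0.
by move=> A; rewrite in_below => AP; exact: norm_atom_mean_le_Linfty.
Qed.

Lemma operator_bound_of_admissible (K : R) :
  (forall f, Lp mu p f ->
    (Lp_norm nu q (dyadic_operator mu DD lambda f) <= K%:E * Lp_norm mu p f)%E) ->
  forall c : DD -> V, 'L_q (w, op finset.setT c) <= K * 'L_p (s, c).
Proof.
move=> hK c; have := hK _ (@Lp_step _ _ DD d_gt0 mu mu_cube _ c p p_gt0).
rewrite (@Lp_norm_dyadic_operator _ finset.setT _ c); last 3 first.
- by apply/fsubsetP.
- by move=> Q; rewrite fsvalP inE.
- by move=> Q _; exact: bochner_integral_step.
by rewrite Lp_norm_step// -EFinM lee_fin.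
Qed.

End testing_constants.

Section operator_norm.
Context {R : realType} {d : nat} {C D : banachLatticeType R}.
Variable DD : {fset dyadic_cube d}.
Hypothesis d_gt0 : (0 < d)%N.
Variables sigma omega : {measure set (Rd R d) -> \bar R}.
Hypothesis sigma_cube : forall Q : dyadic_cube d, (sigma (cube R Q) < +oo)%E.
Hypothesis omega_cube : forall Q : dyadic_cube d, (omega (cube R Q) < +oo)%E.
Variables p p' q : R.
Hypothesis p_gt1 : 1 < p.
Hypothesis pp' : p^-1 + p'^-1 = 1.
Hypothesis q_gt1 : 1 < q.
Variable lambda : dyadic_cube d -> positive_operator C D.

Local Notation cube_le := (@cube_le R d DD).
Local Notation s := (@atom_mass R d DD sigma).
Local Notation w := (@atom_mass R d DD omega).
Local Notation op := (forest_operator cube_le s (fun Q : DD => lambda (val Q))).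
Local Notation "''L_' p ( w , c )" := ((\sum_A w A * `|c A| `^ p) `^ p^-1)
  (at level 8, p at level 2).

(** Averaging over the atoms does not increase the norm of a function and does
not change its image, and absolute values only increase the image. *)
Lemma opnorm_le (K : R) : 0 <= K ->
  (forall c : DD -> C, (forall A, lle 0 (c A)) ->
     'L_q (w, op finset.setT c) <= K * 'L_p (s, c)) ->
  (opnorm sigma omega p q (dyadic_operator sigma DD lambda) <= K%:E)%E.
Proof.
move=> K0 hK; apply: ereal_inf_lbound; exists K => //; split=> // f fp.
have p0 : 0 < p by exact: lt_trans p_gt1.
have q0 : 0 < q by exact: lt_trans q_gt1.
have mC := @measurable_cube R d.
rewrite (@Lp_norm_dyadic_operator _ _ _ _ DD d_gt0 _ _ omega_cube _ q0 _ _ finset.setT _ (atom_mean sigma f)); last 3 first.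
- by apply/fsubsetP.
- by move=> Q; rewrite fsvalP inE.
- move=> Q _; apply: bochner_integral_cube => //.
  exact: (Lp_bochner_integrable _ (mC _) (sigma_cube _) fp).
apply: (@le_trans _ _ (K * 'L_p (s, atom_mean sigma f))%:E); last first.
  rewrite EFinM; apply: lee_wpmul2l; first by rewrite lee_fin.
  by rewrite -Lp_norm_step//; exact: Lp_norm_step_atom_mean pp' fp.
rewrite lee_fin; pose c (A : DD) := labs (atom_mean sigma f A : C).
have -> : 'L_p (s, atom_mean sigma f) = 'L_p (s, c).
  by congr (_ `^ _); apply: eq_bigr => A _; rewrite norm_labs.
apply: le_trans (hK c _); last by move=> A; exact: labs_ge0.
apply: wnorm_le => // B; first exact: atom_mass_ge0.
apply: norm_operator_le => //.
- by move=> A; exact: atom_mass_ge0.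
- by move=> A; exact: labs_ge0.
- by move=> Q A _ _; exact: llexx.
Qed.

End operator_norm.

(** * The two-weight bound *)

Section two_weight.
Context {R : realType} {d : nat} {C D : banachLatticeType R}.
Variable DD : {fset dyadic_cube d}.
Hypothesis d_gt0 : (0 < d)%N.
Variables sigma omega : {measure set (Rd R d) -> \bar R}.
Hypothesis sigma_cube : forall Q : dyadic_cube d, (sigma (cube R Q) < +oo)%E.
Hypothesis omega_cube : forall Q : dyadic_cube d, (omega (cube R Q) < +oo)%E.
Variables p p' q q' : R.
Hypothesis p_gt1 : 1 < p.
Hypothesis p'_gt1 : 1 < p'.
Hypothesis q_gt1 : 1 < q.
Hypothesis q'_gt1 : 1 < q'.
Hypothesis pp' : p^-1 + p'^-1 = 1.
Hypothesis qq' : q^-1 + q'^-1 = 1.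
Hypothesis le_pq : p <= q.
Variable lambda : dyadic_cube d -> positive_operator C D.

Local Notation le := (@cube_le R d DD).
Local Notation s := (@atom_mass R d DD sigma).
Local Notation w := (@atom_mass R d DD omega).
Local Notation op := (forest_operator le s (fun Q : DD => lambda (val Q))).
Local Notation "''L_' p ( w , c )" := ((\sum_A w A * `|c A| `^ p) `^ p^-1)
  (at level 8, p at level 2).
Local Notation form Q h k :=
  (sinteg w k (below le Q) (lambda (val Q) (sinteg s h (below le Q))) : R).
Local Notation T := (testing_constant sigma omega p q DD lambda).
Local Notation T' :=
  (testing_constant omega sigma q' p' DD (fun Q => adjoint (lambda Q))).
Local Notation N := (opnorm sigma omega p q (dyadic_operator sigma DD lambda)).

Let le_forest : is_forest le. Proof. exact: cube_le_forest. Qed.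
Let s_ge0 A : 0 <= s A. Proof. exact: atom_mass_ge0. Qed.
Let w_ge0 A : 0 <= w A. Proof. exact: atom_mass_ge0. Qed.
Let p_gt0 : 0 < p. Proof. exact: lt_trans p_gt1. Qed.
Let q_gt0 : 0 < q. Proof. exact: lt_trans q_gt1. Qed.
Let p'_gt0 : 0 < p'. Proof. exact: lt_trans p'_gt1. Qed.
Let q'_gt0 : 0 < q'. Proof. exact: lt_trans q'_gt1. Qed.

Lemma testing_le_opnorm : (T <= N)%E.
Proof.
apply: le_ereal_inf_tmp => _ [K [K0 hK] <-].
apply: (testing_constant_le d_gt0 sigma_cube omega_cube q_gt0) => // P c L L0 cL.
apply: testing_of_operator_bound => //.
exact: (operator_bound_of_admissible d_gt0 sigma_cube omega_cube p_gt0 q_gt0 hK).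
Qed.

Lemma dual_testing_le_opnorm : (T' <= N)%E.
Proof.
apply: le_ereal_inf_tmp => _ [K [K0 hK] <-].
apply: (testing_constant_le d_gt0 omega_cube sigma_cube p'_gt0) => // P c L L0 cL.
apply: (dual_testing_of_operator_bound _ _ _ p_gt1 q_gt1) => //.
exact: (operator_bound_of_admissible d_gt0 sigma_cube omega_cube p_gt0 q_gt0 hK).
Qed.

Lemma opnorm_le_of_form (K : R) : 0 <= K ->
  (forall (c : DD -> C) (k : DD -> dual D), (forall A, lle 0 (c A)) -> (forall A, lle 0 (k A)) ->
     \sum_Q form Q c k <= K * ('L_p (s, c) * 'L_q' (w, k))) ->
  (N <= K%:E)%E.
Proof.
move=> K0 hK; apply: (opnorm_le d_gt0 sigma_cube omega_cube p_gt1 pp' q_gt1 K0) => c c0.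
apply: (operator_bound_of_form s_ge0 w_ge0 q_gt1 q'_gt1 qq' K0 c0) => k k0.
exact: hK.
Qed.

Lemma form_ge0 Q (c : DD -> C) (k : DD -> dual D) : (forall A, lle 0 (c A)) ->
  (forall A, lle 0 (k A)) -> 0 <= form Q c k.
Proof.
move=> c0 k0; have : lle 0 (sinteg w k (below le Q)).
  by apply: lsum_ge0 => A _; exact: lleZ_ge0.
rewrite dual_lleE; apply; apply: posop_ge0.
by apply: lsum_ge0 => A _; exact: lleZ_ge0.
Qed.

Lemma form_test (t : R) : (T <= t%:E)%E ->
  forall P (h : DD -> C) (k : DD -> dual D) L, 0 <= L -> (forall A, `|h A| <= L) ->
  \sum_(Q in below le P) form Q h k <=
  t * L * smass s (below le P) `^ p^-1 * 'L_q' (w, k).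
Proof.
move=> Tt P h k L L0 hL; apply: (form_testing w_ge0 q_gt1 qq').
exact: (testing_bound d_gt0 sigma_cube omega_cube q_gt0 Tt).
Qed.

Lemma form_dual_test (t : R) : (T' <= t%:E)%E ->
  forall P (h : DD -> C) (k : DD -> dual D) L, 0 <= L -> (forall A, `|k A| <= L) ->
  \sum_(Q in below le P) form Q h k <=
  t * L * smass w (below le P) `^ q'^-1 * 'L_p (s, h).
Proof.
move=> Tt P h k L L0 hL; apply: (form_dual_testing s_ge0 p_gt1 pp').
exact: (testing_bound d_gt0 omega_cube sigma_cube p'_gt0 Tt).
Qed.

Lemma opnorm_bound (t t' m m' : R) : 0 <= t -> 0 <= t' -> 0 < m -> 0 < m' ->
  (T <= t%:E)%E -> (T' <= t'%:E)%E -> (maximal_norm d C p <= m%:E)%E ->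
  (maximal_norm d (dual D) q' <= m'%:E)%E ->
  (N <= (bilinear_const p p' q' q * (m * t + m' * t'))%:E)%E.
Proof.
move=> t0 t'0 m0 m'0 Tt Tt' Mm Mm'.
have bc : 0 <= bilinear_const p p' q' q.
  by rewrite addr_ge0// mulr_ge0 ?one_sided_const_ge0// addr_ge0 ?powR_ge0.
apply: opnorm_le_of_form => [|c k c0 k0].
  by rewrite mulr_ge0// addr_ge0// mulr_ge0// ltW.
pose beta (Q : DD) (v : C) (e : dual D) : R := e (lambda (val Q) v).
apply: (@bilinear_bound R DD le le_forest C (dual D) s w c k p p' q' q t t' m m' beta) => //.
- by rewrite addrC.
- by rewrite -qq' lerD2r lef_pV2.
- exact: strong_btree_maximal d_gt0 _ (ltW _) _.
- exact: strong_btree_maximal d_gt0 _ (ltW _) _.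
- move=> Q v e v0; rewrite dual_lleE; apply; exact: posop_ge0.
- move=> Q v v' e e' v0 vv' e0 ee'; apply: (@le_trans _ _ (e (lambda (val Q) v'))).
    rewrite -subr_ge0 -linearB; move: e0; rewrite dual_lleE; apply.
    by apply/lsub_ge0; exact: posop_lle.
  move: ee'; rewrite dual_lleE; apply; apply: posop_ge0.
  exact: lle_trans vv'.
- by move=> P h k' L L0 _ _ hL; exact: form_test.
- by move=> P h k' L L0 _ _ hL; exact: form_dual_test.
Qed.

Lemma opnorm_le0_of_form :
  (forall (c : DD -> C) (k : DD -> dual D), (forall A, lle 0 (c A)) -> (forall A, lle 0 (k A)) ->
     forall Q, form Q c k <= 0) -> (N <= 0)%E.
Proof.
move=> h; apply: opnorm_le_of_form => // c k c0 k0.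
by rewrite mul0r; apply: sumr_le0 => Q _; exact: h.
Qed.

(** Each term of the form at positive functions is at most the sum over the
subcubes of its cube, which testing bounds by zero. *)
Lemma opnorm_degenerate_testing : (T <= 0)%E \/ (T' <= 0)%E -> (N <= 0)%E.
Proof.
move=> TT'; apply: opnorm_le0_of_form => c k c0 k0 Q.
have [lexx _ _ _] := le_forest.
apply: (@le_trans _ _ (\sum_(P in below le Q) form P c k)).
  rewrite (bigD1 Q) ?in_below//= lerDl sumr_ge0// => P _; exact: form_ge0.
have ge0 (V : normedModType R) (v : DD -> V) : 0 <= \sum_A `|v A| by exact: sumr_ge0.
case: TT' => [T0|T0].
  by apply: le_trans (form_test T0 Q k (ge0 _ c) (norm_le_sum c)) _; rewrite !mul0r.
by apply: le_trans (form_dual_test T0 Q c (ge0 _ k) (norm_le_sum k)) _; rewrite !mul0r.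
Qed.

(** A constant martingale is its own maximal function. *)
Lemma trivial_of_maximal_norm (E : banachLatticeType R) r : 0 < r ->
  (maximal_norm d E r <= 0)%E -> forall x : E, lle 0 x -> x = 0.
Proof.
move=> r0 M0 x x0; have := strong_btree_maximal d_gt0 r0 (lexx 0) M0 (t := BLeaf x) x0.
rewrite powR0 ?gt_eqF// mul0r /=.
have -> : ljoin 0 x = x.
  by apply: lle_anti; [apply/ljoin_lle; split=> //; exact: llexx|exact: lle_joinr].
move=> h; have e : `|x| `^ r = 0 by apply/le_anti; rewrite h powR_ge0.
exact/normr0_eq0/(powR_eq0_eq0 e).
Qed.

Lemma opnorm_degenerate_maximal :
  (maximal_norm d C p <= 0)%E \/ (maximal_norm d (dual D) q' <= 0)%E -> (N <= 0)%E.
Proof.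
move=> MM; apply: opnorm_le0_of_form => c k c0 k0 Q; case: MM => M0.
  have -> : sinteg s c (below le Q) = 0.
    by rewrite /sinteg big1// => A _; rewrite (trivial_of_maximal_norm p_gt0 M0 (c0 A)) scaler0.
  by rewrite !linear0.
have -> : sinteg w k (below le Q) = 0.
  by rewrite /sinteg big1// => A _; rewrite (trivial_of_maximal_norm q'_gt0 M0 (k0 A)) scaler0.
by rewrite dual0E.
Qed.

End two_weight.

Lemma opnorm_ge0 (R : realType) (d1 d2 : measure_display)
    (X : measurableType d1) (Y : measurableType d2) (C D : completeNormedModType R)
    (mu : {measure set X -> \bar R}) (nu : {measure set Y -> \bar R}) (p q : R)
    (S : (X -> C) -> (Y -> D)) : (0 <= opnorm mu nu p q S)%E.
Proof. by apply: le_ereal_inf_tmp => _ [K [K0 _] <-]; rewrite lee_fin. Qed.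

Lemma testing_constant_ge0 (R : realType) (d : nat) (C D : completeNormedModType R)
    (sigma omega : {measure set (Rd R d) -> \bar R}) (p q : R) DD
    (lambda : dyadic_cube d -> C -> D) :
  (0 <= testing_constant sigma omega p q DD lambda)%E.
Proof. by apply: le_ereal_inf_tmp => _ [K [K0 _] <-]; rewrite lee_fin. Qed.

Lemma maximal_norm_ge0 (R : realType) (d : nat) (E : banachLatticeType R) (p : R) :
  (0 <= maximal_norm d E p)%E.
Proof.
apply: le_trans (opnorm_ge0 (lebesgue_Rd d) (lebesgue_Rd d) p p
  (@dyadic_maximal R d E fset0)) _.
by apply: ereal_sup_ubound; exists fset0.
Qed.

Lemma conjugate_gt1 (R : realType) (p p' : R) : 1 < p -> p^-1 + p'^-1 = 1 -> 1 < p'.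
Proof.
move=> p1 pp'; have p0 : 0 < p by exact: lt_trans p1.
have pV1 : p^-1 < 1 by rewrite invf_lt1.
have pV0 : 0 < p^-1 by rewrite invr_gt0.
have p'V0 : 0 < p'^-1 by move: pp'; lra.
have p'V1 : p'^-1 < 1 by move: pp'; lra.
by rewrite -invf_lt1 // -invr_gt0.
Qed.

(** Products of extended reals have [0 * +oo = 0], so the bound for finite
nonzero constants has to be completed by the vanishing of the operator norm when
one of them is zero. *)
Lemma ereal_bound_of_finite (R : realType) (b : R) (M M' T T' N : \bar R) :
  0 <= b -> (0 <= M)%E -> (0 <= M')%E -> (0 <= T)%E -> (0 <= T')%E ->
  (M <= 0 \/ M' <= 0 -> N <= 0)%E -> (T <= 0 \/ T' <= 0 -> N <= 0)%E ->
  (forall m m' t t' : R, 0 < m -> 0 < m' -> 0 <= t -> 0 <= t' ->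
     (M <= m%:E)%E -> (M' <= m'%:E)%E -> (T <= t%:E)%E -> (T' <= t'%:E)%E ->
     (N <= (b * (m * t + m' * t'))%:E)%E) ->
  (N <= (1 + b)%:E * (M * T + M' * T'))%E.
Proof.
move=> b0 M0 M'0 T0 T'0 dM dT bound.
have MT0 : (0 <= M * T)%E by exact: mule_ge0.
have MT'0 : (0 <= M' * T')%E by exact: mule_ge0.
have b1 : 0 < 1 + b by rewrite ltr_pwDl.
have zero : (N <= 0 -> N <= (1 + b)%:E * (M * T + M' * T'))%E.
  by move=> /le_trans; apply; rewrite mule_ge0 ?adde_ge0// lee_fin ltW.
have [h|Mp] := leP M 0%E; first by apply/zero/dM; left.
have [h|M'p] := leP M' 0%E; first by apply/zero/dM; right.
have [h|Tp] := leP T 0%E; first by apply/zero/dT; left.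
have [h|T'p] := leP T' 0%E; first by apply/zero/dT; right.
have [foo|ninf] := pselect ((M * T = +oo)%E \/ (M' * T' = +oo)%E).
  have -> : (M * T + M' * T' = +oo)%E.
    case: foo => ->; [apply: addye|apply: addey];
      by rewrite gt_eqF// (lt_le_trans _ MT'0, lt_le_trans _ MT0) ?ltNy0.
  by rewrite gt0_muley ?leey// lte_fin.
have fin (x y : \bar R) : (0 < x)%E -> (0 < y)%E -> (x * y)%E <> +oo%E ->
    exists2 a : R, 0 < a & exists2 c : R, 0 < c & x = a%:E /\ y = c%:E.
  case: x => [a| |]//; case: y => [c| |]// x0 y0 h.
  - by exists a => //; exists c.
  - by exfalso; apply: h; rewrite gt0_muley.
  - by exfalso; apply: h; rewrite gt0_mulye.
have [m m0 [t t0 [ME TE]]] := fin _ _ Mp Tp (fun h => ninf (or_introl h)).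
have [m' m'0 [t' t'0 [M'E T'E]]] := fin _ _ M'p T'p (fun h => ninf (or_intror h)).
have := bound m m' t t' m0 m'0 (ltW t0) (ltW t'0); rewrite ME M'E TE T'E !lexx.
move=> /(_ isT isT isT isT)/le_trans; apply.
rewrite -!EFinM lee_fin; apply: ler_wpM2r; last by rewrite lerDr.
by rewrite addr_ge0// mulr_ge0// ltW.
Qed.

Theorem theorem1p3 (R : realType) (p q p' q' : R)
    (p_gt1 : 1 < p) (le_pq : p <= q)
    (pp' : p^-1 + p'^-1 = 1) (qq' : q^-1 + q'^-1 = 1) :
  exists K : R,
  forall (d : nat) (sigma omega : {measure set (Rd R d) -> \bar R})
    (C D : banachLatticeType R) (DD : {fset dyadic_cube d})
    (lambda : dyadic_cube d -> positive_operator C D),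
    (0 < d)%N ->
    locally_finite sigma -> locally_finite omega ->
    hardy_littlewood d C -> hardy_littlewood d (dual D) ->
    let T := testing_constant sigma omega p q DD lambda in
    let T' :=
      testing_constant omega sigma q' p' DD (fun Q => adjoint (lambda Q)) in
    let N := opnorm sigma omega p q (dyadic_operator sigma DD lambda) in
    (maxe T T' <= N /\
     N <= K%:E * (maximal_norm d C p * T + maximal_norm d (dual D) q' * T'))%E.
Proof.
have q_gt1 : 1 < q by exact: lt_le_trans le_pq.
have p'_gt1 := conjugate_gt1 p_gt1 pp'; have q'_gt1 := conjugate_gt1 q_gt1 qq'.
(* the summand 1 makes the constant positive, as infinite factors require *)
exists (1 + bilinear_const p p' q' q) => d sigma omega C D DD lambda d_gt0 lfs lfw _ _ T T' N.
have sC Q := locally_finite_cube Q lfs; have wC Q := locally_finite_cube Q lfw.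
split.
  rewrite ge_max (testing_le_opnorm DD d_gt0 sC wC p_gt1 q_gt1)/=.
  exact: (dual_testing_le_opnorm DD d_gt0 sC wC p_gt1 p'_gt1 q_gt1 q'_gt1 pp' qq').
apply: ereal_bound_of_finite.
- by rewrite addr_ge0// mulr_ge0 ?one_sided_const_ge0// addr_ge0 ?powR_ge0.
- exact: maximal_norm_ge0.
- exact: maximal_norm_ge0.
- exact: testing_constant_ge0.
- exact: testing_constant_ge0.
- exact: (opnorm_degenerate_maximal DD d_gt0 sC wC p_gt1 q_gt1 q'_gt1 pp' qq').
- exact: (opnorm_degenerate_testing d_gt0 sC wC p_gt1 p'_gt1 q_gt1 q'_gt1 pp' qq').
- move=> m m' t t' m0 m'0 t0 t'0 Mm Mm' Tt Tt'.
  exact: (opnorm_bound d_gt0 sC wC p_gt1 p'_gt1 q_gt1 q'_gt1 pp' qq' le_pq).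
Qed.
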